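(* Let $G$ be a distance-regular graph of even order, valency $k\ge 3$ and diameter $D\geq 3$. Then $G$ is $2$-extendable.
   Context: All graphs are finite, simple and undirected. A connected graph $G$ of diameter $D$ is distance-regular if there are integers $b_0,\dots,b_{D-1},c_1,\dots,c_D$ such that for all vertices $x,y$ at distance $i$, the vertex $y$ has exactly $c_i$ neighbors at distance $i-1$ from $x$ (for $1\le i\le D$) and exactly $b_i$ neighbors at distance $i+1$ from $x$ (for $0\le i\le D-1$). Such a graph is regular of valency $k=b_0$. A matching is a set of edges no two of which share a vertex; it is perfect if every vertex is incident with one of its edges. A connected graph of even order $v$ is called $t$-extendable if it contains a perfect matching, $t<v/2$, and every matching of $t$ edges is contained in some perfect matching. *)

(* Defs.v *)
From mathcomp Require Import all_boot.

Set Implicit Arguments.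
Unset Strict Implicit.
Unset Printing Implicit Defensive.

Record sgraph := SGraph {
  vertex :> finType;
  adj : rel vertex;
  adj_sym : symmetric adj;
  adj_irrefl : irreflexive adj
}.

Section Graph.
Variable G : sgraph.
Implicit Types (x y z : G) (M : {set {set G}}).

Definition connected : Prop := 0 < #|G| /\ forall x y, connect (@adj G) x y.

Definition walk (n : nat) x y : bool :=
  [exists p : n.-tuple G, path (@adj G) x p && (last x p == y)].

(* The least length of a walk from x to y. A shortest walk has fewer than #|G|
   edges, so the search is complete; the value is #|G| when y is not reachable
   from x. *)
Definition gdist x y : nat := find (fun n => walk n x y) (iota 0 #|G|).

Definition diameter : nat := \max_(x : G) \max_(y : G) gdist x y.

Definition valency (k : nat) : Prop := forall x, #|[set y | adj x y]| = k.

(* Only the values b 0, .., b (D - 1) and c 1, .., c D are constrained,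
   where D is the diameter. *)
Definition intersection_array (b c : nat -> nat) : Prop :=
  forall x y,
    (1 <= gdist x y ->
       #|[set z | adj y z & gdist x z == (gdist x y).-1]| = c (gdist x y)) /\
    (gdist x y < diameter ->
       #|[set z | adj y z & gdist x z == (gdist x y).+1]| = b (gdist x y)).

Definition distance_regular : Prop :=
  connected /\ exists b c : nat -> nat, intersection_array b c.

Definition edges : {set {set G}} :=
  [set [set p.1; p.2] | p : G * G & adj p.1 p.2].

Definition matching M : Prop := M \subset edges /\ trivIset M.

Definition perfect_matching M : Prop := matching M /\ cover M = [set: G].

Definition extendable (t : nat) : Prop :=
  [/\ connected /\ ~~ odd #|G|,
      exists M, perfect_matching M,
      t < #|G|./2 &
      forall M, matching M -> #|M| = t ->
        exists P, perfect_matching P /\ M \subset P].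

End Graph.

(* Main.v *)
Require Import Defs.
From mathcomp Require Import all_boot all_order all_algebra zify ring lra.

Set Implicit Arguments.
Unset Strict Implicit.
Unset Printing Implicit Defensive.

(** By Tutte's theorem, two disjoint edges that lie in no perfect matching give
    a set S of vertices that contains their four ends and splits the rest of the
    graph into a set P of odd blocks without edges between them, where #|S| is
    at most #|P| + 2. Counting the arcs that leave S, the cuts around the blocks
    and [arcs S S] add up to k * #|S| ([sum_cuts]), and [arcs S S] is at least
    4. A block that is a single vertex has a cut of k arcs. So this identity
    fails as soon as the other blocks have large cuts, and the proof consists of
    lower bounds for edge cuts of distance-regular graphs and of the analysis of
    the few remaining configurations.

    The cut bounds come from a flow: one unit sent from x to each vertex, evenly
    along shortest paths, loads all edges between two consecutive distances from
    x equally. The units for the vertices outside a set A all cross the boundary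
    of A, which bounds the boundary from below, either for one source x in A
    ([cut_from_vertex]) or for the average over the sources in A ([cut_wiener],
    [cut_three_levels]).

    Three cases arise. If there are triangles, their number on each edge is
    bounded by [lambda_bound]; valency 3 is then impossible, valency 4 forces an
    odd number of vertices ([odd_order]), and for larger valency all odd cuts
    but those around single vertices have at least 2 k - 1 edges ([cut_ge]), too
    many for the identity ([no_barrier_triangles]). Without triangles a cut with
    at most 3 k - 4 edges and parts of odd size at least 5 has a part that is a
    pentagon in a graph of valency 3 ([cut_small_part]). A barrier with #|S| +
    #|P| as large as possible has no blocks of size 3, and so it consists of
    single vertices, with at most one pentagon among them. In a bipartite graph
    this produces a cut with only k edges ([no_barrier_bipartite]). In a graph
    with odd cycles the vertices outside S are independent up to the pentagon
    and S spans few edges: such a nearly bipartite graph is small, since each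
    edge lies on equally many closed walks of the shortest odd length
    ([max_cut_bound]), whereas a graph of that odd girth is large
    ([card_graph_gt]). The pentagon leaves orders up to 16, which a count of
    closed walks of length 5 rules out ([five_dvd_order]). *)

(** * Hall's theorem *)

(** Hall's marriage theorem. Either some proper nonempty part Y of X has no more
    candidates than members, and then Y and its complement are matched
    separately, or every such part has a candidate to spare and an arbitrary
    first choice is harmless. The element t0 makes h total. *)
Lemma hall (I T : finType) (t0 : T) (r : I -> T -> bool) (X : {set I}) :
  (forall Y : {set I}, Y \subset X ->
     #|Y| <= #|[set t | [exists i in Y, r i t]]|) ->
  exists h : I -> T, {in X &, injective h} /\ {in X, forall i, r i (h i)}.
Proof.
have [n] := ubnP #|X|; elim: n r X => // n IHn r X ltXn hX.
have [->|[i0 Xi0]] := set_0Vmem X.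
  by exists (fun=> t0); split=> [i j|i]; rewrite inE.
pose N (Y : {set I}) := [set t | [exists i in Y, r i t]].
case: (boolP [exists Y : {set I},
   [&& Y \subset X, Y != set0, Y != X & #|N Y| <= #|Y|]]).
  (* a tight set Y: match Y inside N Y, and X :\: Y outside N Y *)
  case/existsP=> Y /and4P[sYX nY0 nYX leNY].
  have ltY : #|Y| < #|X| by apply: proper_card; rewrite properEneq nYX.
  have [|Z sZY|h1 [h1i h1r]] := IHn r Y; first by lia.
    exact/hX/(subset_trans sZY).
  have Y0 : 0 < #|Y| by rewrite card_gt0.
  have [||h2 [h2i h2r]] := IHn (fun i t => r i t && (t \notin N Y)) (X :\: Y).
  - by rewrite cardsDS //; lia.
  - move=> Z sZ.
    have dZY : [disjoint Z & Y].
      by rewrite -setI_eq0 -subset0; apply/subsetP=> i; rewrite inE;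
        case/andP=> /(subsetP sZ); rewrite inE => /andP[/negP].
    have := hX (Z :|: Y).
    have -> : Z :|: Y \subset X.
      by rewrite subUset sYX andbT; apply: subset_trans sZ _; rewrite subsetDl.
    rewrite cardsU disjoint_setI0 // cards0 subn0 => /(_ isT) hle.
    have hsub : [set t | [exists i in Z :|: Y, r i t]] \subset
      [set t | [exists i in Z, r i t && (t \notin N Y)]] :|: N Y.
      apply/subsetP=> t; rewrite inE => /existsP[i /andP[ZYi rit]].
      rewrite !inE; case: (boolP [exists j in Y, r j t]) => nt; rewrite ?orbT // orbF.
      apply/existsP; exists i.
      have nYi : i \notin Y.
        by apply: contra nt => Yi; apply/existsP; exists i; rewrite Yi.
      by move: ZYi; rewrite !inE (negbTE nYi) orbF => ->; rewrite rit.
    have := subset_leq_card hsub; rewrite cardsU.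
    by have := leNY; rewrite /N; lia.
  exists (fun i => if i \in Y then h1 i else h2 i); split.
    have h1N i : i \in Y -> h1 i \in N Y.
      by move=> Yi; rewrite inE; apply/existsP; exists i; rewrite Yi h1r.
    have h2N i : i \in X -> i \notin Y -> h2 i \notin N Y.
      by move=> Xi nYi; have /h2r/andP[] : i \in X :\: Y by rewrite inE nYi.
    move=> i j Xi Xj; case: ifPn => Yi; case: ifPn => Yj.
    + exact: h1i.
    + by move=> E; have := h2N j Xj Yj; rewrite -E h1N.
    + by move=> E; have := h2N i Xi Yi; rewrite E h1N.
    + by apply: h2i; rewrite inE ?Yi ?Yj.
  move=> i Xi; case: ifPn => Yi; first exact: h1r.
  by have /h2r/andP[] : i \in X :\: Y by rewrite inE Yi.
move/existsPn=> hstrict.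
have [t] : exists t, t \in N [set i0].
  by apply/card_gt0P; have := hX [set i0]; rewrite sub1set cards1; apply.
rewrite inE => /existsP[i1 /andP[/set1P-> rt]].
have [||h [hi hr]] := IHn (fun i s => r i s && (s != t)) (X :\ i0).
- by have := cardsD1 i0 X; rewrite Xi0; lia.
- move=> Y sY; have [->|nY0] := eqVneq Y set0; first by rewrite cards0.
  have sYX : Y \subset X by apply: subset_trans sY _; rewrite subsetDl.
  have nYX : Y != X.
    by apply: contraL Xi0 => /eqP<-; apply/negP=> /(subsetP sY); rewrite !inE eqxx.
  have := hstrict Y; rewrite sYX nY0 nYX /= -ltnNge => lt.
  have hsub : N Y \subset
    [set s | [exists i1 in Y, r i1 s && (s != t)]] :|: [set t].
    apply/subsetP=> s; rewrite inE => /existsP[j /andP[Yj rjs]]; rewrite !inE.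
    case: eqVneq => [|ns]; rewrite ?orbT // orbF.
    by apply/existsP; exists j; rewrite Yj rjs.
  by have := subset_leq_card hsub; rewrite cardsU cards1; lia.
exists (fun i => if i == i0 then t else h i); split.
  move=> i j Xi Xj; case: eqVneq => [->|ni]; case: eqVneq => [->|nj] //.
  - move=> E; have /hr/andP[_] : j \in X :\ i0 by rewrite !inE nj.
    by rewrite -E eqxx.
  - move=> E; have /hr/andP[_] : i \in X :\ i0 by rewrite !inE ni.
    by rewrite E eqxx.
  - by apply: hi; rewrite !inE ?ni ?nj.
move=> i Xi; case: eqVneq => [->|ni] //.
by have /hr/andP[] : i \in X :\ i0 by rewrite !inE ni.
Qed.

(** * Tutte's theorem *)

Section Tutte.
Variables (T : finType) (e : rel T).
Hypothesis e_sym : symmetric e.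
Implicit Types (U S C : {set T}) (P Q : {set {set T}}).

(** The blocks of P are unions of components of what S leaves of U. Arbitrary
    unions are allowed, which avoids any mention of connectedness: an odd block
    contains an odd component, so the count of odd blocks is at most the one in
    Tutte's condition. *)
Definition barrier U S P : bool :=
  [&& S \subset U, partition P (U :\: S) &
      [forall C in P, forall C' in P, forall x in C, forall y in C',
         e x y ==> (C == C')]].

Definition odd_blocks P : nat := #|[set C in P | odd #|C|]|.

Lemma barrierP U S P :
  reflect [/\ S \subset U, partition P (U :\: S) &
      forall C C' x y, C \in P -> C' \in P -> x \in C -> y \in C' ->
        e x y -> C = C'] (barrier U S P).
Proof.
apply: (iffP and3P) => [[sSU pP nP]|[sSU pP nP]]; split=> //.
  move=> C C' x y PC PC' Cx Cy exy; apply/eqP.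
  move/forall_inP: nP => /(_ C PC)/forall_inP/(_ C' PC')/forall_inP/(_ x Cx).
  by move/forall_inP/(_ y Cy)/implyP; apply.
apply/forall_inP => C PC; apply/forall_inP => C' PC'.
apply/forall_inP => x Cx; apply/forall_inP => y Cy.
by apply/implyP=> exy; apply/eqP; apply: nP exy.
Qed.

Lemma odd_blocksU1 C P : C \in P ->
  odd_blocks P = odd #|C| + odd_blocks (P :\ C).
Proof.
move=> PC; rewrite /odd_blocks (cardsD1 C) !inE PC /=; congr (_ + _).
by apply: eq_card => B; rewrite !inE; case: eqP; rewrite ?andbF.
Qed.

Lemma odd_blocksU P Q : [disjoint P & Q] ->
  odd_blocks (P :|: Q) = odd_blocks P + odd_blocks Q.
Proof.
move=> dPQ; rewrite /odd_blocks.
rewrite (_ : [set C in P :|: Q | _] =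
  [set C in P | odd #|C|] :|: [set C in Q | odd #|C|]); last first.
  by apply/setP=> C; rewrite !inE andb_orl.
rewrite cardsU disjoint_setI0 ?cards0 ?subn0 //.
apply: disjointWl (disjointWr _ dPQ); apply/subsetP=> C; rewrite inE; by case/andP.
Qed.

Lemma odd_blocks1 C : odd_blocks [set C] = odd #|C|.
Proof.
rewrite (odd_blocksU1 (set11 C)) setDv /odd_blocks.
rewrite [X in _ + X](_ : _ = 0) ?addn0 //; apply/eqP; rewrite cards_eq0.
by apply/eqP/setP=> B; rewrite !inE.
Qed.

Lemma odd_blocks_all P : {in P, forall C, odd #|C|} -> odd_blocks P = #|P|.
Proof.
move=> hP; apply: eq_card => C; rewrite inE.
by case: (boolP (C \in P)) => //= /hP ->.
Qed.

Lemma barrier_card U S P : barrier U S P -> #|U| = #|S| + \sum_(C in P) #|C|.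
Proof.
by case/barrierP=> sSU /card_partition <- _; rewrite cardsDS // subnKC // subset_leq_card.
Qed.

Lemma barrier_parity U S P : barrier U S P ->
  odd (odd_blocks P) = odd #|U| (+) odd #|S|.
Proof.
move=> /barrier_card ->; rewrite oddD addbAC addbb /odd_blocks.
rewrite -sum1_card (eq_bigl (fun C => (C \in P) && odd #|C|)) => [|C]; last first.
  by rewrite inE.
rewrite big_mkcondr !(big_morph odd oddD (erefl (odd 0))).
by apply: eq_bigr => C _; case: ifP.
Qed.

Lemma barrier_block U S P C : barrier U S P -> C \in P ->
  [/\ C != set0, C \subset U & [disjoint C & S]].
Proof.
case/barrierP=> _ pP _ PC; case/and3P: pP => /eqP cP tP n0.
have sC : C \subset U :\: S by rewrite -cP; exact: bigcup_sup.
split; first by apply: contraNneq n0 => <-.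
  exact: subset_trans sC (subsetDl _ _).
by apply: disjointWl sC _; rewrite disjoints_subset setDE subsetIr.
Qed.

Lemma refine_disjoint U S P C R Q :
  barrier U S P -> C \in P -> barrier C R Q -> [disjoint P :\ C & Q].
Proof.
move=> bP PC bQ; have [_ /and3P[_ tP nP0] _] := barrierP _ _ _ bP.
rewrite -setI_eq0; apply/eqP/setP=> B; rewrite !inE; apply/negP.
case/andP=> /andP[nBC PB] QB.
have d : [disjoint B & C] by move/trivIsetP: tP; apply.
have /negP[] : B != set0 by apply: contraNneq nP0 => <-.
have [_ sBC _] := barrier_block bQ QB.
by rewrite -subset0 -(disjoint_setI0 d) subsetI subxx.
Qed.

Lemma card_refine U S P C R Q :
  barrier U S P -> C \in P -> barrier C R Q ->
  #|P :\ C :|: Q| + 1 = #|P| + #|Q|.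
Proof.
move=> bP PC bQ; rewrite cardsU disjoint_setI0; last exact: (refine_disjoint bP PC bQ).
by rewrite cards0 subn0 [in RHS](cardsD1 C) PC addnC addnA.
Qed.

(** Barriers compose: a barrier inside a block enlarges the given one. So the
    blocks of a barrier of largest size have no profitable barriers of their
    own. *)
Lemma barrier_refine U S P C R Q :
  barrier U S P -> C \in P -> barrier C R Q ->
  [/\ barrier U (S :|: R) (P :\ C :|: Q),
      #|S :|: R| = #|S| + #|R| &
      odd_blocks (P :\ C :|: Q) + odd #|C| = odd_blocks P + odd_blocks Q].
Proof.
move=> bP PC bQ; have [C0 sCU dCS] := barrier_block bP PC.
case/barrierP: (bP) => sSU pP nP; case/barrierP: (bQ) => sRC pQ nQ.
case/and3P: (pP) => /eqP cP tP nP0; case/and3P: (pQ) => /eqP cQ tQ nQ0.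
have sQC B : B \in Q -> B \subset C.
  by move=> QB; have [] := barrier_block bQ QB.
have dPC B : B \in P :\ C -> [disjoint B & C].
  by rewrite !inE => /andP[nBC PB]; move/trivIsetP: tP; apply.
have dPQ := refine_disjoint bP PC bQ.
split; last first.
- by rewrite (odd_blocksU dPQ) (odd_blocksU1 PC) addnAC [odd _ + _]addnC.
- rewrite cardsU disjoint_setI0 ?cards0 ?subn0 //.
  by rewrite disjoint_sym; apply: disjointWl sRC _.
apply/barrierP; split.
- by rewrite subUset sSU (subset_trans sRC).
- apply/and3P; split.
  + apply/eqP/setP=> x; rewrite !inE; apply/bigcupP/idP.
      case=> B; rewrite !inE => /orP[/andP[nBC PB] Bx|QB Bx].
        have [_ sBU dBS] := barrier_block bP PB.
        rewrite (subsetP sBU) // andbT (disjointFr dBS) //=.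
        apply/negP=> Rx; have := dPC B; rewrite !inE nBC PB => /(_ isT) d.
        by have := disjointFr d Bx; rewrite (subsetP sRC).
      have [_ sB dB] := barrier_block bQ QB.
      have Cx := subsetP sB _ Bx.
      by rewrite (disjointFr dB) // (disjointFr dCS) // (subsetP sCU).
    rewrite negb_or => /andP[/andP[nSx nRx] Ux].
    case: (boolP (x \in C)) => Cx.
      have : x \in cover Q by rewrite cQ inE nRx.
      by case/bigcupP=> B QB Bx; exists B; rewrite // !inE QB orbT.
    have : x \in cover P by rewrite cP inE nSx.
    case/bigcupP=> B PB Bx; exists B; rewrite // !inE PB andbT.
    by rewrite (_ : B != C) //; apply: contraNneq Cx => <-.
  + apply/trivIsetP=> A B /setUP[PA|QA] /setUP[PB|QB] nAB.
    * move/trivIsetP: tP; apply=> //; [by case/setD1P: PA|by case/setD1P: PB].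
    * exact: disjointWr (sQC _ QB) (dPC _ PA).
    * by rewrite disjoint_sym; exact: disjointWr (sQC _ QA) (dPC _ PB).
    * by move/trivIsetP: tQ; apply.
  + by rewrite !inE (negbTE nQ0) orbF (negbTE nP0) andbF.
- have hPQ A B x y : A \in P :\ C -> B \in Q -> x \in A -> y \in B -> e x y -> A = B.
    case/setD1P=> nAC PA QB Ax By exy.
    by case/eqP: nAC; apply: nP exy; rewrite // (subsetP (sQC _ QB)).
  move=> A B x y /setUP[PA|QA] /setUP[PB|QB] Ax By exy.
  + by apply: nP exy; rewrite //; [case/setD1P: PA|case/setD1P: PB].
  + exact: hPQ exy.
  + by symmetry; apply: (hPQ B A y x) => //; rewrite e_sym.
  + exact: nQ exy.
Qed.

Lemma barrier_block1 C : C != set0 -> barrier C set0 [set C].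
Proof.
move=> C0; apply/barrierP; split; rewrite ?sub0set //.
  apply/and3P; split; first by rewrite /cover big_set1 setD0.
    by apply/trivIsetP=> A B /set1P-> /set1P->; rewrite eqxx.
  by rewrite inE eq_sym.
by move=> A B x y /set1P-> /set1P->.
Qed.

Lemma barrierU1 C v R Q : v \in C -> barrier (C :\ v) R Q ->
  barrier C (v |: R) Q /\ #|v |: R| = #|R|.+1.
Proof.
move=> Cv bQ; case/barrierP: (bQ) => sR pQ nQ.
have nRv : v \notin R by apply/negP=> /(subsetP sR); rewrite !inE eqxx.
split; last by rewrite cardsU1 nRv.
apply/barrierP; split=> //.
  by rewrite subUset sub1set Cv (subset_trans sR) // subsetDl.
by rewrite -setDDl.
Qed.

Definition perfectly_matched U : Prop := exists f : T -> T,
  {in U, forall x, [/\ f x \in U, e x (f x) & f (f x) = x]}.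

Lemma perfectly_matched_cover P : trivIset P ->
  {in P, forall C, perfectly_matched C} -> perfectly_matched (cover P).
Proof.
move=> tP hP.
have [F hF] : exists F : {set T} -> T -> T, forall C, C \in P ->
    {in C, forall x, [/\ F C x \in C, e x (F C x) & F C (F C x) = x]}.
  apply: (@fin_all_exists _ (fun=> T -> T) (fun C f => C \in P ->
    {in C, forall x, [/\ f x \in C, e x (f x) & f (f x) = x]})) => C.
  case: (boolP (C \in P)) => [/hP[f hf]|_].
    by exists f.
  by exists id.
exists (fun x => F (pblock P x) x) => x cx.
have PB := pblock_mem cx; have Bx : x \in pblock P x by rewrite mem_pblock.
have [BF exF FF] := hF _ PB x Bx.
split=> //; last by rewrite (def_pblock tP PB BF).
by apply/bigcupP; exists (pblock P x).
Qed.

Lemma perfectly_matchedU1 C v y : v \in C -> y \notin C -> e v y ->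
  perfectly_matched (C :\ v) -> perfectly_matched (y |: C).
Proof.
move=> Cv nCy evy [f hf].
have nvy : v != y by apply: contraNneq nCy => <-.
exists (fun x => if x == v then y else if x == y then v else f x) => x.
case/setU1P=> [->|Cx].
  by rewrite eq_sym (negbTE nvy) !eqxx !inE Cv orbT e_sym.
case: (eqVneq x v) => [->|nxv].
  by rewrite eq_sym (negbTE nvy) !eqxx !inE eqxx.
have nxy : x != y by apply: contraNneq nCy => <-.
rewrite (negbTE nxy).
have /hf[fx exf ffx] : x \in C :\ v by rewrite !inE nxv.
case/setD1P: fx => nfv Cf.
have nfy : f x != y by apply: contraNneq nCy => <-.
by rewrite (negbTE nfv) (negbTE nfy) !inE Cf orbT.
Qed.

(** Tutte's theorem. A barrier that is tight (with as many odd blocks as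
    vertices) and of largest size has only odd blocks, each block minus any
    vertex is perfectly matched by induction, and Hall's theorem matches the
    blocks to the vertices of the barrier. *)
Theorem tutte U :
  (forall S P, barrier U S P -> odd_blocks P <= #|S|) -> perfectly_matched U.
Proof.
have [n] := ubnP #|U|; elim: n U => // n IHn U ltU hU.
have [->|[u0 Uu0]] := set_0Vmem U; first by exists id => x; rewrite inE.
have U0 : U != set0 by apply/set0Pn; exists u0.
pose tight p := barrier U p.1 p.2 && (odd_blocks p.2 == #|p.1|).
have tight0 : tight (set0, [set U]).
  have b := barrier_block1 U0; rewrite /tight b /= cards0.
  by have := hU _ _ b; rewrite cards0 leqn0.
case: (arg_maxnP (fun p : {set T} * {set {set T}} => #|p.1|) tight0).
case=> S P /= /andP[/= bP /eqP oP] maxP.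
have {}maxP S' P' : barrier U S' P' -> #|S'| <= odd_blocks P' -> #|S'| <= #|S|.
  move=> b' le'; apply: (maxP (S', P')).
  by rewrite /tight /= b' eqn_leq le' hU.
have oddP : {in P, forall C, odd #|C|}.
  move=> C PC; apply: contraT => evC.
  have [/set0Pn[v Cv] _ _] := barrier_block bP PC.
  have Cv0 : C :\ v != set0.
    by apply: contraNneq evC => E; rewrite (cardsD1 v) Cv E cards0.
  have [b1 c1] := barrierU1 Cv (barrier_block1 Cv0).
  have [b2 c2] := barrier_refine bP PC b1.
  rewrite odd_blocks1 (negbTE evC) => o2.
  have := maxP _ _ b2; move: evC o2; rewrite (cardsD1 v) Cv /= negbK => ->.
  by rewrite c2 c1 cards0 oP; clear; lia.
have pmC C v : C \in P -> v \in C -> perfectly_matched (C :\ v).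
  move=> PC Cv; have [_ sCU _] := barrier_block bP PC.
  apply: IHn => [|R Q bQ].
    by have := subset_leq_card sCU; rewrite (cardsD1 v) Cv; lia.
  rewrite leqNgt; apply/negP=> ltQ.
  have [b1 c1] := barrierU1 Cv bQ.
  have [b2 c2] := barrier_refine bP PC b1.
  rewrite (oddP _ PC) => o2.
  have p1 := barrier_parity bQ; have := oddP _ PC.
  rewrite (cardsD1 v) Cv oddS => p2.
  move: (maxP _ _ b2) o2 ltQ p1 p2; rewrite c2 c1 oP.
  by case: (odd #|C :\ v|) => //; clear; lia.
have cardP : #|P| = #|S| by rewrite -oP odd_blocks_all.
have [sSU pP nP] := barrierP _ _ _ bP.
case/and3P: (pP) => /eqP cP tP nP0.
pose r (C : {set T}) y := (y \in S) && [exists x in C, e x y].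
have [|h [h_inj hr]] := @hall _ _ u0 r P.
  move=> Y sYP; set N := [set _ | _].
  have sNS : N \subset S.
    by apply/subsetP=> y; rewrite inE => /existsP[C /andP[_ /andP[]]].
  (* N is a barrier with the blocks in Y and one block for everything else *)
  pose Z := U :\: N :\: cover Y.
  pose P' := Y :|: (if Z == set0 then set0 else [set Z]).
  have P'P B : B \in P' -> B \in Y \/ B = Z /\ Z != set0.
    by rewrite inE => /orP[|]; [left|case: ifPn => Z0; rewrite inE // => /eqP; right].
  have Ycov B x : B \in Y -> x \in B -> x \in cover Y.
    by move=> YB Bx; apply/bigcupP; exists B.
  have YZ B x y : B \in Y -> x \in B -> y \in Z -> e x y -> False.
    move=> YB Bx; rewrite !inE => /andP[ncy /andP[nNy Uy]] exy.
    have PB := subsetP sYP _ YB.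
    case: (boolP (y \in S)) => Sy.
      by case/existsP: nNy; exists B; rewrite YB /r Sy; apply/existsP; exists x; rewrite Bx.
    have : y \in cover P by rewrite cP inE Sy.
    case/bigcupP=> C PC Cy; have E := nP _ _ _ _ PB PC Bx Cy exy.
    by case/negP: ncy; apply: (Ycov B); rewrite // E.
  have b' : barrier U N P'.
    apply/barrierP; split; first exact: subset_trans sNS sSU.
      apply/and3P; split.
      - apply/eqP/setP=> x; apply/bigcupP/idP.
          case=> B /P'P[YB|[-> _]] Bx; last by move: Bx; rewrite !inE; case/andP.
          have PB := subsetP sYP _ YB; have [_ sBU dBS] := barrier_block bP PB.
          rewrite inE (subsetP sBU) // andbT.
          by apply/negP=> /(subsetP sNS); rewrite (disjointFr dBS).
        move=> UNx; case: (boolP (x \in cover Y)) => [/bigcupP[B YB Bx]|ncx].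
          by exists B; rewrite // inE YB.
        have Zx : x \in Z by rewrite inE ncx.
        exists Z; rewrite // inE; case: eqP => [E|_]; last by rewrite set11 orbT.
        by rewrite E inE in Zx.
      - have dYZ B : B \in Y -> [disjoint B & Z].
          move=> YB; rewrite -setI_eq0; apply/eqP/setP=> x; rewrite 2!inE in_set0.
          by apply/negP=> /andP[Bx /andP[/negP[]]]; exact: Ycov Bx.
        apply/trivIsetP=> A B /P'P[YA|[-> _]] /P'P[YB|[-> _]] //.
        + by move/trivIsetP: tP; apply; apply: (subsetP sYP).
        + by move=> _; exact: dYZ.
        + by move=> _; rewrite disjoint_sym; exact: dYZ.
        + by rewrite eqxx.
      - apply/negP=> /P'P[/(subsetP sYP)|[E]]; first by rewrite (negbTE nP0).
        by rewrite -E eqxx.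
    move=> A B x y /P'P[YA|[-> _]] /P'P[YB|[-> _]] Ax By exy //.
    - by apply: nP exy; rewrite // (subsetP sYP).
    - by case: (YZ _ _ _ YA Ax By exy).
    - by rewrite e_sym in exy; case: (YZ _ _ _ YB By Ax exy).
  apply: leq_trans (hU _ _ b'); apply: subset_leq_card; apply/subsetP=> C YC.
  by rewrite !inE YC oddP // (subsetP sYP).
have hS : h @: P = S.
  apply/eqP; rewrite eqEcard card_in_imset // cardP leqnn andbT.
  by apply/subsetP=> _ /imsetP[C PC ->]; case/andP: (hr _ PC).
pose W := [set h C |: C | C in P].
have dhC C C' : C \in P -> C' \in P -> h C \in C' -> False.
  move=> PC PC' hC; have [_ _ d] := barrier_block bP PC'.
  by have := disjointFr d hC; case/andP: (hr _ PC) => ->.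
have tW : trivIset W.
  apply/trivIsetP=> _ _ /imsetP[C PC ->] /imsetP[C' PC' ->] nCC'.
  have nC : C != C' by apply: contraNneq nCC' => ->.
  rewrite -setI_eq0; apply/eqP/setP=> x; rewrite !inE; apply/negP.
  case/andP=> /orP[/eqP->|Cx] /orP[/eqP E|C'x].
  - by case/eqP: nC; apply: h_inj.
  - exact: dhC PC PC' C'x.
  - by rewrite E in Cx; exact: dhC PC' PC Cx.
  - move/trivIsetP: tP => /(_ _ _ PC PC' nC) d.
    by rewrite (disjointFr d) in C'x.
have cW : cover W = U.
  apply/setP=> x; apply/bigcupP/idP.
    case=> _ /imsetP[C PC ->] /setU1P[->|Cx].
      by apply: (subsetP sSU); case/andP: (hr _ PC).
    by have [_ sCU _] := barrier_block bP PC; exact: (subsetP sCU).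
  move=> Ux; case: (boolP (x \in S)) => Sx.
    move: Sx; rewrite -hS => /imsetP[C PC ->].
    by exists (h C |: C); [apply/imsetP; exists C|rewrite setU11].
  have : x \in cover P by rewrite cP inE Sx.
  case/bigcupP=> C PC Cx.
  by exists (h C |: C); [apply/imsetP; exists C|rewrite setU1r].
rewrite -cW; apply: perfectly_matched_cover => // _ /imsetP[C PC ->].
case/andP: (hr _ PC) => _ /existsP[v /andP[Cv evh]].
apply: perfectly_matchedU1 Cv _ evh (pmC _ _ PC Cv).
by apply/negP; exact: dhC.
Qed.

End Tutte.

(** * The graph metric *)

Section Metric.
Variable G : sgraph.
Hypothesis conn : connected G.
Implicit Types x y z : G.
Local Notation d := (@gdist G).
Local Notation D := (diameter G).

Lemma walkP n x y :
  reflect (exists p, [/\ path (@adj G) x p, last x p = y & size p = n])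
          (walk n x y).
Proof.
apply: (iffP existsP) => [[p /andP[pp /eqP lp]]|[p [pp lp /eqP sp]]].
  by exists p; rewrite size_tuple.
by exists (Tuple sp); rewrite /= pp lp eqxx.
Qed.

Lemma walk_gdist x y : walk (d x y) x y /\ d x y < #|G|.
Proof.
have hs : has (fun n => walk n x y) (iota 0 #|G|).
  case: conn => _ /(_ x y)/connectP[p pp ->].
  case/shortenP: pp => q qp uq _; apply/hasP; exists (size q).
    rewrite mem_iota add0n /=.
    by move/card_uniqP: uq => /= <-; exact: max_card.
  by apply/walkP; exists q.
have lt : d x y < #|G| by rewrite -[ltnRHS](size_iota 0) -has_find.
by split=> //; have := nth_find 0 hs; rewrite nth_iota.
Qed.

Lemma gdist_le n x y : walk n x y -> d x y <= n.
Proof.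
move=> w; have [_ lt] := walk_gdist x y.
rewrite leqNgt; apply/negP=> ltn; have := before_find 0 ltn.
by rewrite nth_iota ?add0n ?w //; exact: ltn_trans lt.
Qed.

Lemma gdistxx x : d x x = 0.
Proof. by apply/eqP; rewrite -leqn0; apply/gdist_le/walkP; exists [::]. Qed.

Lemma gdist_eq0 x y : (d x y == 0) = (x == y).
Proof.
apply/eqP/eqP => [E|->]; last exact: gdistxx.
have [/walkP[p [_ lp sp]] _] := walk_gdist x y.
by move: sp lp; rewrite E => /size0nil ->.
Qed.

Lemma gdist_sym x y : d x y = d y x.
Proof.
suff le u v : d u v <= d v u by apply/eqP; rewrite eqn_leq !le.
have [/walkP[p [pp lp <-]] _] := walk_gdist v u; rewrite -{}lp.
apply/gdist_le/walkP; exists (rev (belast v p)).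
rewrite rev_path size_rev size_belast; split=> //.
  by rewrite (eq_path (e' := @adj G)) // => a b; exact: adj_sym.
by case: p {pp} => //= a p; rewrite rev_cons last_rcons.
Qed.

Lemma gdist_triangle y x z : d x z <= d x y + d y z.
Proof.
have [/walkP[p [pp lp sp]] _] := walk_gdist x y.
have [/walkP[q [pq lq sq]] _] := walk_gdist y z.
apply/gdist_le/walkP; exists (p ++ q).
by rewrite cat_path last_cat size_cat pp lp pq sp sq.
Qed.

Lemma gdist1 x y : (d x y == 1) = adj x y.
Proof.
apply/eqP/idP=> [E|xy].
  have [/walkP[p [pp lp sp]] _] := walk_gdist x y; move: sp pp lp; rewrite E.
  by case: p => [|a []] //= _; rewrite andbT => ? <-.
apply/eqP; rewrite eqn_leq; apply/andP; split.
  by apply/gdist_le/walkP; exists [:: y]; rewrite /= xy.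
by rewrite lt0n gdist_eq0; apply: contraTneq xy => ->; rewrite adj_irrefl.
Qed.

Lemma gdist_adj x y z : adj y z -> d x z <= (d x y).+1 /\ d x y <= (d x z).+1.
Proof.
move=> yz; have /eqP E : d y z == 1 by rewrite gdist1.
have := gdist_triangle y x z; have := gdist_triangle z x y.
by rewrite (gdist_sym z y) E !addn1.
Qed.

Lemma gdist_pred x y n : d x y = n.+1 -> exists2 z, adj z y & d x z = n.
Proof.
move=> E; have [/walkP[p [pp lp sp]] _] := walk_gdist x y; move: sp pp lp.
rewrite E; elim/last_ind: p => // p y' _; rewrite size_rcons => -[sp].
rewrite rcons_path last_rcons => /andP[pp zy] Ey; rewrite {}Ey in zy *.
exists (last x p) => //; apply/eqP; rewrite eqn_leq -{1}sp; apply/andP; split.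
  by apply/gdist_le/walkP; exists p.
by have [] := gdist_adj x zy; rewrite E.
Qed.

(** Every distance up to the one between two vertices is realised on a shortest
    path. *)
Lemma gdist_between x y i : i <= d x y -> exists2 z, d x z = i & d z y = d x y - i.
Proof.
move=> le; have [m Em] : exists m, d x y = i + m by exists (d x y - i); lia.
rewrite Em addKn.
elim: m y Em {le} => [|m IH] y Em; first by exists y; rewrite ?gdistxx ?Em ?addn0.
have [y' ay' Ey'] := gdist_pred (etrans Em (addnS i m)).
have [z Ez Ezy] := IH _ Ey'; exists z => //.
apply/eqP; rewrite eqn_leq; apply/andP; split.
  by have [] := gdist_adj z ay'; rewrite Ezy.
by have := gdist_triangle z x y; rewrite Em Ez; lia.
Qed.

Lemma gdist_max x y : d x y <= D.
Proof.
apply: leq_trans (leq_bigmax x).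
exact: (leq_bigmax (F := fun y => d x y) y).
Qed.

Lemma diameter_attained : exists x y, d x y = D.
Proof.
have [G0 _] := conn; have [x0 _] : exists x : G, true.
  by case/card_gt0P: G0 => x _; exists x.
have [x Ex] := eq_bigmax (fun x : G => \max_(y : G) d x y) G0.
have [y Ey] := eq_bigmax (fun y : G => d x y) G0.
by exists x, y; rewrite /D Ex Ey.
Qed.

End Metric.

(** * Degrees into a set and arcs between sets *)

Section Degree.
Variable G : sgraph.
Implicit Types (x y z : G) (A B C : {set G}).

Definition deg_in x B : nat := #|[set y in B | adj x y]|.

Definition arcs A B : nat := \sum_(x in A) deg_in x B.

Lemma deg_inE x B : deg_in x B = \sum_(y in B) adj x y.
Proof.
by rewrite /deg_in -sum1dep_card big_mkcondr; apply: eq_bigr => y _; case: adj.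
Qed.

Lemma arcsC A B : arcs A B = arcs B A.
Proof.
rewrite /arcs; under eq_bigr do rewrite deg_inE.
rewrite exchange_big; apply: eq_bigr => y _; rewrite deg_inE.
by apply: eq_bigr => x _; rewrite adj_sym.
Qed.

Lemma deg_in_sub x A B : A \subset B -> deg_in x A <= deg_in x B.
Proof.
by move=> sAB; apply/subset_leq_card/subsetP=> y; rewrite !inE => /andP[/(subsetP sAB)->].
Qed.

Lemma deg_inU x A B : [disjoint A & B] -> deg_in x (A :|: B) = deg_in x A + deg_in x B.
Proof.
by move=> dAB; rewrite !deg_inE -bigU //=; apply: eq_bigl => y; rewrite !inE.
Qed.

Lemma deg_inC k x A : valency G k -> deg_in x A + deg_in x (~: A) = k.
Proof.
move=> hk; rewrite -deg_inU ?setUCr -?setI_eq0 ?setICr // -(hk x).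
by apply: eq_card => y; rewrite !inE.
Qed.

Lemma arcsUr A B C : [disjoint B & C] -> arcs A (B :|: C) = arcs A B + arcs A C.
Proof.
by move=> dBC; rewrite /arcs -big_split; apply: eq_bigr => x _; rewrite deg_inU.
Qed.

Lemma arcsUl A B C : [disjoint A & B] -> arcs (A :|: B) C = arcs A C + arcs B C.
Proof. by move=> dAB; rewrite -!(arcsC C) arcsUr. Qed.

Lemma arcs_valency k A : valency G k -> arcs A A + arcs A (~: A) = k * #|A|.
Proof.
move=> hk; rewrite /arcs -big_split /= -sum1_card big_distrr /=.
by apply: eq_bigr => x _; rewrite (deg_inC _ _ hk) muln1.
Qed.

Lemma odd_arcs A : ~~ odd (arcs A A).
Proof.
pose f := fun x => enum_rank x : nat.
suff -> : arcs A A = (\sum_(x in A) #|[set y in A | adj x y && (f x < f y)]|).*2.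
  by rewrite odd_double.
rewrite -addnn {2}(_ : \sum_(x in A) _ = \sum_(x in A) #|[set y in A | adj x y && (f y < f x)]|).
  rewrite -big_split; apply: eq_bigr => x _; rewrite /deg_in /= -cardsUI.
  rewrite [X in _ + X](_ : _ = 0) ?addn0; last first.
    apply/eqP; rewrite cards_eq0; apply/eqP/setP=> y; rewrite !inE.
    by case: (ltngtP (f x) (f y)); rewrite ?andbF.
  apply: eq_card => y; rewrite !inE; case: (boolP (y \in A)) => //= _.
  case: (boolP (adj x y)) => //= xy; case: (ltngtP (f x) (f y)) => // E.
  by move/ord_inj/enum_rank_inj: E xy => ->; rewrite adj_irrefl.
under eq_bigr => x _ do rewrite -sum1dep_card big_mkcondr.
under [in RHS]eq_bigr => x _ do rewrite -sum1dep_card big_mkcondr.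
rewrite exchange_big; apply: eq_bigr => y _; apply: eq_bigr => x _.
by rewrite adj_sym.
Qed.

End Degree.

(** The values b and c are fixed at all distances, so that c 0 = 0 and b D = 0
    for the diameter D. Counts of neighbours then need no range conditions. *)
Definition drg (G : sgraph) (k : nat) (b c : nat -> nat) : Prop :=
  [/\ connected G, valency G k,
      forall x y : G, #|[set z | adj y z & (gdist x z).+1 == gdist x y]| = c (gdist x y) &
      forall x y : G, #|[set z | adj y z & gdist x z == (gdist x y).+1]| = b (gdist x y)].

Lemma distance_regular_drg (G : sgraph) k :
  distance_regular G -> valency G k -> exists b c, drg G k b c.
Proof.
case=> conn [b [c arr]] hk.
exists (fun i => if i < diameter G then b i else 0), (fun i => if 0 < i then c i else 0).
split=> // x y; have [hc hb] := arr x y.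
  case: ifP => [h|]; last first.
    move/negbT; rewrite lt0n negbK => /eqP ->; apply/eqP; rewrite cards_eq0.
    by apply/eqP/setP=> z; rewrite !inE andbF.
  by rewrite -(hc h); apply: eq_card => z; rewrite !inE; congr (_ && _); lia.
case: ifP => [h|h]; first exact: hb.
apply/eqP; rewrite cards_eq0; apply/eqP/setP=> z; rewrite !inE.
apply/negP=> /andP[_ /eqP E].
by have := gdist_max x z; have := gdist_max x y; lia.
Qed.

(** * Intersection numbers *)

Section IntersectionNumbers.
Variables (G : sgraph) (k : nat) (b c : nat -> nat).
Hypothesis hG : drg G k b c.
Implicit Types x y z w : G.
Local Notation d := (@gdist G).
Local Notation D := (diameter G).

Let conn : connected G. Proof. by case: hG. Qed.
Let hk : valency G k. Proof. by case: hG. Qed.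

(** The subtractions are exact up to the diameter, by [bca_sum]. *)
Definition a_ i := k - b i - c i.

Definition sphere x i : {set G} := [set y | d x y == i].

Lemma card_c x y : deg_in y [set z | (d x z).+1 == d x y] = c (d x y).
Proof.
by case: hG => _ _ <- _; apply: eq_card => z; rewrite !inE andbC.
Qed.

Lemma card_b x y : deg_in y (sphere x (d x y).+1) = b (d x y).
Proof.
by case: hG => _ _ _ <-; apply: eq_card => z; rewrite !inE andbC.
Qed.

Lemma card_bca x y :
  c (d x y) + deg_in y (sphere x (d x y)) + b (d x y) = k.
Proof.
rewrite -card_c -card_b -(hk y) -!deg_inU.
- apply: eq_card => z; rewrite !inE; case: (boolP (adj y z)) => yz; rewrite ?andbF //.
  by have [h1 h2] := gdist_adj conn x yz; lia.
- by rewrite -setI_eq0; apply/eqP/setP=> z; rewrite !inE; lia.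
- by rewrite -setI_eq0; apply/eqP/setP=> z; rewrite !inE; lia.
Qed.

Lemma card_a x y : deg_in y (sphere x (d x y)) = a_ (d x y).
Proof. by rewrite /a_; have := card_bca x y; lia. Qed.

Lemma dist_pair i : i <= D -> exists x y, d x y = i.
Proof.
have [x [y E]] := diameter_attained conn; rewrite -E => le.
by have [z Ez _] := gdist_between conn le; exists x, z.
Qed.

Lemma bca_sum i : i <= D -> c i + a_ i + b i = k.
Proof. by case/dist_pair=> x [y <-]; rewrite -(card_a x y) card_bca. Qed.

Lemma c0 : c 0 = 0.
Proof.
have [G0 _] := conn; case/card_gt0P: G0 => x _.
rewrite -{1}(gdistxx conn x) -card_c; apply/eqP; rewrite /deg_in cards_eq0.
by apply/eqP/setP=> z; rewrite !inE gdistxx ?andbF.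
Qed.

Lemma a0 : a_ 0 = 0.
Proof.
have [G0 _] := conn; case/card_gt0P: G0 => x _.
rewrite -{1}(gdistxx conn x) -card_a; apply/eqP; rewrite /deg_in cards_eq0.
apply/eqP/setP=> z; rewrite !inE gdistxx // gdist_eq0 //.
by case: eqP => //= <-; rewrite adj_irrefl.
Qed.

Lemma b0 : b 0 = k.
Proof. by have := bca_sum (leq0n D); rewrite c0 a0; lia. Qed.

Lemma bD : b D = 0.
Proof.
have [x [y E]] := diameter_attained conn; rewrite -E -card_b.
apply/eqP; rewrite /deg_in cards_eq0; apply/eqP/setP=> z; rewrite !inE E.
by apply/negP=> /andP[/eqP F _]; have := gdist_max x z; lia.
Qed.

Lemma c_gt0 i : 0 < i <= D -> 0 < c i.
Proof.
case: i => // i /andP[_ /dist_pair[x [y E]]].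
have [z zy Ez] := gdist_pred conn E.
rewrite -E -card_c; apply/card_gt0P; exists z.
by rewrite !inE Ez E eqxx adj_sym.
Qed.

Lemma b_gt0 i : i < D -> 0 < b i.
Proof.
case/dist_pair=> x [y E]; have [z zy Ez] := gdist_pred conn E.
by rewrite -Ez -card_b; apply/card_gt0P; exists y; rewrite !inE Ez E eqxx.
Qed.

Lemma c1 : 0 < D -> c 1 = 1.
Proof.
move=> D0; have [x [y E]] := dist_pair D0; rewrite -{1}E -card_c -(cards1 x).
apply: eq_card => z; rewrite !inE E eqSS gdist_eq0 // eq_sym.
by case: eqP => //= ->; move/eqP: E; rewrite gdist1 // adj_sym.
Qed.

(** Replacing x by its neighbour x' on a shortest path to y keeps the neighbours
    of y that are closer to x' closer to x. *)
Lemma c_mono i j : i <= j <= D -> c i <= c j.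
Proof.
case/andP=> ij jD; rewrite -(subnKC ij) in jD *; move: (j - i) jD => n {j ij}.
elim: n => [|n IH]; rewrite ?addn0 // addnS => jD.
apply: leq_trans (IH (ltnW jD)) _; have [x [y E]] := dist_pair jD.
have [x' x'x Ex'] := gdist_pred conn (etrans (gdist_sym conn y x) E).
rewrite gdist_sym // in Ex'; rewrite -E -{1}Ex' -!card_c.
apply/subset_leq_card/subsetP=> z; rewrite !inE => /andP[/eqP Ez yz].
rewrite yz andbT; rewrite adj_sym in yz.
have [h1 _] := gdist_adj conn z x'x; have [h2 _] := gdist_adj conn x yz.
by rewrite !(gdist_sym conn z) in h1; lia.
Qed.

End IntersectionNumbers.

(** The division is exact, by [sphere_size_rec], and the value is the number of
    vertices at distance i from any vertex. *)
Fixpoint sphere_size (b c : nat -> nat) (i : nat) : nat :=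
  if i is j.+1 then sphere_size b c j * b j %/ c j.+1 else 1.

(** * Spheres *)

Section Spheres.
Variables (G : sgraph) (k : nat) (b c : nat -> nat).
Hypothesis hG : drg G k b c.
Implicit Types x y z w : G.
Local Notation d := (@gdist G).
Local Notation D := (diameter G).
Local Notation a := (a_ k b c).
Local Notation kk := (sphere_size b c).
Local Notation v := #|G|.

Let conn : connected G. Proof. by case: hG. Qed.
Let hk : valency G k. Proof. by case: hG. Qed.

(** Dually to [c_mono], the neighbours of y that are farther from x are farther
    from x'. *)
Lemma b_mono i j : i <= j <= D -> b j <= b i.
Proof.
case/andP=> ij jD; rewrite -(subnKC ij) in jD *; move: (j - i) jD => n {j ij}.
elim: n => [|n IH]; rewrite ?addn0 // addnS => jD.
apply: leq_trans (IH (ltnW jD)); have [x [y E]] := dist_pair hG jD.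
have [x' x'x Ex'] := gdist_pred conn (etrans (gdist_sym conn y x) E).
rewrite gdist_sym // in Ex'; rewrite -E -{1}Ex' -!(card_b hG).
apply/subset_leq_card/subsetP=> z; rewrite !inE => /andP[/eqP Ez yz].
rewrite yz andbT.
have [h1 _] := gdist_adj conn z x'x; have [h2 _] := gdist_adj conn x' yz.
by rewrite !(gdist_sym conn z) in h1; lia.
Qed.

(** For y on a shortest path from x to z, the neighbours of y that are closer to
    z are farther from x. *)
Lemma c_le_b i j : i + j <= D -> c i <= b j.
Proof.
move=> ijD; have [x [z E]] := dist_pair hG ijD.
have [|y Ey Eyz] := gdist_between conn (i := j) (x := x) (y := z).
  by rewrite E leq_addl.
rewrite E addnK in Eyz; rewrite -Eyz -Ey (gdist_sym conn y z).
rewrite -(card_c hG z y) -(card_b hG x y).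
apply/subset_leq_card/subsetP=> u; rewrite !inE => /andP[/eqP Eu yu].
rewrite yu andbT; have [h1 _] := gdist_adj conn x yu.
have h2 := gdist_triangle conn u x z; rewrite (gdist_sym conn z u) in Eu.
by rewrite (gdist_sym conn z y) in Eu; lia.
Qed.

Lemma sphere_size_rec_aux x i : #|sphere x i| * b i = #|sphere x i.+1| * c i.+1.
Proof.
have := arcsC (sphere x i) (sphere x i.+1); rewrite /arcs.
rewrite (eq_bigr (fun=> b i)) => [|y]; last first.
  by rewrite inE => /eqP <-; exact: (card_b hG).
rewrite [in RHS](eq_bigr (fun=> c i.+1)) ?sum_nat_const // => y.
rewrite inE => /eqP E; rewrite -E -(card_c hG) /deg_in; apply: eq_card => z.
by rewrite !inE E eqSS.
Qed.

Lemma sphere_gt x i : D < i -> #|sphere x i| = 0.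
Proof.
move=> Di; apply/eqP; rewrite cards_eq0; apply/eqP/setP=> y; rewrite !inE.
by apply/negP=> /eqP E; have := gdist_max x y; lia.
Qed.

Lemma card_sphere x i : #|sphere x i| = kk i.
Proof.
elim: i => [|i IH] /=.
  rewrite -(cards1 x); apply: eq_card => y.
  by rewrite !inE gdist_eq0 // eq_sym.
rewrite -IH sphere_size_rec_aux.
case: (leqP i.+1 D) => iD; first by rewrite mulnK // (c_gt0 hG).
by rewrite sphere_gt // div0n.
Qed.

Let vertex_exists : exists x : G, true.
Proof. by have [G0 _] := conn; case/card_gt0P: G0 => x _; exists x. Qed.

Lemma sphere_size_rec i : kk i * b i = kk i.+1 * c i.+1.
Proof.
by have [x _] := vertex_exists; rewrite -!(card_sphere x) sphere_size_rec_aux.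
Qed.

Lemma sphere_size_gt0 i : i <= D -> 0 < kk i.
Proof.
case/(dist_pair hG)=> x [y E]; rewrite -(card_sphere x).
by apply/card_gt0P; exists y; rewrite inE E.
Qed.

Lemma sphere_size1 : 0 < D -> kk 1 = k.
Proof. by move=> D0; rewrite /= (c1 hG) // divn1 mul1n (b0 hG). Qed.

Lemma sum_dist (f : nat -> nat) (A : {set G}) x :
  \sum_(y in A) f (d x y) = \sum_(i < D.+1) #|A :&: sphere x i| * f i.
Proof.
rewrite (partition_big (fun y => inord (d x y) : 'I_D.+1) predT) //=.
apply: eq_bigr => i _; rewrite -sum_nat_const.
have E y : (inord (d x y) == i) = (d x y == i).
  by rewrite -val_eqE /= inordK // ltnS gdist_max.
rewrite (eq_bigl (fun y => y \in A :&: sphere x i)) => [|y]; last by rewrite !inE E.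
by apply: eq_bigr => y; rewrite !inE => /andP[_ /eqP->].
Qed.

Lemma card_spheres (A : {set G}) x : #|A| = \sum_(i < D.+1) #|A :&: sphere x i|.
Proof.
rewrite -sum1_card (sum_dist (fun=> 1) _ x).
by apply: eq_bigr => i _; rewrite muln1.
Qed.

Lemma card_graph : v = \sum_(i < D.+1) kk i.
Proof.
have [x _] := vertex_exists; rewrite -cardsT (card_spheres _ x).
by apply: eq_bigr => i _; rewrite setTI card_sphere.
Qed.

(** Spheres do not shrink up to half of the diameter, and the sphere of radius D
    - m is at least as large as the one of radius m. Both follow from [c_le_b]
    through [sphere_size_rec]. *)
Lemma sphere_size_le m j : m <= j -> m + j <= D -> kk m <= kk j.
Proof.
have [n] := ubnP (j - m); elim: n m j => // n IHn m j ltn mj mjD.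
case: (eqVneq m j) => [->//|nmj].
have lt : m < j by rewrite ltn_neqAle nmj.
have cb : c j <= b m by apply: c_le_b; rewrite addnC.
have b0 : 0 < b m by apply: (b_gt0 hG); lia.
have [E|lt2] : j = m.+1 \/ m.+1 < j by lia.
  rewrite -(leq_pmul2r b0) sphere_size_rec E leq_mul2l.
  by rewrite -E cb orbT.
have le1 : kk m.+1 <= kk j.-1 by apply: IHn; lia.
have cb2 : c m.+1 <= b j.-1 by apply: c_le_b; lia.
have h1 := sphere_size_rec m; have h2 := sphere_size_rec j.-1.
rewrite prednK in h2; last by lia.
rewrite -(leq_pmul2r b0) h1 (leq_trans (leq_mul le1 cb2)) // h2.
by rewrite leq_mul2l cb orbT.
Qed.

(** * Functions that depend only on the distance *)

(** These functions are the matrices in the Bose-Mesner algebra with entries in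
    nat. *)
Definition dist_class (X : G -> G -> nat) : Prop :=
  forall x y x' y', d x y = d x' y' -> X x y = X x' y'.

Lemma dist_classP X : dist_class X -> exists f, forall x y, X x y = f (d x y).
Proof.
move=> hX; exists (fun n => if [pick p : G * G | d p.1 p.2 == n] is Some p
                            then X p.1 p.2 else 0) => x y.
case: pickP => [p /eqP E|/(_ (x, y))]; first exact/hX.
by rewrite eqxx.
Qed.

Lemma sum_nbr f x y :
  \sum_(z | adj y z) f (d x z) =
  c (d x y) * f (d x y).-1 + a (d x y) * f (d x y) + b (d x y) * f (d x y).+1.
Proof.
rewrite (bigID (fun z => (d x z).+1 == d x y)) -addnA /=; congr (_ + _).
  rewrite -(card_c hG) -sum_nat_const; apply: congr_big => // z.
    by rewrite !inE andbC.
  by case/andP=> _ /eqP <-.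
rewrite (bigID (fun z => d x z == d x y)) /=; congr (_ + _).
  rewrite -(card_a hG) -sum_nat_const; apply: congr_big => // z.
    by rewrite !inE; case: (adj y z); rewrite ?andbF ?andbT //=; lia.
  by case/andP=> _ /eqP <-.
rewrite -(card_b hG) -sum_nat_const; apply: congr_big => // z.
  rewrite !inE; case: (boolP (adj y z)) => yz; rewrite ?andbF ?andbT //=.
  by have [h1 h2] := gdist_adj conn x yz; lia.
move=> /andP[/andP[yz h1] h2]; congr f.
by have [h3 h4] := gdist_adj conn x yz; lia.
Qed.

Lemma dist_class_nbr X : dist_class X ->
  dist_class (fun x y => \sum_(z | adj x z) X z y).
Proof.
move=> /dist_classP[f hf].
have E x y : \sum_(z | adj x z) X z y = \sum_(z | adj x z) f (d y z).
  by apply: eq_bigr => z _; rewrite hf gdist_sym.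
by move=> x y x' y' e; rewrite !E !sum_nbr !(gdist_sym conn _ x) !(gdist_sym conn _ x') e.
Qed.

(** By induction on i: multiplying by the adjacency matrix preserves distance
    classes, and the product of the adjacency matrix and the matrix of distance
    i + 1 is the combination of the matrices of distance i + 2, i + 1 and i with
    coefficients c i.+2, a i.+1 and b i. *)
Lemma dist_class_sphere X i : dist_class X ->
  dist_class (fun x y => \sum_(z | d x z == i) X z y).
Proof.
move=> hX.
suff: dist_class (fun x y => \sum_(z | d x z == i) X z y) /\
      dist_class (fun x y => \sum_(z | d x z == i.+1) X z y) by case.
elim: i => [|i [IH0 IH1]].
  split=> x y x' y' E.
    have e1 u : (fun z => d u z == 0) =1 pred1 u.
      by move=> z; rewrite /= gdist_eq0 // eq_sym.
    by rewrite (eq_bigl _ _ (e1 x)) (eq_bigl _ _ (e1 x')) !big_pred1_eq; exact: hX.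
  have e1 u : (fun z => d u z == 1) =1 adj u by move=> z; rewrite gdist1.
  rewrite (eq_bigl _ _ (e1 x)) (eq_bigl _ _ (e1 x')).
  exact: (dist_class_nbr hX).
split=> //.
case: (leqP i.+2 D) => iD; last first.
  by move=> x y x' y' _; rewrite !big_pred0 // => z; apply/eqP=> E;
    [have := gdist_max x' z|have := gdist_max x z]; lia.
have E x y : \sum_(w | adj x w) \sum_(z | d w z == i.+1) X z y =
  c i.+2 * \sum_(z | d x z == i.+2) X z y +
  (a i.+1 * \sum_(z | d x z == i.+1) X z y + b i * \sum_(z | d x z == i) X z y).
  under eq_bigr do rewrite big_mkcond.
  rewrite exchange_big /=.
  have e z : \sum_(w | adj x w) (if d w z == i.+1 then X z y else 0) =
    c i.+2 * (if d x z == i.+2 then X z y else 0) +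
    (a i.+1 * (if d x z == i.+1 then X z y else 0) +
     b i * (if d x z == i then X z y else 0)).
    under eq_bigr do rewrite gdist_sym //.
    rewrite (sum_nbr (fun m => if m == i.+1 then X z y else 0)) (gdist_sym conn z).
    case: (ltngtP (d x z) i.+1) => [lt|gt|->].
    - rewrite (_ : (_.-1 == _) = false) ?muln0 ?eqSS; last by lia.
      rewrite (_ : (_ == i.+2) = false) ?muln0; last by lia.
      by case: eqP => [->|]; rewrite ?muln0.
    - rewrite (_ : (_.+1 == _) = false) ?muln0; last by lia.
      rewrite (_ : (_ == i) = false) ?muln0 ?addn0; last by lia.
      rewrite (_ : (_.-1 == i.+1) = (d x z == i.+2)); last by lia.
      by case: eqP => [->|]; rewrite ?muln0.
    - rewrite (_ : (_ == i.+2) = false) ?muln0; last by lia.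
      rewrite (_ : (_ == i) = false) ?muln0 ?addn0; last by lia.
      rewrite (_ : (_.-1 == i.+1) = false) ?muln0; last by lia.
      by rewrite (_ : (i.+2 == i.+1) = false) ?muln0 ?addn0 //; lia.
  rewrite (eq_bigr _ (fun z _ => e z)) !big_split /= -!big_distrr /=.
  by rewrite -!big_mkcond.
move=> x y x' y' exy.
have := dist_class_nbr IH1 exy; rewrite !E (IH1 _ _ _ _ exy) (IH0 _ _ _ _ exy).
move/addIn => /eqP; rewrite eqn_pmul2l; first by move/eqP.
by rewrite (c_gt0 hG).
Qed.

(** By [dist_class_sphere] the number of such x is the same for all arcs (z, w),
    and the right-hand side counts the pairs (x, w) for a fixed z. *)
Lemma card_edge_level z w i : adj z w ->
  k * #|[set x | (d x z == i) && (d x w == i.+1)]| = kk i * b i.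
Proof.
move=> zw.
have cls : dist_class (fun z w => \sum_(x | d z x == i) (d x w == i.+1)).
  by apply: dist_class_sphere => x y x' y' ->.
have E u : \sum_(x | d z x == i) (d x u == i.+1) =
    #|[set x | (d x z == i) && (d x u == i.+1)]|.
  rewrite -sum1dep_card [RHS]big_mkcondr /=.
  by apply: eq_big => [x|x _]; [rewrite gdist_sym|case: eqP].
have E2 u : adj z u -> \sum_(x | d z x == i) (d x u == i.+1) =
    #|[set x | (d x z == i) && (d x w == i.+1)]|.
  move=> zu; rewrite -E; apply: cls.
  by apply/eqP; rewrite (eqP (_ : d z w == 1)) gdist1.
rewrite -{1}(hk z) -sum_nat_const.
rewrite (eq_bigr (fun u => \sum_(x | d z x == i) (d x u == i.+1))); last first.
  by move=> u; rewrite inE => /E2.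
rewrite exchange_big /= -(card_sphere z) -sum_nat_const.
apply: eq_big => [x|x /eqP Ex]; first by rewrite inE.
rewrite -Ex (gdist_sym conn z) -(card_b hG) /deg_in -sum1_card.
rewrite [LHS]big_mkcond [RHS]big_mkcond; apply: eq_bigr => u _ /=.
by rewrite !inE; case: adj; case: eqP.
Qed.

End Spheres.

Arguments sphere_size : simpl never.

(** * Edge cuts and flows along shortest paths *)

Import Order.TTheory GRing.Theory Num.Theory.

Section Flow.
Variables (G : sgraph) (k : nat) (b c : nat -> nat).
Hypothesis hG : drg G k b c.
Implicit Types (x y z w : G) (A : {set G}).
Local Notation d := (@gdist G).
Local Notation D := (diameter G).
Local Notation kk := (sphere_size b c).
Local Notation v := #|G|.

Let conn : connected G. Proof. by case: hG. Qed.

Local Open Scope ring_scope.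

(** The recursion of [load_rec], started at the last level, where no edge leads
    farther away. *)
Fixpoint load_from_end (n : nat) : rat :=
  if n is m.+1 then (1 + (b (D - m)%N)%:R * load_from_end m) / (c (D - m)%N)%:R
  else 0.

(** The load of an edge between the levels i and i + 1 of x when x sends one
    unit to every other vertex, evenly along shortest paths. *)
Definition load (i : nat) : rat := load_from_end (D - i)%N.

Definition beyond (i : nat) : nat := (\sum_(i.+1 <= j < D.+1) kk j)%N.

Lemma loadD : load D = 0.
Proof. by rewrite /load subnn. Qed.

(** A vertex at level i + 1 receives [load i] over c i.+1 edges, keeps one unit
    and sends [load i.+1] on over b i.+1 edges. *)
Lemma load_rec i : (i < D)%N ->
  (c i.+1)%:R * load i = 1 + (b i.+1)%:R * load i.+1.
Proof.
move=> iD; rewrite /load -(subnSK iD) /= subKn //.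
rewrite mulrC divfK // pnatr_eq0 -lt0n (c_gt0 hG) //.
Qed.

Lemma load_ge0 i : 0 <= load i.
Proof.
rewrite /load; elim: (D - i)%N => //= n IH.
by rewrite divr_ge0 ?addr_ge0 ?mulr_ge0 ?ler0n.
Qed.

(** The c i increase and the b i decrease, and both changes make the load of
    later edges smaller. *)
Lemma load_anti1 i : (i < D)%N -> load i.+1 <= load i.
Proof.
have [n] := ubnP (D - i)%N; elim: n i => // n IHn i ltn iD.
have ci : 0 < (c i.+1)%:R :> rat by rewrite ltr0n (c_gt0 hG).
rewrite -(ler_pM2l ci) load_rec //.
have [E|iD2] : i.+1 = D \/ (i.+1 < D)%N by lia.
  by rewrite E loadD !mulr0 addr0 ler01.
have le1 : load i.+2 <= load i.+1 by apply: IHn; lia.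
have le2 : (c i.+1)%:R <= (c i.+2)%:R :> rat by rewrite ler_nat (c_mono hG); lia.
have le3 : (b i.+2)%:R <= (b i.+1)%:R :> rat by rewrite ler_nat (b_mono hG); lia.
apply: (@le_trans _ _ ((c i.+2)%:R * load i.+1)).
  by rewrite ler_wpM2r // load_ge0.
rewrite load_rec // lerD2l ler_pM //; exact: load_ge0.
Qed.

Lemma load_anti i j : (i <= j <= D)%N -> load j <= load i.
Proof.
case/andP=> ij jD; rewrite -(subnKC ij) in jD *; move: (j - i)%N jD => n {j ij}.
elim: n => [|n IH]; rewrite ?addn0 // addnS => jD.
by apply: le_trans (IH (ltnW jD)); apply: load_anti1.
Qed.

Lemma beyond_rec i : (i < D)%N -> beyond i = (kk i.+1 + beyond i.+1)%N.
Proof. by move=> iD; rewrite /beyond big_ltn. Qed.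

Lemma load_beyond i : (i <= D)%N -> (kk i * b i)%:R * load i = (beyond i)%:R.
Proof.
have [n] := ubnP (D - i)%N; elim: n i => // n IHn i ltn.
rewrite leq_eqVlt => /orP[/eqP->|iD].
  by rewrite loadD mulr0 /beyond big_geq.
have lt' : (D - i.+1 < n)%N by lia.
rewrite (sphere_size_rec hG) natrM -mulrA load_rec // mulrDr mulr1 mulrA -natrM.
by rewrite (IHn _ lt' iD) (beyond_rec iD) natrD.
Qed.

Lemma beyond0 : (beyond 0 + 1)%N = v.
Proof. by rewrite (card_graph hG) -(big_mkord predT kk) big_ltn // addnC. Qed.

(** Arcs that leave A away from x, between the levels j and j + 1 of x. *)
Definition level_arcs A x j : nat :=
  arcs (A :&: sphere x j) (~: A :&: sphere x j.+1).

Lemma level_arcs_ge A x j :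
  (c j.+1 * #|~: A :&: sphere x j.+1| <=
   level_arcs A x j + b j * #|~: A :&: sphere x j|)%N.
Proof.
rewrite /level_arcs arcsC.
have -> : (c j.+1 * #|~: A :&: sphere x j.+1| =
    arcs (~: A :&: sphere x j.+1) (sphere x j))%N.
  rewrite mulnC -sum_nat_const; apply: eq_bigr => y.
  rewrite !inE => /andP[_ /eqP E]; rewrite -E -(card_c hG) /deg_in.
  by apply: eq_card => z; rewrite !inE E eqSS.
rewrite -[X in arcs _ X](setID _ A) arcsUr; last first.
  by rewrite -setI_eq0; apply/eqP/setP=> z; rewrite !inE; case: (z \in A); rewrite ?andbF.
rewrite [_ :&: A]setIC leq_add2l arcsC.
apply: (@leq_trans (arcs (sphere x j :\: A) (sphere x j.+1))).
  by apply: leq_sum => y _; apply: deg_in_sub; exact: subsetIr.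
rewrite setDE setIC mulnC -sum_nat_const leq_sum // => y.
by rewrite !inE => /andP[_ /eqP<-]; rewrite (card_b hG).
Qed.

(** In the flow of [load], the units meant for the vertices outside A leave A
    over arcs that point away from x. The induction on the number of levels
    carries the amount that the vertices outside A at the last level send on. *)
Lemma card_outside_le A x : x \in A ->
  #|~: A|%:R <= \sum_(j < D) (level_arcs A x j)%:R * load j.
Proof.
move=> Ax; pose al j := #|~: A :&: sphere x j|.
have al0 : al 0%N = 0%N.
  apply/eqP; rewrite cards_eq0; apply/eqP/setP=> y; rewrite !inE gdist_eq0 //.
  by case: eqP => [<-|]; rewrite ?Ax ?andbF.
have main n : (n <= D)%N ->
    (\sum_(1 <= j < n.+1) al j)%N%:R + (b n * al n)%:R * load n <=
    \sum_(j < n) (level_arcs A x j)%:R * load j.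
  elim: n => [|n IH] nD; first by rewrite big_geq // al0 muln0 mul0r addr0 big_ord0.
  rewrite big_ord_recr /= big_nat_recr //= natrD.
  have := IH (ltnW nD).
  have : (c n.+1)%:R * (al n.+1)%:R <=
         (level_arcs A x n)%:R + (b n)%:R * (al n)%:R :> rat.
    by rewrite -!natrM -natrD ler_nat level_arcs_ge.
  move/(ler_wpM2r (load_ge0 n)).
  have := load_rec nD; rewrite !natrM.
  set C := (c n.+1)%:R; set X := (al n.+1)%:R; set B := (b n.+1)%:R.
  set L := load n; set L' := load n.+1 => E h1 h2.
  have -> : B * X * L' = X * (C * L - 1) by rewrite E; ring.
  by nra.
have -> : #|~: A| = (\sum_(1 <= j < D.+1) al j)%N.
  rewrite (card_spheres (~: A) x) -(big_mkord predT al) [LHS]big_ltn //.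
  by rewrite al0 add0n.
by have := main D (leqnn D); rewrite loadD mulr0 addr0.
Qed.

Lemma level_arcs0 A x : x \in A -> level_arcs A x 0 = deg_in x (~: A).
Proof.
move=> Ax; rewrite /level_arcs /arcs (_ : A :&: sphere x 0 = [set x]).
  rewrite big_set1; apply: eq_card => y; rewrite !inE gdist1 //.
  by rewrite -andbA andbb.
by apply/setP=> y; rewrite !inE gdist_eq0 // andbC eq_sym; case: eqP => [->|].
Qed.

Lemma sum_level_arcs A x : (\sum_(j < D) level_arcs A x j <= arcs A (~: A))%N.
Proof.
rewrite /level_arcs /arcs.
apply: (@leq_trans (\sum_(j < D.+1) \sum_(z in A :&: sphere x j) deg_in z (~: A))%N).
  rewrite big_ord_recr /=; apply: leq_trans (leq_addr _ _).
  by apply: leq_sum => j _; apply: leq_sum => z _; apply: deg_in_sub; exact: subsetIl.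
rewrite [leqRHS](partition_big (fun y => inord (d x y) : 'I_D.+1) predT) //=.
apply: leq_sum => i _; apply: eq_leq; apply: eq_bigl => z; rewrite !inE.
by rewrite -val_eqE /= inordK // ltnS gdist_max.
Qed.

Lemma sum_level_arcs_in A j :
  (k * \sum_(x in A) level_arcs A x j <= arcs A (~: A) * (kk j * b j))%N.
Proof.
have E x : level_arcs A x j = (\sum_(z in A) \sum_(w in ~: A)
    (adj z w && ((d x z == j) && (d x w == j.+1))))%N.
  rewrite /level_arcs /arcs big_mkcond [RHS]big_mkcond; apply: eq_bigr => z _.
  rewrite !inE deg_inE; case: (z \in A) => //=; case: eqP => _; last first.
    by rewrite big1 // => w _; rewrite andbF.
  rewrite big_mkcond [RHS]big_mkcond; apply: eq_bigr => w _.
  by rewrite !inE; case: (w \in A) => //=; case: eqP; case: adj.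
under eq_bigr do rewrite E.
rewrite exchange_big /= big_distrr /= /arcs big_distrl /=; apply: leq_sum => z Az.
rewrite exchange_big /= big_distrr /= deg_inE big_distrl /=; apply: leq_sum => w Aw.
case: (boolP (adj z w)) => zw; last by rewrite big1 ?muln0.
rewrite mul1n -(card_edge_level hG j zw) leq_mul2l; apply/orP; right.
rewrite -sum1dep_card [leqRHS]big_mkcond [leqLHS]big_mkcond /=.
by apply: leq_sum => x _; case: ifP => //; case: ifP.
Qed.

Hypothesis D2 : (1 < D)%N.
Hypothesis k0 : (0 < k)%N.

Let load0E : k%:R * load 0 = (v - 1)%:R.
Proof.
have := load_beyond (leq0n D); rewrite mul1n (b0 hG) => ->; congr _%:R.
by rewrite -beyond0 addnK.
Qed.

Let load1E : (k * b 1)%:R * load 1 = (v - 1 - k)%:R.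
Proof.
have D1 : (0 < D)%N := ltnW D2.
have := load_beyond D1; rewrite (sphere_size1 hG) // => ->; congr _%:R.
by rewrite -beyond0 addnK (beyond_rec D1) (sphere_size1 hG) // addKn.
Qed.

(** Only the edges at x have load [load 0], and all others have at most [load
    1]. *)
Lemma cut_from_vertex A x t f : x \in A ->
  (deg_in x (~: A) <= t <= f)%N -> (arcs A (~: A) <= f)%N ->
  (k * b 1 * #|~: A| + t * b 1 + (f - t) * (k + 1) <= (t * b 1 + (f - t)) * v)%N.
Proof.
move=> Ax /andP[tx tf] Ff.
have D1 : (0 < D)%N := ltnW D2.
rewrite -(ler_nat rat).
have key : #|~: A|%:R <= t%:R * load 0 + (f - t)%:R * load 1.
  apply: le_trans (card_outside_le Ax) _.
  have := sum_level_arcs A x; case: D D1 (load_anti) => // m _ anti.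
  rewrite !big_ord_recl /= level_arcs0 //.
  set s := (\sum_(i < m) _)%N => sF.
  apply: (@le_trans _ _ ((deg_in x (~: A))%:R * load 0 + s%:R * load 1)).
    rewrite lerD2l natr_sum mulr_suml; apply: ler_sum => i _.
    by rewrite ler_wpM2l ?ler0n // anti //= /bump /=; have := ltn_ord i; lia.
  have L01 := anti 0%N 1%N isT; have L1 := load_ge0 1.
  have h1 : (deg_in x (~: A))%:R + s%:R <= f%:R :> rat.
    by rewrite -natrD ler_nat; exact: leq_trans sF Ff.
  have h2 : (deg_in x (~: A))%:R <= t%:R :> rat by rewrite ler_nat.
  rewrite natrB //; nra.
have kv : (k + 1 <= v)%N.
  have F1 := beyond_rec D1; have F0 := beyond0.
  by rewrite (sphere_size1 hG) // in F1; lia.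
have L0 : k%:R * load 0 = v%:R - 1 by rewrite load0E natrB //; lia.
have L1 : (k * b 1)%:R * load 1 = v%:R - 1 - k%:R.
  by rewrite load1E -subnDA addnC natrB // natrD opprD addrCA addrA [- k%:R + _]addrC addrAC.
have kb : 0 <= (k * b 1)%:R :> rat by rewrite ler0n.
have := ler_wpM2l kb key; rewrite !natrD !natrM in L1 *.
have -> : k%:R * (b 1)%:R * (t%:R * load 0 + (f - t)%:R * load 1) =
  (b 1)%:R * t%:R * (k%:R * load 0) + (f - t)%:R * (k%:R * (b 1)%:R * load 1) :> rat by ring.
by rewrite L0 L1; lra.
Qed.

(** The sum of the distances from a fixed vertex. *)
Definition wiener : nat := (\sum_(j < D) beyond j)%N.

(** Summing the flow bound over the sources x in A, each arc that leaves A is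
    met at level j by at most kk j * b j / k sources. *)
Lemma cut_wiener A : (k * #|A| * #|~: A| <= arcs A (~: A) * wiener)%N.
Proof.
rewrite -(ler_nat rat).
have key : (#|A| * #|~: A|)%:R <=
    \sum_(j < D) (\sum_(x in A) level_arcs A x j)%N%:R * load j.
  apply: (@le_trans _ _ (\sum_(x in A) \sum_(j < D) (level_arcs A x j)%:R * load j)).
    rewrite -sum_nat_const natr_sum; apply: ler_sum => x; exact: card_outside_le.
  rewrite exchange_big /=; apply: ler_sum => j _.
  by rewrite natr_sum mulr_suml.
rewrite -mulnA natrM.
apply: le_trans (ler_wpM2l (ler0n _ k) key) _.
rewrite /wiener [leRHS]natrM [X in _ <= _ * X]natr_sum !mulr_sumr.
apply: ler_sum => j _.
rewrite -load_beyond; last exact: ltnW.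
rewrite !mulrA -!natrM ler_wpM2r ?load_ge0 // ler_nat.
by have := sum_level_arcs_in A j; rewrite !mulnA.
Qed.

(** As in [cut_wiener], with a cruder account of the far levels: an arc that
    leaves A carries [load 0] for at most one source in A, [load 1] for at most
    [b 1] sources, and at most [load 2] for the others. *)
Lemma cut_three_levels A : (2 < D)%N -> (b 1 < #|A|)%N ->
  (k * (kk 2 * b 2) * #|A| * #|~: A| <=
   arcs A (~: A) * ((kk 2 * b 2) * ((v - 1) + (v - 1 - k)) +
                    (#|A| - 1 - b 1) * k * (v - 1 - k - kk 2)))%N.
Proof.
move=> D3 ltb; have D1 : (0 < D)%N := ltnW D2.
pose S j := (\sum_(x in A) level_arcs A x j)%N.
have S0 : (S 0 <= arcs A (~: A))%N.
  have := sum_level_arcs_in A 0; rewrite mul1n (b0 hG) mulnC.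
  by rewrite leq_pmul2r.
have S1 : (S 1 <= arcs A (~: A) * b 1)%N.
  have := sum_level_arcs_in A 1; rewrite (sphere_size1 hG) //.
  by rewrite mulnCA leq_pmul2l.
have SS : (\sum_(j < D) S j <= #|A| * arcs A (~: A))%N.
  rewrite exchange_big -sum_nat_const; apply: leq_sum => x _; exact: sum_level_arcs.
have key : (#|A| * #|~: A|)%:R <= \sum_(j < D) (S j)%:R * load j.
  apply: (@le_trans _ _ (\sum_(x in A) \sum_(j < D) (level_arcs A x j)%:R * load j)).
    rewrite -sum_nat_const natr_sum; apply: ler_sum => x; exact: card_outside_le.
  rewrite exchange_big /=; apply: ler_sum => j _.
  by rewrite /S natr_sum mulr_suml.
have load2E : (kk 2 * b 2)%:R * load 2 = (v - 1 - k - kk 2)%:R.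
  have -> := load_beyond (ltnW D3); congr _%:R.
  have E1 := beyond_rec D1; have E2 := beyond_rec D2; have E0 := beyond0.
  by rewrite (sphere_size1 hG) // in E1; lia.
have key2 : \sum_(j < D) (S j)%:R * load j <=
    (arcs A (~: A))%:R * (load 0 + (b 1)%:R * load 1 + (#|A| - 1 - b 1)%:R * load 2).
  have L12 : load 2 <= load 1 by apply: load_anti; lia.
  have L01 : load 1 <= load 0 by apply: load_anti; lia.
  have := load_anti; move: SS; case: D D3 => // -[//|m] _ SS anti.
  move: SS; rewrite !big_ord_recl /=; set s := (\sum_(i < m) _)%N => SS.
  apply: (@le_trans _ _ ((S 0)%:R * load 0 + ((S 1)%:R * load 1 + s%:R * load 2))).
    rewrite !lerD2l natr_sum mulr_suml; apply: ler_sum => i _.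
    by rewrite ler_wpM2l ?ler0n // anti //= /bump /=; have := ltn_ord i; lia.
  move: SS S0 S1; rewrite /= -!(ler_nat rat) !natrD !natrM => SS S0 S1.
  have E : #|A|%:R = (#|A| - 1 - b 1)%:R + 1 + (b 1)%:R :> rat.
    by rewrite -[1]/(1%:R) -!natrD; congr _%:R; lia.
  rewrite E in SS.
  have p1 : 0 <= ((arcs A (~: A))%:R - (S 0)%:R) * (load 0 - load 2).
    by rewrite mulr_ge0 // subr_ge0 // (le_trans L12).
  have p2 : 0 <= ((arcs A (~: A))%:R * (b 1)%:R - (S 1)%:R) * (load 1 - load 2).
    by rewrite mulr_ge0 // subr_ge0.
  have p3 := mulr_ge0 (load_ge0 2) (etrans (subr_ge0 _ _) SS).
  rewrite /bump /=; lra.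
have := le_trans key key2.
have kb : 0 <= (k * (kk 2 * b 2))%:R :> rat by rewrite ler0n.
move/(ler_wpM2l kb) => h; rewrite -(ler_nat rat).
set m := (#|A| - 1 - b 1)%N in h *; set q := (kk 2 * b 2)%N in h load2E kb *.
have -> : (arcs A (~: A) * (q * ((v - 1) + (v - 1 - k)) + m * k * (v - 1 - k - kk 2)))%:R =
    (arcs A (~: A))%:R * (q%:R * (k%:R * load 0 + (k * b 1)%:R * load 1) +
                          m%:R * k%:R * (q%:R * load 2)) :> rat.
  by rewrite load0E load1E load2E -!natrM -!natrD -!natrM -natrD -natrM.
apply: (le_trans _ (le_trans h _)); rewrite !natrM; lra.
Qed.

(** The spheres of radius 2, ..., D - 2 have at least kap vertices and the one
    of radius D - 1 has at least k, so a given number of vertices cannot be far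
    away on average. *)
Lemma wiener_le kap : (2 < D)%N -> (k <= kap <= kk 2)%N ->
  (2 * wiener + kap * (D * D) <= D * (2 * v + 3 * kap - (2 * k + 2)))%N.
Proof.
move=> D3 /andP[kkap kap2]; have D1 : (0 < D)%N := ltnW D2.
(* s j vertices are at distance at most j, and beyond j at a larger distance *)
pose s j := (\sum_(i < j.+1) kk i)%N.
have sE j : (j < D)%N -> (beyond j + s j)%N = v.
  elim: j => [|j IH] jD; first by rewrite /s big_ord1 beyond0.
  by rewrite -(IH (ltnW jD)) (beyond_rec (ltnW jD)) /s [in LHS]big_ord_recr /=; lia.
have sle n : (n <= D - 2)%N ->
    (0 < n -> 1 + k + kap * n.-1 <= s n)%N /\
    (2 + 2 * n * (1 + k) + kap * (n * n.-1) <= 2 * \sum_(j < n.+1) s j)%N.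
  elim: n => [|n IH] nD; first by split=> //; rewrite big_ord1 /s big_ord1 -[kk 0]/1%N; lia.
  have [IH1 IH2] := IH (ltnW nD).
  have h : (1 + k + kap * n <= s n.+1)%N.
    rewrite /s big_ord_recr /=; case: n nD IH1 {IH IH2} => [|n] nD IH1.
      by rewrite big_ord1 (sphere_size1 hG) // muln0 addn0.
    have := IH1 isT; rewrite /s /=.
    have : (kk 2 <= kk n.+2)%N by apply: (sphere_size_le hG); lia.
    by move: (\sum_(i < n.+2) kk i)%N (kk 2) (kk n.+2) kap2; clear; nia.
  split=> //; rewrite big_ord_recr /=.
  move: (\sum_(j < n.+1) s j)%N IH2 (s n.+1) h => X; clear; case: n => [|n] /=; nia.
have [E D2'] : D = (D - 2).+2 /\ (0 < D - 2)%N by lia.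
have [h1 h2] := sle _ (leqnn _).
have E1 : D.-1 = (D - 2).+1 by lia.
have hk : (k <= kk D.-1)%N.
  by rewrite -{1}(sphere_size1 hG D1); apply: (sphere_size_le hG); lia.
have hv : (D * v = wiener + \sum_(j < D) s j)%N.
  rewrite /wiener -big_split /= (eq_bigr (fun=> v)) ?sum_nat_const ?card_ord //.
  by move=> j _; exact: sE.
have hs : (s D.-1 = s (D - 2) + kk D.-1)%N.
  by rewrite E1 /s big_ord_recr.
have hS : (\sum_(j < D) s j = \sum_(j < (D - 2).+1) s j + s D.-1)%N.
  by rewrite -!(big_mkord predT s) {1}E big_nat_recr // E1.
have kv : (k + 1 <= v)%N.
  have F1 := beyond_rec D1; have F0 := beyond0.
  by rewrite (sphere_size1 hG) // in F1; lia.
move: (h1 D2') h2 hk hv hs hS kv kkap; clear -D3.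
move: (s D.-1) (s (D - 2)%N) (\sum_(j < (D - 2).+1) s j)%N (\sum_(j < D) s j)%N.
move: (kk D.-1) wiener v; move: D D3 => n n3.
have -> : n = (n - 3).+3 by lia.
move: (n - 3)%N => m p W u s1 s2 s3 s4; rewrite /= !subSS !subn0 => g1 g2 g3 g4 g5 g6 g7 g8.
by nia.
Qed.

(** The bound of [wiener_le] is quadratic in the diameter; the square comes from
    its maximum. *)
Lemma wiener_square kap : (2 < D)%N -> (k <= kap <= kk 2)%N ->
  (8 * kap * wiener <= (2 * v + 3 * kap - (2 * k + 2)) ^ 2)%N.
Proof.
move=> D3 hkap; have := wiener_le D3 hkap.
move: (2 * v + 3 * kap - _)%N wiener D => X W n h.
have : (4 * kap * (n * X) <= X ^ 2 + 4 * (kap * kap) * (n * n))%N.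
  by have := (nat_Cauchy X (2 * (kap * n))).1; nia.
by nia.
Qed.

End Flow.

(** * Triangles and edge cuts *)

(** In the numerical lemmas below the smaller part of a cut has a vertices and
    the larger one a + e, so that the graph has 2 a + e vertices. The hypotheses
    h3 and h4 are the bounds [cut_from_vertex] and [cut_square]. The products of
    h3 with e and of the lower bound ka with a make the contradiction linear in
    the monomials. *)
Ltac cut_finish a e h3 h4 ka :=
  let h := fresh in have h := leq_mul (leqnn e) h3;
  let h' := fresh in have h' := leq_mul (leqnn a) ka;
  rewrite ?expnS expn0 in h4; lia.

Lemma large_b1_arith k b1 a e K : 5 <= k -> 5 <= b1 -> 0 < a -> K + 3 = 2 * k ->
  k * b1 * (a + e) <= (b1 + K) * (2 * a + e) -> False.
Proof.
move=> k5 b15 a0 EK h.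
have h1 : 2 * b1 + 2 * K + 1 <= k * b1.
  have -> : k = (k - 5) + 5 by lia.
  move: (k - 5) EK => k'; nia.
have h2 := leq_mul h1 (leqnn (a + e)).
have h3 : (b1 + K) * (2 * a + e) <= (2 * b1 + 2 * K) * (a + e).
  have -> : (2 * b1 + 2 * K) * (a + e) = (b1 + K) * (2 * a + 2 * e) by ring.
  by rewrite leq_mul2l; lia.
have : (2 * b1 + 2 * K + 1) * (a + e) = (2 * b1 + 2 * K) * (a + e) + (a + e) by ring.
lia.
Qed.

(** By [b1_bound] only finitely many k are left when b1 is at most 4. The value
    of f is the largest cut below 2 k - 1 that has the parity of k. *)
Lemma small_b1_arith k b1 a e f :
  5 <= k -> 2 <= b1 <= 4 -> k.+1 <= 3 * b1 -> k <= a ->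
  f = (if odd k then 2 * k - 3 else 2 * k - 2) ->
  k * b1 * (a + e) + 1 * b1 + (f - 1) * (k + 1) <= (1 * b1 + (f - 1)) * (2 * a + e) ->
  8 * k * k * (a * (a + e)) <= f * (2 * (2 * a + e) + 3 * k - (2 * k + 2)) ^ 2 ->
  False.
Proof.
move=> k5 b15 kb ka hf h3 h4; rewrite {}hf in h3 h4.
have [Hb|[Hb|Hb]] : b1 = 2 \/ b1 = 3 \/ b1 = 4 by lia.
- have E : k = 5 by lia.
  by rewrite E Hb /= in ka h3 h4 *; cut_finish a e h3 h4 ka.
- have [E|[E|[E|E]]] : k = 5 \/ k = 6 \/ k = 7 \/ k = 8 by lia.
  + by rewrite E Hb /= in ka h3 h4 *; cut_finish a e h3 h4 ka.
  + by rewrite E Hb /= in ka h3 h4 *; cut_finish a e h3 h4 ka.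
  + by rewrite E Hb /= in ka h3 h4 *; cut_finish a e h3 h4 ka.
  + by rewrite E Hb /= in ka h3 h4 *; cut_finish a e h3 h4 ka.
- have [E|[E|[E|[E|[E|[E|E]]]]]] : k = 5 \/ k = 6 \/ k = 7 \/ k = 8 \/ k = 9 \/
    k = 10 \/ k = 11 by lia.
  + by rewrite E Hb /= in ka h3 h4 *; cut_finish a e h3 h4 ka.
  + by rewrite E Hb /= in ka h3 h4 *; cut_finish a e h3 h4 ka.
  + by rewrite E Hb /= in ka h3 h4 *; cut_finish a e h3 h4 ka.
  + by rewrite E Hb /= in ka h3 h4 *; cut_finish a e h3 h4 ka.
  + by rewrite E Hb /= in ka h3 h4 *; cut_finish a e h3 h4 ka.
  + by rewrite E Hb /= in ka h3 h4 *; cut_finish a e h3 h4 ka.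
  + by rewrite E Hb /= in ka h3 h4 *; cut_finish a e h3 h4 ka.
Qed.

Lemma two_out_arith k b1 a e : 6 <= k -> 3 <= b1 -> a + 1 = k ->
  k * b1 * (a + e) + 2 * b1 + (2 * k - 2 - 2) * (k + 1) <=
    (2 * b1 + (2 * k - 2 - 2)) * (2 * a + e) -> False.
Proof.
move=> k6 b3 ak; have [n ->] : exists n, b1 = n + 3 by exists (b1 - 3); lia.
have [m Em] : exists m, a = m + 5 by exists (a - 5); lia.
have -> : k = m + 6 by lia.
have -> : 2 * (m + 6) - 2 - 2 = 2 * m + 8 by lia.
rewrite Em; nia.
Qed.

Section Cuts.
Variables (G : sgraph) (k : nat) (b c : nat -> nat).
Hypothesis hG : drg G k b c.
Hypothesis D3 : 2 < diameter G.
Hypothesis k3 : 2 < k.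
Implicit Types (x y z w : G) (A : {set G}).
Local Notation d := (@gdist G).
Local Notation D := (diameter G).
Local Notation kk := (sphere_size b c).
Local Notation a := (a_ k b c).
Local Notation v := #|G|.
Local Notation cut A := (arcs A (~: A)).

Let conn : connected G. Proof. by case: hG. Qed.
Let hk : valency G k. Proof. by case: hG. Qed.
Let D1 : 0 < D. Proof. exact: ltn_trans D3. Qed.
Let D2 : 1 < D. Proof. exact: ltnW. Qed.
Let k0 : 0 < k. Proof. exact: ltn_trans k3. Qed.

Lemma cutC A : cut (~: A) = cut A.
Proof. by rewrite setCK arcsC. Qed.

Lemma odd_cut A : odd (cut A) = odd k && odd #|A|.
Proof.
by rewrite -oddM -(arcs_valency A hk) oddD (negbTE (odd_arcs A)).
Qed.

(** The average number of neighbours outside A of a vertex of A is less than t +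
    1. *)
Lemma few_out A t : cut A < t.+1 * #|A| -> exists2 x, x \in A & deg_in x (~: A) <= t.
Proof.
move=> lt; case: (boolP [exists x in A, deg_in x (~: A) <= t]).
  by case/existsP=> x /andP[Ax h]; exists x.
move/existsPn=> h; move: lt; rewrite ltnNge mulnC -sum_nat_const.
case/negP; apply: leq_sum => x Ax.
by have := h x; rewrite Ax -ltnNge.
Qed.

Lemma common_nbrs x y : adj x y -> #|[set z | adj x z & adj y z]| = a 1.
Proof.
move=> xy; have /eqP E : d x y == 1 by rewrite gdist1.
rewrite -{1}E -(card_a hG) /deg_in E; apply: eq_card => z.
by rewrite !inE gdist1.
Qed.

Lemma path3 : exists x y z w, [/\ adj x y, adj y z, adj z w & d x w = 3] /\
  d x z = 2 /\ d y w = 2.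
Proof.
have [x [w E]] := dist_pair hG D3.
have [z zw Ez] := gdist_pred conn E; have [y yz Ey] := gdist_pred conn Ez.
exists x, y, z, w; split; first by split=> //; rewrite -gdist1 // Ey.
split=> //; apply/eqP; rewrite eqn_leq.
have := gdist_triangle conn y x w; rewrite Ey E.
have [h _] := gdist_adj conn y zw; have /eqP yz1 : d y z == 1 by rewrite gdist1.
by rewrite yz1 in h; lia.
Qed.

(** On a shortest path x, y, z, w, the common neighbours of y with x and those
    of y with z are two sets of a 1 of the k neighbours of y, so they overlap;
    likewise at z with w. But a common neighbour of y and z that is adjacent to
    x is not adjacent to w, so that the two overlaps have at most a 1 vertices
    together. *)
Lemma lambda_bound : 3 * a 1 + 4 <= 2 * k.
Proof.
have [x [y [z [w [[xy yz zw E] [Exz Eyw]]]]]] := path3.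
pose N (u : G) := [set s | adj u s].
have NI u u' : adj u u' -> #|N u :&: N u'| = a 1.
  by move=> h; rewrite -(common_nbrs h); apply: eq_card => s; rewrite !inE.
pose T := N y :&: N z.
have half u p q : adj p q -> adj p u -> d u q = 2 ->
    2 * a 1 + 2 <= k + #|N p :&: N q :&: N u|.
  move=> pq pu duq.
  have nuq : ~~ adj u q by rewrite -gdist1 // duq.
  have ne : u != q by rewrite -(gdist_eq0 conn) duq.
  have : #|(N p :&: N q) :|: (N p :&: N u)| + 2 <= k.
    have <- : #|[set u; q]| = 2 by rewrite cards2 ne.
    rewrite -(hk p) -cardsUI [X in _ + X](_ : _ = 0) ?addn0; last first.
      apply/eqP; rewrite cards_eq0; apply/eqP/setP=> s; rewrite !inE.
      apply/negP=> /andP[/orP[|] /andP[_ h] /orP[] /eqP Es]; subst s.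
      - by rewrite adj_sym (negbTE nuq) in h.
      - by rewrite adj_irrefl in h.
      - by rewrite adj_irrefl in h.
      - by rewrite (negbTE nuq) in h.
    apply/subset_leq_card/subsetP=> s; rewrite !inE.
    by case/orP=> [/orP[|] /andP[->]|/orP[|] /eqP->].
  rewrite cardsU setIACA setIid !NI // setIA; lia.
have h1 : 2 * a 1 + 2 <= k + #|T :&: N x| by apply: half; rewrite // adj_sym.
have h2 : 2 * a 1 + 2 <= k + #|T :&: N w|.
  by rewrite /T (setIC (N y)); apply: half; rewrite // ?(gdist_sym conn w) // adj_sym.
have h3 : #|T :&: N x| + #|T :&: N w| <= a 1.
  rewrite -cardsUI [X in _ + X](_ : _ = 0) ?addn0; last first.
    apply/eqP; rewrite cards_eq0; apply/eqP/setP=> s; rewrite !inE.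
    apply/negP=> /andP[/andP[_ xs] /andP[_ ws]].
    have := gdist_triangle conn s x w; rewrite E.
    have /eqP -> : d x s == 1 by rewrite gdist1.
    by have /eqP -> : d s w == 1 by rewrite gdist1 // adj_sym.
  rewrite -(NI y z) //; apply/subset_leq_card; rewrite subUset.
  by rewrite !subsetIl.
lia.
Qed.

Lemma b1E : b 1 + a 1 + 1 = k.
Proof. by have := bca_sum hG D1; rewrite (c1 hG) //; lia. Qed.

Lemma b1_bound : k.+1 <= 3 * b 1.
Proof. have := lambda_bound; have := b1E; lia. Qed.

Lemma card_graph_ge : 2 * k + 2 <= v /\ k + kk 2 + 2 <= v.
Proof.
have E0 := beyond0 hG; have E1 := beyond_rec b c D1; have E2 := beyond_rec b c D2.
have E3 := beyond_rec b c D3; have h3 := sphere_size_gt0 hG D3.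
have h12 : kk 1 <= kk 2 by apply: (sphere_size_le hG).
by rewrite (sphere_size1 hG) // in E1 h12; lia.
Qed.

Lemma cut_square A kap f : cut A <= f -> k <= kap <= kk 2 ->
  8 * kap * k * (#|A| * #|~: A|) <= f * (2 * v + 3 * kap - (2 * k + 2)) ^ 2.
Proof.
move=> Ff hkap; have h1 := cut_wiener hG A.
have h2 := wiener_square hG D2 k0 D3 hkap.
apply: leq_trans (leq_mul Ff h2).
have -> : 8 * kap * k * (#|A| * #|~: A|) = 8 * kap * (k * #|A| * #|~: A|) by ring.
by rewrite [leqRHS]mulnCA leq_mul2l h1 orbT.
Qed.

(** Let A be the smaller part. If it has at most k - 2 vertices, each of them
    has many neighbours outside. Otherwise a small cut gives a vertex with at
    most one neighbour outside (two if A has k - 1 vertices), against the flow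
    bounds. *)
Lemma cut_ge A : 5 <= k -> ~~ odd v -> odd #|A| -> 3 <= #|A| -> 3 <= #|~: A| ->
  2 * k - 1 <= cut A.
Proof.
move=> k5 evv.
wlog le : A / #|A| <= #|~: A| => [wl oA A3 A3'|oA A3 _].
  case/orP: (leq_total #|A| #|~: A|) => le; first exact: wl.
  rewrite -cutC; apply: wl; rewrite ?setCK //.
  by have := congr1 odd (cardsC A); rewrite oddD oA; move: evv; case: odd => //; case: odd.
rewrite leqNgt; apply/negP=> ltF.
have vE : v = #|A| + #|~: A| by rewrite cardsC.
have [v2 _] := card_graph_ge.
have parF := odd_cut A; rewrite oA andbT in parF.
pose f := if odd k then 2 * k - 3 else 2 * k - 2.
have Ff : cut A <= f by rewrite /f; case: ifP parF; lia.
have [e Ee] : exists e, #|~: A| = #|A| + e by exists (#|~: A| - #|A|); lia.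
have vE2 : v = 2 * #|A| + e by lia.
case: (leqP #|A| (k - 2)) => [lek|gek].
  have : #|A| * (k - #|A| + 1) <= cut A.
    rewrite -sum_nat_const; apply: leq_sum => x Ax.
    have : deg_in x A <= #|A| - 1.
      rewrite (cardsD1 x A) Ax addKn; apply/subset_leq_card/subsetP=> y.
      by rewrite !inE => /andP[-> h]; rewrite andbT; apply: contraTneq h => ->; rewrite adj_irrefl.
    by have := deg_inC x A hk; lia.
  move: ltF lek A3 k5; move: (cut A) #|A| => F n; clear => ltF lek A3 k5 h.
  have [i Ei] : exists i, n = i + 3 by exists (n - 3); lia.
  have [j Ej] : exists j, k = i + j + 5 by exists (k - n - 2); lia.
  have E : k - n + 1 = j + 3 by lia.
  by rewrite E Ei in h; nia.
have [gek2|Ek] : k <= #|A| \/ #|A| + 1 = k by lia.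
  have [|x Ax tx] := @few_out A 1; first lia.
  have f1 : 1 <= f by rewrite /f; case: ifP; lia.
  have := cut_from_vertex hG D2 k0 Ax (introT andP (conj tx f1)) Ff.
  have := cut_square Ff (kap := k).
  have hkk : k <= k <= kk 2.
    by rewrite leqnn -{1}(sphere_size1 hG D1); apply: (sphere_size_le hG).
  move=> /(_ hkk); rewrite vE2 Ee => h4 h3.
  have [b5|b5] : 5 <= b 1 \/ b 1 <= 4 by lia.
    apply: (large_b1_arith k5 b5 (a := #|A|) (e := e) (K := 2 * k - 3)); [lia|lia|].
    have hf : f - 1 <= 2 * k - 3 by rewrite /f; case: ifP; lia.
    move: h3; rewrite mul1n; clear -hf gek2; move: (b 1) (f - 1) (2 * k - 3) #|A| hf gek2.
    move=> b1 f1 K n hf kn h.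
    have [i Ei] : exists i, K = f1 + i by exists (K - f1); lia.
    by rewrite Ei; nia.
  apply: (small_b1_arith k5 _ b1_bound gek2 (erefl f)) h3 h4.
  by rewrite b5 andbT; have := b1_bound; lia.
have k6 : 6 <= k /\ f = 2 * k - 2.
  have evk : ~~ odd k by rewrite -Ek oddD oA.
  by rewrite /f (negbTE evk); split=> //; move: evk; case: (ltngtP k 5) => //; [lia|move=> ->].
case: k6 => k6 fE; have [|x Ax tx] := @few_out A 2; first lia.
have f2 : 2 <= f by lia.
have := cut_from_vertex hG D2 k0 Ax (introT andP (conj tx f2)) Ff.
rewrite vE2 Ee fE; apply: two_out_arith => //.
by have := b1_bound; lia.
Qed.

End Cuts.

(** * Edge cuts of triangle-free graphs *)

Lemma cut_arith8 k a e : 8 <= k ->  0 < a ->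
  k * (k - 1) * (a + e) + 1 * (k - 1) + (3 * k - 4 - 1) * (k + 1) <=
    (1 * (k - 1) + (3 * k - 4 - 1)) * (2 * a + e) -> False.
Proof.
move=> k8 a0; have [n ->] : exists n, k = n + 8 by exists (k - 8); lia.
have -> : n + 8 - 1 = n + 7 by lia.
have -> : 3 * (n + 8) - 4 - 1 = 3 * n + 19 by lia.
nia.
Qed.

Lemma cut_arith7 a e : 11 <= a ->
  7 * (7 - 1) * (a + e) + 1 * (7 - 1) + (17 - 1) * (7 + 1) <= (1 * (7 - 1) + (17 - 1)) * (2 * a + e) ->
  8 * 7 * 7 * (a * (a + e)) <= 17 * (2 * (2 * a + e) + 3 * 7 - (2 * 7 + 2)) ^ 2 -> False.
Proof. by move=> ka h3 h4; cut_finish a e h3 h4 ka. Qed.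

Lemma cut_arith6 a e : 9 <= a ->
  6 * (6 - 1) * (a + e) + 1 * (6 - 1) + (14 - 1) * (6 + 1) <= (1 * (6 - 1) + (14 - 1)) * (2 * a + e) ->
  8 * 6 * 6 * (a * (a + e)) <= 14 * (2 * (2 * a + e) + 3 * 6 - (2 * 6 + 2)) ^ 2 -> False.
Proof. by move=> ka h3 h4; cut_finish a e h3 h4 ka. Qed.

Lemma cut_arith5 a e : 7 <= a -> odd a ->
  5 * (5 - 1) * (a + e) + 1 * (5 - 1) + (11 - 1) * (5 + 1) <= (1 * (5 - 1) + (11 - 1)) * (2 * a + e) ->
  8 * 10 * 5 * (a * (a + e)) <= 11 * (2 * (2 * a + e) + 3 * 10 - (2 * 5 + 2)) ^ 2 -> False.
Proof.
move=> ka oa h3 h4; have {}ka : 9 <= a by move: oa ka; case: (ltngtP a 8) => //; [lia|move=> ->].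
by cut_finish a e h3 h4 ka.
Qed.

Lemma cut_arith4 a e : 9 <= a ->
  4 * (4 - 1) * (a + e) + 0 * (4 - 1) + (8 - 0) * (4 + 1) <= (0 * (4 - 1) + (8 - 0)) * (2 * a + e) ->
  8 * 6 * 4 * (a * (a + e)) <= 8 * (2 * (2 * a + e) + 3 * 6 - (2 * 4 + 2)) ^ 2 -> False.
Proof. by move=> ka h3 h4; have {}ka : 10 <= a; [lia|cut_finish a e h3 h4 ka]. Qed.

Lemma cut_arith3 a e : 7 <= a -> odd a -> ~~ odd e ->
  3 * (3 - 1) * (a + e) + 0 * (3 - 1) + (5 - 0) * (3 + 1) <= (0 * (3 - 1) + (5 - 0)) * (2 * a + e) ->
  8 * 6 * 3 * (a * (a + e)) <= 5 * (2 * (2 * a + e) + 3 * 6 - (2 * 3 + 2)) ^ 2 -> a = 7 /\ e = 0.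
Proof.
move=> ka oa oe h3 h4.
have [E|a9] : a = 7 \/ 9 <= a by move: oa ka; case: (ltngtP a 8) => //; [lia|lia|move=> ->].
  split=> //; rewrite E in h3 h4; rewrite ?expnS expn0 in h4.
  have : e <= 8 by lia.
  by move: oe h4; case: e {h3} => [|[|[|[|[|[|[|[|[|n]]]]]]]]] //= _ h4 h; lia.
exfalso; have p1 := leq_mul (leqnn e) h3; have p2 := leq_mul (leqnn a) h3.
rewrite ?expnS expn0 in h4.
have p3 : 50 * e <= 20 * a + 125 by lia.
have p4 := leq_mul (leqnn e) p3; have p5 := leq_mul (leqnn a) a9.
have p6 := leq_mul (leqnn e) a9; lia.
Qed.

Section TriangleFree.
Variables (G : sgraph) (k : nat) (b c : nat -> nat).
Hypothesis hG : drg G k b c.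
Hypothesis D3 : 2 < diameter G.
Hypothesis k3 : 2 < k.
Hypothesis lam0 : a_ k b c 1 = 0.
Hypothesis evv : ~~ odd #|G|.
Implicit Types (x y z w : G) (A : {set G}).
Local Notation d := (@gdist G).
Local Notation D := (diameter G).
Local Notation kk := (sphere_size b c).
Local Notation a := (a_ k b c).
Local Notation v := #|G|.
Local Notation cut A := (arcs A (~: A)).

Let conn : connected G. Proof. by case: hG. Qed.
Let hk : valency G k. Proof. by case: hG. Qed.
Let D1 : 0 < D. Proof. exact: ltn_trans D3. Qed.
Let D2 : 1 < D. Proof. exact: ltnW. Qed.
Let k0 : 0 < k. Proof. exact: ltn_trans k3. Qed.

Lemma no_triangle x y z : adj x y -> adj x z -> adj y z -> False.
Proof.
move=> xy xz yz; have := common_nbrs hG xy; rewrite lam0 => /eqP.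
by rewrite cards_eq0 => /eqP/setP/(_ z); rewrite !inE xz yz.
Qed.

Lemma gdist2 x y z : adj x y -> adj x z -> y != z -> ~~ adj y z -> d y z = 2.
Proof.
move=> xy xz nyz nadj; have := gdist_triangle conn x y z.
move: nyz nadj; rewrite -(gdist_eq0 conn) -(gdist1 conn).
rewrite -(gdist1 conn) gdist_sym // in xy; rewrite -(gdist1 conn) in xz.
by rewrite (eqP xy) (eqP xz); clear; lia.
Qed.

Lemma b1_triangle_free : b 1 = k - 1.
Proof. by have := b1E hG D3; rewrite lam0; lia. Qed.

Lemma cauchy_deg A : arcs A A ^ 2 <= #|A| * \sum_(x in A) deg_in x A ^ 2.
Proof.
have e1 : arcs A A ^ 2 = \sum_(x in A) \sum_(y in A) deg_in x A * deg_in y A.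
  by rewrite -mulnn {1}/arcs big_distrl /=; apply: eq_bigr => x _; rewrite big_distrr.
have e2 : 2 * (#|A| * \sum_(x in A) deg_in x A ^ 2) =
    \sum_(x in A) \sum_(y in A) (deg_in x A ^ 2 + deg_in y A ^ 2).
  under [RHS]eq_bigr => x _ do rewrite big_split /= sum_nat_const.
  by rewrite big_split /= -big_distrr /= sum_nat_const addnn mul2n.
rewrite -(leq_pmul2l (isT : 0 < 2)) e2 e1 big_distrr /=; apply: leq_sum => x _.
by rewrite big_distrr /=; apply: leq_sum => y _; exact: nat_Cauchy.
Qed.

(** Mantel's theorem: adjacent vertices have disjoint neighbourhoods, and the
    Cauchy-Schwarz inequality does the rest. *)
Lemma mantel A : 2 * arcs A A <= #|A| ^ 2.
Proof.
have h1 : 2 * \sum_(x in A) deg_in x A ^ 2 <= #|A| * arcs A A.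
  have e1 : \sum_(x in A) \sum_(y in A) adj x y * (deg_in x A + deg_in y A) =
      2 * \sum_(x in A) deg_in x A ^ 2.
    under eq_bigr => x _ do under eq_bigr => y _ do rewrite mulnDr.
    under eq_bigr => x _ do rewrite big_split /=.
    rewrite big_split /= mul2n -addnn; congr (_ + _).
      by apply: eq_bigr => x _; rewrite -big_distrl /= -deg_inE mulnn.
    rewrite exchange_big /=; apply: eq_bigr => y _.
    by rewrite -big_distrl /= -mulnn deg_inE; congr (_ * _); apply: eq_bigr => x _; rewrite adj_sym.
  rewrite -e1 /arcs big_distrr /=; apply: leq_sum => x Ax.
  rewrite [X in _ <= _ * X]deg_inE big_distrr /=; apply: leq_sum => y Ay.
  case: (boolP (adj x y)) => xy; rewrite ?mul0n // mul1n muln1 /deg_in -cardsUI.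
  rewrite [X in _ + X](_ : _ = 0) ?addn0; last first.
    apply/eqP; rewrite cards_eq0; apply/eqP/setP=> z; rewrite !inE.
    by apply/negP=> /andP[/andP[_ xz] /andP[_ yz]]; exact: no_triangle xy xz yz.
  by apply/subset_leq_card/subsetP=> z; rewrite !inE => /orP[|] /andP[].
have := cauchy_deg A; case: (posnP (arcs A A)) => [->|g0]; first by rewrite muln0.
move=> h2; rewrite -(leq_pmul2r g0) -mulnA mulnn.
apply: leq_trans (leq_mul (leqnn 2) h2) _.
by rewrite mulnCA -mulnn -mulnA leq_mul2l h1 orbT.
Qed.

(** The sum of squares counts the paths of length two inside A by their middle
    vertex. Counted by their ends, those with equal ends are the arcs of A,
    adjacent ends do not occur, and other ends have at most c 2 common
    neighbours. *)
Lemma two_paths A : \sum_(x in A) deg_in x A ^ 2 + c 2 * (#|A| + arcs A A) <=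
  arcs A A + c 2 * #|A| ^ 2.
Proof.
pose cd y z := \sum_(x in A) (adj x y * adj x z).
have e1 : \sum_(x in A) deg_in x A ^ 2 = \sum_(y in A) \sum_(z in A) cd y z.
  rewrite /cd; under [RHS]eq_bigr => y _ do rewrite exchange_big /=.
  rewrite [RHS]exchange_big /=; apply: eq_bigr => x _.
  rewrite -mulnn {1}deg_inE big_distrl /=; apply: eq_bigr => y _.
  by rewrite deg_inE big_distrr.
have e2 y : y \in A -> \sum_(z in A) cd y z + c 2 * (1 + deg_in y A) <=
    deg_in y A + c 2 * #|A|.
  move=> Ay; have -> : 1 + deg_in y A = \sum_(z in A) ((y == z) + adj y z).
    rewrite big_split /= -deg_inE (bigD1 y) //= eqxx big1 // => z /andP[_ /negPf].
    by rewrite eq_sym => ->.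
  have -> : deg_in y A + c 2 * #|A| = \sum_(z in A) ((y == z) * deg_in y A + c 2).
    rewrite big_split /= sum_nat_const mulnC (bigD1 y) //= eqxx mul1n big1 ?addn0 //.
    by move=> z /andP[_ /negPf]; rewrite eq_sym => ->.
  rewrite big_distrr /= -big_split /=; apply: leq_sum => z Az.
  case: (eqVneq y z) => [<-|nyz].
    rewrite adj_irrefl mul1n addn0 muln1 leq_add2r deg_inE leq_sum // => x _.
    by rewrite adj_sym; case: adj.
  case: (boolP (adj y z)) => yz.
    rewrite muln1 mul0n /cd big1 // => x _.
    case: (boolP (adj x y)) => xy; case: (boolP (adj x z)) => xz //.
    by case: (no_triangle xy xz yz).
  rewrite !mul0n muln0 addn0 add0n.
  have [x0 /andP[_ /andP[h1 h2]]|none] := pickP (fun x => [&& x \in A, adj x y & adj x z]).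
    suff E : d y z = 2.
      rewrite -E -(card_c hG) /cd E /deg_in -sum1dep_card big_mkcond [leqRHS]big_mkcond /=.
      apply: leq_sum => x _; case: (x \in A) => //.
      case: (boolP (adj x y)) => xy //; case: (boolP (adj x z)) => xz //.
      have /eqP dyx : d y x == 1 by rewrite gdist1 // adj_sym.
      by rewrite inE dyx adj_sym xz.
    exact: gdist2 h1 h2 nyz yz.
  rewrite /cd big1 // => x Ax; have := none x; rewrite Ax /=.
  by case: adj => //= ->.
rewrite e1 /arcs [X in c 2 * X](_ : _ = \sum_(y in A) (1 + deg_in y A)); last first.
  by rewrite big_split /= sum1_card.
rewrite big_distrr /= -big_split /= -mulnn mulnA -[X in _ <= _ + X]mulnC.
rewrite -sum_nat_const -big_split /=; apply: leq_sum => y Ay; exact: e2.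
Qed.

(** Equality in [mantel] is impossible for an odd number of vertices. *)
Lemma mantel_cut A : odd #|A| -> 2 * (k * #|A|) < 2 * cut A + #|A| ^ 2.
Proof.
move=> oA; have h := arcs_valency A hk; have m := mantel A.
have : 2 * arcs A A != #|A| ^ 2.
  by apply/eqP=> E; have := congr1 odd E; rewrite mul2n odd_double oddX oA.
lia.
Qed.

(** If at most k arcs leave A, the smaller part, then A has more than k vertices
    by [mantel_cut]. So it has a vertex without neighbours outside A, and by the
    flow from that vertex A would be larger than its complement. *)
Lemma cut_gt_k A : odd #|A| -> 3 <= #|A| -> 3 <= #|~: A| -> k < cut A.
Proof.
wlog le : A / #|A| <= #|~: A| => [wl oA A3 A3'|oA A3 _].
  case/orP: (leq_total #|A| #|~: A|) => le; first exact: wl.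
  rewrite -cutC; apply: wl; rewrite ?setCK //.
  by have := congr1 odd (cardsC A); rewrite oddD oA; move: evv; case: odd => //; case: odd.
rewrite ltnNge; apply/negP=> leF.
have kA : k < #|A|.
  have := mantel_cut oA; move: leF A3 k3; move: (cut A) #|A| => F n leF n3 k3' h.
  rewrite ltnNge; apply/negP=> nk.
  have [i Ei] : exists i, n = i + 3 by exists (n - 3); lia.
  have [j Ej] : exists j, k = n + j by exists (k - n); lia.
  by rewrite Ej Ei expnS expn1 in h leF; nia.
have [|x Ax tx] := @few_out G A 0; first lia.
have := cut_from_vertex hG D2 k0 Ax (introT andP (conj tx (leq0n k))) leF.
rewrite b1_triangle_free -(cardsC A) !mul0n !add0n addn0 subn0.
have [m Em] : exists m, k = m + 3 by exists (k - 3); lia.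
move: le; rewrite Em; move: #|A| #|~: A| => p q.
have -> : m + 3 - 1 = m + 2 by lia.
clear; nia.
Qed.

Hypothesis odd_dist : exists2 i, i <= D & 0 < a i.

(** As b 2 > 0, the only larger value of c 2 is k - 1. The second sphere then
    has k vertices with one neighbour farther away each, and the graph is a
    complete bipartite graph minus a perfect matching, without odd cycles. *)
Lemma c2_bound : c 2 + 2 <= k.
Proof.
have s1 := bca_sum hG D1; have s2 := bca_sum hG D2; have s3 := bca_sum hG D3.
have b2 := b_gt0 hG D3; rewrite leqNgt; apply/negP=> ck.
have r1 := sphere_size_rec hG 1; have r2 := sphere_size_rec hG 2.
rewrite (sphere_size1 hG) // b1_triangle_free in r1.
have c23 : c 2 <= c 3 by apply: (c_mono hG).
have k2E : kk 2 = k.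
  have E : c 2 = k - 1 by lia.
  by move/eqP: r1; rewrite E eqn_pmul2r; [move/eqP|lia].
have b2E : b 2 = 1 by lia.
rewrite k2E b2E muln1 in r2.
have c3k : c 3 = k.
  have [E|E] : c 3 = k - 1 \/ c 3 = k by lia.
    rewrite E in r2; case: (ltngtP (kk 3) 1) => h.
    - have h0 : kk 3 = 0 by lia.
      by rewrite h0 in r2; lia.
    - by have := leq_mul h (leqnn (k - 1)); rewrite -r2; lia.
    - by rewrite h in r2; lia.
  by [].
have D3E : D = 3.
  by apply/eqP; rewrite eqn_leq D3 andbT leqNgt; apply/negP=> D4; have := b_gt0 hG D4; lia.
case: odd_dist; rewrite D3E => -[|[|[|[|//]]]] _.
- by rewrite (a0 hG).
- by rewrite lam0.
- by lia.
- by lia.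
Qed.

(** A lower bound for kk 2 = k (k - 1) / c 2 under [c2_bound]. At k = 5 the
    value 10 uses that kk 2 is an integer, which excludes c 2 = 3. *)
Definition kappa : nat := if k <= 4 then 6 else if k == 5 then 10 else k.

Lemma kappa_bound : k <= kappa <= kk 2.
Proof.
have c2k := c2_bound; have c20 : 0 < c 2 by apply: (c_gt0 hG).
have r1 := sphere_size_rec hG 1; rewrite (sphere_size1 hG) // b1_triangle_free in r1.
rewrite /kappa; case: ifP => k4.
  have [E|E] : k = 3 \/ k = 4 by lia.
    rewrite E in r1 c2k *; have E2 : c 2 = 1 by lia.
    by rewrite E2 muln1 in r1; rewrite -r1.
  rewrite E in r1 c2k *; apply/andP; split=> //.
  have [E2|E2] : c 2 = 1 \/ c 2 = 2 by lia.
    by rewrite E2 in r1; lia.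
  by rewrite E2 in r1; lia.
case: eqP => [E|_].
  rewrite E in r1 c2k *; apply/andP; split=> //.
  have [E2|[E2|E2]] : c 2 = 1 \/ c 2 = 2 \/ c 2 = 3 by lia.
  - by rewrite E2 in r1; lia.
  - by rewrite E2 in r1; lia.
  - by rewrite E2 in r1; lia.
rewrite leqnn /=; have [m Em] : exists m, k = m + 3 by exists (k - 3); lia.
rewrite Em in r1 c2k *; rewrite leqNgt; apply/negP=> lt.
have : kk 2 * c 2 <= (m + 2) * (m + 1) by apply: leq_mul; lia.
by rewrite -r1; nia.
Qed.

Lemma card_graph_diam3 : D = 3 -> v = 1 + k + kk 2 + kk 3.
Proof.
move=> DE; rewrite (card_graph hG) DE !big_ord_recr big_ord0 /=.
by rewrite add0n (sphere_size1 hG).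
Qed.

Lemma card_graph_diam4 : 4 <= D -> k + (k + kk 2) + 2 <= v /\ k <= kk 3.
Proof.
move=> D4; rewrite (card_graph hG) -(big_mkord predT kk).
have h3 : kk 1 <= kk 3 by apply: (sphere_size_le hG).
have h4 := sphere_size_gt0 hG D4; rewrite (sphere_size1 hG) // in h3.
rewrite big_ltn // big_ltn // big_ltn // big_ltn // big_ltn ?ltnS //.
by rewrite (sphere_size1 hG) // -[kk 0]/1; lia.
Qed.

Lemma kk2E : kk 2 * c 2 = k * (k - 1).
Proof. by rewrite -(sphere_size_rec hG) (sphere_size1 hG) // b1_triangle_free. Qed.

Lemma not_bipartite3 : D = 3 -> a 2 = 0 -> 0 < a 3.
Proof.
case: odd_dist => i iD ai DE a2; move: iD ai; rewrite DE.
by case: i => [|[|[|[|//]]]] _; rewrite ?(a0 hG) ?lam0 ?a2.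
Qed.

Lemma two_paths_bound A : arcs A A ^ 2 + c 2 * #|A| * (#|A| + arcs A A) <=
  #|A| * arcs A A + c 2 * #|A| ^ 3.
Proof.
have h1 := cauchy_deg A; have h2 := two_paths A.
have h3 := leq_mul (leqnn #|A|) h2.
move: (\sum_(x in A) _) (arcs A A) #|A| h1 h3 => S g n; rewrite !expnS !expn0.
by lia.
Qed.

(** The part is too small for the flow bounds; instead, counting the paths of
    length two inside A bounds the number of arcs inside A. *)
Lemma cut5_valency4 A : k = 4 -> #|A| = 5 -> 8 < cut A.
Proof.
move=> kE AE; have h := arcs_valency A hk; have p := two_paths_bound A.
have c2k := c2_bound; rewrite kE AE in h p c2k; rewrite ltnNge; apply/negP=> Fle.
have g12 : 12 <= arcs A A by lia.
have [m Em] : exists m, arcs A A = m + 12 by exists (arcs A A - 12); lia.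
rewrite Em !expnS expn0 in p; have : c 2 <= 2 by lia.
by move: (c 2) p; clear; case=> [|[|[|]]] //; nia.
Qed.

(** The three vertices at distance 3 from x would form a triangle. *)
Lemma small_outer_sphere : k = 4 -> D = 3 -> kk 3 = 3 -> c 3 = 2 -> False.
Proof.
move=> kE DE k3E c3E; have [x [y Exy]] := dist_pair hG D3.
have b3 : b 3 = 0 by rewrite -DE (bD hG).
have s3 := bca_sum hG D3; have a3 : a 3 = 2 by lia.
have Ex : #|sphere x 3| = 3 by rewrite (card_sphere hG).
(* the outermost sphere has three vertices with two neighbours each in it *)
have all_adj z w : z \in sphere x 3 -> w \in sphere x 3 -> z != w -> adj z w.
  rewrite !inE => /eqP Ez /eqP Ew nzw.
  have h : deg_in z (sphere x 3) = 2 by have := card_a hG x z; rewrite Ez a3.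
  have sub : [set u in sphere x 3 | adj z u] \subset sphere x 3 :\ z.
    apply/subsetP=> u; rewrite !inE => /andP[-> zu]; rewrite andbT.
    by apply: contraTneq zu => ->; rewrite adj_irrefl.
  have /eqP E : [set u in sphere x 3 | adj z u] == sphere x 3 :\ z.
    rewrite eqEcard sub -/(deg_in z (sphere x 3)) h.
    by have := cardsD1 z (sphere x 3); rewrite Ex inE Ez eqxx; lia.
  have : w \in sphere x 3 :\ z by rewrite !inE eq_sym nzw Ew.
  by rewrite -E inE => /andP[].
have [z [w [u [zin win uin [zw zu wu]]]]] : exists z w u,
    [/\ z \in sphere x 3, w \in sphere x 3, u \in sphere x 3 & [/\ z != w, z != u & w != u]].
  have [z zS] : exists z, z \in sphere x 3 by apply/card_gt0P; rewrite Ex.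
  have c1 := cardsD1 z (sphere x 3); rewrite Ex zS in c1.
  have [w wS] : exists w, w \in sphere x 3 :\ z by apply/card_gt0P; lia.
  have c2' := cardsD1 w (sphere x 3 :\ z); rewrite wS in c2'.
  have [u uS] : exists u, u \in sphere x 3 :\ z :\ w by apply/card_gt0P; lia.
  move: wS uS; rewrite !inE => /andP[wz wS] /and3P[uw uz uS].
  by exists z, w, u; rewrite !inE in zS *; split=> //; split; rewrite // eq_sym.
by apply: (no_triangle (all_adj z w zin win zw) (all_adj z u zin uin zu)); apply: all_adj.
Qed.

(** [cut_three_levels] excludes c 2 = 1. For c 2 = 2 the diameter is 3 and few
    intersection numbers are left, which contradict [not_bipartite3] or
    [small_outer_sphere]. *)
Lemma cut7_valency4 A : k = 4 -> #|A| = 7 -> 7 <= #|~: A| -> 8 < cut A.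
Proof.
move=> kE AE A7; rewrite ltnNge; apply/negP=> Fle.
have [u uE] : exists u, #|~: A| = u + 7 by exists (#|~: A| - 7); lia.
have vE : v = u + 14 by rewrite -(cardsC A) AE uE; lia.
have ou : ~~ odd u by move: evv; rewrite vE oddD addbF.
have h := kk2E; have c20 : 0 < c 2 by apply: (c_gt0 hG).
have b20 := b_gt0 hG D3; have s2 := bca_sum hG D2; have s3 := bca_sum hG D3.
have r2 := sphere_size_rec hG 2.
have c23 : c 2 <= c 3 by apply: (c_mono hG).
have D1A : b 1 < #|A| by rewrite b1_triangle_free kE AE.
have three := cut_three_levels hG D2 k0 D3 D1A.
rewrite b1_triangle_free AE uE vE kE in three; have c2k := c2_bound; rewrite kE in h c2k s2 s3.
have {}three := leq_trans three (leq_mul Fle (leqnn _)).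
have [E|E] : c 2 = 1 \/ c 2 = 2 by lia.
  have k2E : kk 2 = 12 by rewrite E in h; lia.
  rewrite k2E in three; have : u + 14 - 1 - 4 - 12 <= u by lia.
  move: (u + 14 - 1 - 4 - 12) three => w.
  have -> : u + 14 - 1 = u + 13 by lia.
  have -> : u + 13 - 4 = u + 9 by lia.
  by move: (b 2) b20; clear; case=> // n _; rewrite !subSS !subn0; nia.
have k2E : kk 2 = 6 by rewrite E in h; lia.
rewrite k2E in r2 three; have vD : v = 14 -> D = 3.
  move=> v14; apply/eqP; rewrite eqn_leq D3 andbT leqNgt; apply/negP=> D4.
  by have [] := card_graph_diam4 D4; rewrite kE k2E v14.
have [b2E|b2E] : b 2 = 2 \/ b 2 = 1 by lia.
  rewrite b2E in three r2; have u0 : u = 0.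
    by have u1 : u <= 1; [lia|case: (u) ou u1 => [|[|]]].
  rewrite u0 in vE; have DE := vD vE.
  have cg := card_graph_diam3 DE; have nb := not_bipartite3 DE.
  rewrite kE k2E vE in cg; have k3E : kk 3 = 3 by lia.
  have a2 : a_ 4 b c 2 = 0 by lia.
  by rewrite kE in nb; have := nb a2; rewrite k3E in r2; lia.
have DE : D = 3.
  apply/eqP; rewrite eqn_leq D3 andbT leqNgt; apply/negP=> D4.
  by have := c_le_b hG (D4 : 2 + 2 <= D); rewrite E b2E.
have cg := card_graph_diam3 DE; rewrite kE k2E vE in cg.
rewrite b2E E in r2 c23.
have k33 : 3 <= kk 3 by lia.
have h6 := leq_mul k33 c23; have c3E : c 3 = 2.
  by have := leq_mul k33 (leqnn (c 3)); lia.
by apply: small_outer_sphere; rewrite // c3E in r2; lia.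
Qed.

(** A cut with 5 edges needs distances with sum at least 30 from each vertex,
    too much on 14 vertices. *)
Lemma cut7_valency3 A : k = 3 -> #|A| = 7 -> #|~: A| = 7 -> 5 < cut A.
Proof.
move=> kE AE AE'; rewrite ltnNge; apply/negP=> Fle.
have vE : v = 14 by rewrite -(cardsC A) AE AE'.
have kb := kappa_bound; rewrite /kappa kE /= in kb.
have h := cut_wiener hG A; rewrite AE AE' kE in h.
have w30 : 30 <= wiener G b c.
  by have := leq_trans h (leq_mul Fle (leqnn _)); lia.
have h2 := kk2E; have c20 : 0 < c 2 by apply: (c_gt0 hG).
have k2E : kk 2 = 6 by rewrite kE in h2; have := leq_mul (leqnn (kk 2)) c20; lia.
have [DE|D4] : D = 3 \/ 4 <= D by lia.
  have E0 := beyond0 hG; have E1 := beyond_rec b c D1; have E2 := beyond_rec b c D2.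
  rewrite (sphere_size1 hG) // in E1; move: w30.
  by rewrite /wiener DE !big_ord_recr big_ord0 /=; lia.
have := wiener_le hG D2 k0 D3 (kap := 6); rewrite kE => /(_ kb); rewrite vE.
move: (wiener G b c) D w30 D4; clear => w n w30 n4 h.
have [m Em] : exists m, n = m + 4 by exists (n - 4); lia.
by rewrite Em in h; lia.
Qed.

(** [mantel_cut] makes A large, so that it has a vertex with at most one
    neighbour outside, or none for valency 3 and 4. The bounds [cut_from_vertex]
    and [cut_square] then contradict each other except for the small parts of
    valency 3 and 4. *)
Lemma cut_small_part A : odd #|A| -> 5 <= #|A| -> #|A| <= #|~: A| ->
  cut A <= 3 * k - 4 -> k = 3 /\ #|A| = 5.
Proof.
move=> oA A5 le Fle.
have ev : ~~ odd (#|~: A| - #|A|).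
  by rewrite oddB // oA; move: evv; rewrite -(cardsC A) oddD oA; case: odd.
have [e Ee] : exists e, #|~: A| = #|A| + e by exists (#|~: A| - #|A|); lia.
rewrite Ee addKn in ev.
have vE : v = 2 * #|A| + e by rewrite -(cardsC A) Ee; lia.
have kA : 2 * k <= #|A| + 3.
  have := mantel_cut oA; move: Fle A5 oA k3; move: (cut A) #|A| => F n Fle n5 on k3' h.
  rewrite leqNgt; apply/negP=> nk.
  have [i Ei] : exists i, n = i + 5 by exists (n - 5); lia.
  have [j Ej] : exists j, 2 * k = n + 4 + j by exists (2 * k - n - 4); lia.
  have E1 : 2 * (k * n) = 2 * k * n by ring.
  rewrite E1 Ej Ei !expnS expn0 in h; have : 2 * F + 8 <= 3 * (n + 4 + j) by lia.
  by rewrite Ei; move: h; clear; nia.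
have sq := cut_square hG D3 k3 Fle kappa_bound.
have [|x1 Ax1 t1] := @few_out G A 1; first lia.
have t1f : 1 <= 3 * k - 4 by lia.
have I1 := cut_from_vertex hG D2 k0 Ax1 (introT andP (conj t1 t1f)) Fle.
rewrite b1_triangle_free vE Ee in I1; rewrite vE Ee in sq.
case: (leqP 8 k) => k8; first by case: (cut_arith8 k8 _ I1); lia.
have [E|[E|[E|[E|E]]]] : k = 7 \/ k = 6 \/ k = 5 \/ k = 4 \/ k = 3 by lia.
- by rewrite /kappa E /= in kA I1 sq; case: (@cut_arith7 #|A| e _ I1 sq); lia.
- by rewrite /kappa E /= in kA I1 sq; case: (@cut_arith6 #|A| e _ I1 sq); lia.
- by rewrite /kappa E /= in kA I1 sq; case: (@cut_arith5 #|A| e _ oA I1 sq); lia.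
- exfalso; rewrite /kappa E /= in sq.
  have Fle8 : cut A <= 8 by lia.
  have [A5E|[A7E|A9]] : #|A| = 5 \/ #|A| = 7 \/ 9 <= #|A|.
    move: A5 oA; case: (ltngtP #|A| 6) => [|h|->] //; first lia.
    by case: (ltngtP #|A| 8) => [|h2|->] //; lia.
  + by have := cut5_valency4 E A5E; lia.
  + by have := cut7_valency4 E A7E; rewrite A7E in le => /(_ le); lia.
  + have [|x0 Ax0 t0] := @few_out G A 0; first lia.
    have := cut_from_vertex hG D2 k0 Ax0 (introT andP (conj t0 (leq0n _))) Fle8.
    by rewrite b1_triangle_free vE Ee E => I0; exact: cut_arith4 A9 I0 sq.
- split=> //; have [//|A7] : #|A| = 5 \/ 7 <= #|A|.
    by move: A5 oA; case: (ltngtP #|A| 6) => [|h|->] //; lia.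
  exfalso; have Fle5 : cut A <= 5 by lia.
  rewrite /kappa E /= in sq.
  have [|x0 Ax0 t0] := @few_out G A 0; first lia.
  have := cut_from_vertex hG D2 k0 Ax0 (introT andP (conj t0 (leq0n _))) Fle5.
  rewrite b1_triangle_free vE Ee E => I0.
  have [AE e0] := cut_arith3 A7 oA ev I0 sq.
  by have := cut7_valency3 E AE; rewrite Ee e0 AE addn0 => /(_ erefl); lia.
Qed.

End TriangleFree.

(** * Closed walks and bipartitions *)

Section Walks.
Variables (G : sgraph) (k : nat) (b c : nat -> nat).
Hypothesis hG : drg G k b c.
Implicit Types (x y z w u : G) (X : {set G}).
Local Notation d := (@gdist G).

Let conn : connected G. Proof. by case: hG. Qed.
Let hk : valency G k. Proof. by case: hG. Qed.

Fixpoint walks (n : nat) x y : nat :=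
  if n is m.+1 then \sum_(z | adj x z) walks m z y else x == y.

Lemma walks_cat m n x y : walks (m + n) x y = \sum_z walks m x z * walks n z y.
Proof.
elim: m x => [|m IH] x /=.
  rewrite (bigD1 x) //= eqxx mul1n big1 ?addn0 // => z /negPf.
  by rewrite eq_sym => ->.
under [RHS]eq_bigr do rewrite big_distrl /=.
by rewrite exchange_big /=; apply: eq_bigr => z _; rewrite IH.
Qed.

Lemma walks_class n : dist_class (walks n).
Proof.
elim: n => [|n IH]; last exact: (dist_class_nbr hG IH).
by move=> x y x' y' E /=; rewrite -!(gdist_eq0 conn) E.
Qed.

Lemma walks_gdist x y : 0 < walks (d x y) x y.
Proof.
have [n E] : exists n, d x y = n by exists (d x y).
rewrite E; elim: n x E => [|n IH] x E /=.
  by move/eqP: E; rewrite gdist_eq0 // => ->.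
have [z zx Ez] := gdist_pred conn (etrans (gdist_sym conn y x) E).
rewrite gdist_sym // in Ez; rewrite adj_sym in zx.
by rewrite (bigD1 z) //= addn_gt0 IH.
Qed.

Fixpoint bicolored_walks X (n : nat) x y : nat :=
  if n is m.+1 then
    \sum_(z | adj x z && ((x \in X) != (z \in X))) bicolored_walks X m z y
  else x == y.

Lemma bicolored_walks_odd X n x y :
  odd n != ((x \in X) != (y \in X)) -> bicolored_walks X n x y = 0.
Proof.
elim: n x => [|n IH] x /=; first by case: (eqVneq x y) => [->|//]; rewrite eqxx.
move=> h; rewrite big1 // => z /andP[_ xz]; apply: IH.
by move: h xz; case: (odd n); do 3 case: (_ \in _).
Qed.

(** A walk that does not change sides with respect to X at every step has a
    first edge inside X or inside its complement. *)
Lemma walks_split X n x y : walks n x y <= bicolored_walks X n x y +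
  \sum_(i < n) \sum_u \sum_(w | adj u w && ((u \in X) == (w \in X)))
     walks i x u * walks (n - i.+1) w y.
Proof.
elim: n x => [|n IH] x; first by rewrite /= leq_addr.
pose T i x' := \sum_u \sum_(w | adj u w && ((u \in X) == (w \in X)))
  walks i x' u * walks (n - i.+1) w y.
have e0 : \sum_u \sum_(w | adj u w && ((u \in X) == (w \in X)))
    walks 0 x u * walks n w y =
    \sum_(w | adj x w && ((x \in X) == (w \in X))) walks n w y.
  rewrite (bigD1 x) //= [X in _ + X]big1 ?addn0 => [|u /negPf nu].
    by apply: eq_bigr => w _; rewrite eqxx mul1n.
  by rewrite big1 // => w _; rewrite eq_sym nu.
have eS (i : 'I_n) : \sum_u \sum_(w | adj u w && ((u \in X) == (w \in X)))
    walks i.+1 x u * walks (n.+1 - i.+2) w y = \sum_(z | adj x z) T i z.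
  rewrite /T [RHS]exchange_big /=; apply: eq_bigr => u _.
  rewrite [RHS]exchange_big /=; apply: eq_bigr => w _.
  by rewrite subSS big_distrl.
rewrite big_ord_recl /bump /= subSS subn0 e0.
rewrite (eq_bigr _ (fun i _ => eS i)) exchange_big /=.
rewrite (bigID (fun z => (x \in X) != (z \in X))) /=.
rewrite [X in _ + X](eq_bigl (fun z => adj x z && ((x \in X) == (z \in X)))); last first.
  by move=> z; rewrite negbK.
rewrite addnCA addnC leq_add2l.
rewrite [X in _ + X](bigID (fun z => (x \in X) != (z \in X))) /= addnA.
apply: leq_trans (leq_addr _ _); rewrite -big_split /=.
by apply: leq_sum => z _; exact: IH.
Qed.

(** Every closed walk of odd length n + 1 has an edge with both ends on the same
    side of X, and all edges start equally many of these walks. Counted with the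
    n + 1 positions of such an edge, these walks cover all closed walks. *)
Lemma monochromatic_arcs X n : ~~ odd n -> 0 < n ->
  (exists x, 0 < walks n.+1 x x) ->
  #|G| * k <= n.+1 * (arcs X X + arcs (~: X) (~: X)).
Proof.
move=> ev n0 [x0 wx0].
have [f hf] := dist_classP (@walks_class n).
have nbr x y : adj x y -> walks n y x = f 1.
  by rewrite adj_sym -(gdist1 conn) => /eqP E; rewrite hf E.
have wS x : walks n.+1 x x = k * f 1.
  rewrite /= -(hk x) -sum_nat_const; apply: eq_big => [z|z /nbr //].
  by rewrite inE.
have f0 : 0 < f 1 by move: wx0; rewrite wS muln_gt0; case/andP.
rewrite -(leq_pmul2r f0) -mulnA -(wS x0).
have -> : #|G| * walks n.+1 x0 x0 = \sum_x walks n.+1 x x.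
  by rewrite -sum_nat_const; apply: eq_big => // x _; rewrite !wS.
have sum_le : \sum_x walks n.+1 x x <= \sum_x \sum_(i < n.+1) \sum_u
    \sum_(w | adj u w && ((u \in X) == (w \in X))) walks i x u * walks (n.+1 - i.+1) w x.
  apply: leq_sum => x _; apply: leq_trans (walks_split X n.+1 x x) _.
  by rewrite bicolored_walks_odd ?add0n // eqxx /= ev.
apply: leq_trans sum_le _; rewrite exchange_big /=.
rewrite (eq_bigr (fun=> (arcs X X + arcs (~: X) (~: X)) * f 1)).
  by rewrite sum_nat_const card_ord mulnA.
move=> i _; rewrite exchange_big /=.
under eq_bigr do rewrite exchange_big /=.
have inner u w : adj u w -> \sum_x walks i x u * walks (n.+1 - i.+1) w x = f 1.
  move=> uw; rewrite -(nbr _ _ uw); rewrite subSS.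
  have E : (n - i) + i = n by rewrite subnK // -ltnS.
  by rewrite -[in RHS]E walks_cat; apply: eq_bigr => x _; rewrite mulnC.
rewrite mulnDl /arcs !big_distrl /= [LHS](bigID (mem X)) /=; congr (_ + _).
  apply: eq_bigr => u Xu; rewrite deg_inE big_distrl [RHS]big_mkcond [LHS]big_mkcond /=.
  apply: eq_bigr => w _; rewrite Xu; case: (boolP (w \in X)) => Xw /=; last by rewrite andbF.
  by rewrite andbT; case: (boolP (adj u w)) => uw; rewrite ?mul0n // mul1n inner.
rewrite [RHS](eq_bigl (fun u => u \notin X)) => [|u]; last by rewrite inE.
apply: eq_bigr => u Xu; rewrite deg_inE big_distrl [RHS]big_mkcond [LHS]big_mkcond /=.
apply: eq_bigr => w _; rewrite inE (negPf Xu).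
case: (boolP (w \in X)) => Xw /=; first by rewrite andbF.
by rewrite andbT; case: (boolP (adj u w)) => uw; rewrite ?mul0n // mul1n inner.
Qed.

End Walks.

(** * Odd girth *)

Section OddGirth.
Variables (G : sgraph) (k : nat) (b c : nat -> nat) (dd : nat).
Hypothesis hG : drg G k b c.
Hypothesis ddD : dd <= diameter G.
Hypothesis a_dd : 0 < a_ k b c dd.
Hypothesis a_lt : forall i, i < dd -> a_ k b c i = 0.
Implicit Types (x y z w : G) (X : {set G}).
Local Notation d := (@gdist G).
Local Notation D := (diameter G).
Local Notation a := (a_ k b c).

Let conn : connected G. Proof. by case: hG. Qed.

(** An edge with both ends at distance i from x makes a i positive. *)
Lemma equidistant_adj x y z : adj y z -> d x y = d x z -> dd <= d x y.
Proof.
move=> yz E; rewrite leqNgt; apply/negP=> /a_lt; rewrite -(card_a hG) => /eqP.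
rewrite /deg_in cards_eq0 => /eqP/setP/(_ z).
by rewrite !inE E eqxx yz.
Qed.

(** Moving r along a shortest path to q changes the parity of the perimeter only
    at an edge whose ends are equally far from p. *)
Lemma odd_perimeter p q r : odd (d p q + d q r + d r p) ->
  2 * dd < d p q + d q r + d r p.
Proof.
have [n] : exists n, d q r = n by exists (d q r).
elim: n r => [|n IH] r E.
  have /eqP <- : q == r by rewrite -(gdist_eq0 conn) E.
  by rewrite gdistxx // addn0 (gdist_sym conn q) addnn odd_double.
have [r' r'r Er'] := gdist_pred conn E; rewrite E => odd_r.
have [h1 h2] := gdist_adj conn p r'r.
have tri := gdist_triangle conn q p r'; rewrite Er' in tri.
case: (eqVneq (d p r') (d p r)) => [e|ne].
  have := equidistant_adj r'r e; rewrite (gdist_sym conn r); lia.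
have := IH r' Er'; rewrite Er' (gdist_sym conn r') => h.
rewrite (gdist_sym conn r) in odd_r *.
suff /h : odd (d p q + n + d p r') by lia.
have [E2|E2] : d p r = (d p r').+1 \/ d p r' = (d p r).+1 by lia.
  by move: odd_r; rewrite E2 !addnS addSn /= negbK.
by move: odd_r; rewrite E2 !addnS !addSn.
Qed.

Lemma odd_closed_walk : exists x : G, 0 < walks (dd.*2).+1 x x.
Proof.
have [x [y E]] := dist_pair hG ddD.
have [z] : exists z, z \in [set z in sphere x (d x y) | adj y z].
  by apply/card_gt0P; rewrite -/(deg_in y _) (card_a hG) E.
rewrite !inE => /andP[/eqP Ez yz]; rewrite E in Ez; exists x.
rewrite -addnn -addnS walks_cat (bigD1 y) //= addn_gt0; apply/orP; left.
rewrite muln_gt0 -{1}E (walks_gdist hG) /= (bigD1 z) //= addn_gt0; apply/orP; left.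
by rewrite -Ez gdist_sym // (walks_gdist hG).
Qed.

(** The smallest dd with a dd > 0 makes 2 dd + 1 the odd girth. So this bounds
    the number of edges inside the two sides of any bipartition. *)
Lemma max_cut_bound X : 0 < dd ->
  #|G| * k <= (2 * dd + 1) * (arcs X X + arcs (~: X) (~: X)).
Proof.
move=> dd0; rewrite mul2n addn1; apply: (monochromatic_arcs hG).
- by rewrite odd_double.
- by rewrite double_gt0.
- exact: odd_closed_walk.
Qed.

Hypothesis dd2 : 1 < dd.

(** The vertices w, y and z are consecutive on a cycle of length 2 dd + 1
    through x, with y and z farthest from x, and z' is the vertex opposite to w
    on this cycle. By [odd_perimeter] the neighbours of w closer to z' are
    farther from x. *)
Lemma c_le_b_odd : c dd <= b dd.-1.
Proof.
have [x [y E]] := dist_pair hG ddD.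
have [z] : exists z, z \in [set z in sphere x (d x y) | adj y z].
  by apply/card_gt0P; rewrite -/(deg_in y _) (card_a hG) E.
rewrite !inE => /andP[/eqP Ez yz]; rewrite E in Ez.
have Ed : d x y = dd.-1.+1 by rewrite prednK // ltnW.
have [w wy Ew] := gdist_pred conn Ed.
have [|z' Ez' Ez'z] := gdist_between conn (i := 2) (x := x) (y := z); first by rewrite Ez.
rewrite Ez in Ez'z.
have dwy : d w y = 1 by apply/eqP; rewrite gdist1.
have dyz : d y z = 1 by apply/eqP; rewrite gdist1.
have dwz : d w z = 2.
  have t1 := gdist_triangle conn y w z; have t2 := gdist_triangle conn w x z.
  have := @odd_perimeter w y z; rewrite dwy dyz (gdist_sym conn z) => h.
  have [e|[e|//]] : d w z = 0 \/ d w z = 1 \/ d w z = 2 by lia.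
    by lia.
  by rewrite e in h; have := h isT; lia.
have dwz' : d w z' = dd.
  have dzz' : d z z' = dd - 2 by rewrite gdist_sym.
  have t1 := gdist_triangle conn z w z'; rewrite dwz dzz' in t1.
  have p1 := @odd_perimeter x w z'; rewrite Ew (gdist_sym conn z') Ez' in p1.
  have p2 := @odd_perimeter w z z'; rewrite dwz dzz' (gdist_sym conn z') in p2.
  apply/eqP; rewrite eqn_leq; apply/andP; split; first by lia.
  rewrite leqNgt; apply/negP=> lt.
  case: (boolP (odd (dd.-1 + d w z' + 2))) => [/p1|ev]; first by lia.
  have : odd (2 + (dd - 2) + d w z').
    by move: ev; rewrite !oddD oddB //; case: dd dd2 => // m _; rewrite /=; case: (odd m); case: (odd _).
  by move/p2; lia.
rewrite -{1}dwz' -Ew (gdist_sym conn w z') -(card_c hG) -(card_b hG).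
apply/subset_leq_card/subsetP=> u; rewrite !inE => /andP[/eqP Eu wu].
rewrite wu andbT (gdist_sym conn z' w) dwz' in Eu *.
have dwu : d w u = 1 by apply/eqP; rewrite gdist1.
have [h1 h2] := gdist_adj conn x wu.
case: (eqVneq (d x w) (d x u)) => [e|ne].
  by have := equidistant_adj wu e; lia.
have p1 := @odd_perimeter x u z'.
rewrite (gdist_sym conn u z') (gdist_sym conn z' x) Ez' in p1.
have [e|e] : d x u = dd \/ d x u = dd - 2 by lia.
  by rewrite e Ew prednK // ltnW.
have : odd (d x u + d z' u + 2) by rewrite e; lia.
by move/p1; lia.
Qed.

End OddGirth.

Section OddGirthOrder.
Variables (G : sgraph) (k : nat) (b c : nat -> nat) (dd : nat).
Hypothesis hG : drg G k b c.
Hypothesis D3 : 2 < diameter G.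
Hypothesis k3 : 2 < k.
Hypothesis lam0 : a_ k b c 1 = 0.
Hypothesis evv : ~~ odd #|G|.
Hypothesis ddD : dd <= diameter G.
Hypothesis a_dd : 0 < a_ k b c dd.
Hypothesis a_lt : forall i, i < dd -> a_ k b c i = 0.
Local Notation D := (diameter G).
Local Notation kk := (sphere_size b c).
Local Notation a := (a_ k b c).
Local Notation v := #|G|.

Let odd_dist : exists2 i, i <= D & 0 < a i. Proof. by exists dd. Qed.
Let kap := kappa_bound hG D3 k3 lam0 evv odd_dist.

Lemma dd_ge2 : 1 < dd.
Proof.
case: (dd) a_dd => [|[|//]]; first by rewrite (a0 hG).
by rewrite lam0.
Qed.

Lemma sphere_size_odd i : 2 <= i <= dd -> kk 2 <= kk i.
Proof.
case/andP; elim: i => // i IH; rewrite leq_eqVlt => /orP[/eqP<- //|i2] idd.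
have bi : 0 < b i by apply: (b_gt0 hG); lia.
apply: leq_trans (IH i2 (ltnW idd)) _.
rewrite -(leq_pmul2r bi) (sphere_size_rec hG) leq_mul2l; apply/orP; right.
apply: (@leq_trans (c dd)); first by apply: (c_mono hG); lia.
have := c_le_b_odd hG ddD a_dd a_lt dd_ge2; have := dd_ge2 => dd2 h.
by apply: leq_trans h _; apply: (b_mono hG); lia.
Qed.

(** By [c_le_b_odd] the spheres of radius 2, ..., dd have at least [kappa k]
    vertices. *)
Lemma card_graph_gt : 4 * dd + 2 < v.
Proof.
have dd2 := dd_ge2.
have s1 : kk 1 = k by apply: (sphere_size1 hG); lia.
have low n : 1 <= n <= dd -> 1 + k + n.-1 * kappa k <= \sum_(i < n.+1) kk i.
  elim: n => // -[|n] IH /andP[_ ndd].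
    by rewrite !big_ord_recr big_ord0 /= s1 -[kk 0]/1; lia.
  rewrite big_ord_recr /=; have := IH (ltnW ndd).
  have h : kk 2 <= kk n.+2 by apply: sphere_size_odd.
  by case/andP: kap => _ h2; have := leq_trans h2 h; rewrite /= mulSn; lia.
have h1 : 1 + k + dd.-1 * kappa k <= \sum_(i < dd.+1) kk i by apply: low; lia.
have h2 : \sum_(i < dd.+1) kk i + (dd < D) <= v.
  rewrite (card_graph hG) -!(big_mkord predT kk) [X in _ <= X](big_cat_nat (n := dd.+1)) //=.
  rewrite leq_add2l; case: ltnP => // lt.
  by rewrite big_ltn // ltn_addr // (sphere_size_gt0 hG).
have [m Em] : exists m, dd = m + 2 by exists (dd - 2); lia.
move: h1 h2; rewrite /kappa Em (_ : (m + 2).-1 = m + 1); last lia.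
move: (\sum_(i < _) _) => S; case: ifP => k4.
  have [E|E] : k = 3 \/ k = 4 by lia.
    rewrite E; case: (ltnP (m + 2) D) => lt; lia.
  by rewrite E; case: (_ < D); lia.
case: eqP => [->|ne]; first by case: (_ < D); lia.
have [j ->] : exists j, k = j + 6 by exists (k - 6); lia.
by case: (_ < D); nia.
Qed.

End OddGirthOrder.

(** * Valency four with one triangle on each edge *)

Section ValencyFour.
Variables (G : sgraph) (b c : nat -> nat).
Hypothesis hG : drg G 4 b c.
Hypothesis D3 : 2 < diameter G.
Hypothesis lam1 : a_ 4 b c 1 = 1.
Implicit Types (x y z w u : G).
Local Notation d := (@gdist G).
Local Notation D := (diameter G).
Local Notation kk := (sphere_size b c).

Let conn : connected G. Proof. by case: hG. Qed.
Let hk : valency G 4. Proof. by case: hG. Qed.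

Lemma third_vertex x y : adj x y -> exists2 z, adj x z & adj y z.
Proof.
move=> xy; have h := common_nbrs hG xy; rewrite lam1 in h.
have [z] : exists z, z \in [set z | adj x z & adj y z] by apply/card_gt0P; rewrite h.
by rewrite inE => /andP[]; exists z.
Qed.

Lemma third_vertex_uniq x y z z' : adj x y -> adj x z -> adj y z -> adj x z' ->
  adj y z' -> z = z'.
Proof.
move=> xy xz yz xz' yz'; have h := common_nbrs hG xy; rewrite lam1 in h.
have /cards1P[t E] : #|[set z | adj x z & adj y z]| == 1 by rewrite h.
have : z \in [set t] by rewrite -E inE xz yz.
have : z' \in [set t] by rewrite -E inE xz' yz'.
by rewrite !inE => /eqP-> /eqP->.
Qed.

(** The neighbours of a vertex form two disjoint edges. *)
Lemma other_line x o o' g h : adj x o -> adj x o' -> adj o o' ->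
  adj x g -> adj x h -> g \notin [set o; o'] -> h \notin [set o; o'] ->
  g != h -> adj g h.
Proof.
move=> xo xo' oo' xg xh; rewrite !inE !negb_or => /andP[go go'] /andP[ho ho'] gh.
have [t xt gt] := third_vertex xg.
have to : t != o.
  apply: contraNneq go' => E; subst t; apply/eqP.
  by apply: (third_vertex_uniq xo xg) => //; rewrite adj_sym.
have to' : t != o'.
  apply: contraNneq go => E; subst t; apply/eqP.
  by apply: (third_vertex_uniq xo' xg) => //; rewrite adj_sym.
have tg : t != g by apply: contraTneq gt => ->; rewrite adj_irrefl.
case: (eqVneq t h) => [<- //|th].
have oo : o != o' by apply: contraTneq oo' => ->; rewrite adj_irrefl.
(* otherwise x would have five neighbours *)
have un : uniq [:: o; o'; g; h; t].
  by rewrite /= !inE !negb_or oo !(eq_sym o) !(eq_sym o') go ho to go' ho' to' gh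
    (eq_sym g) tg (eq_sym h) th.
have := uniq_leq_size un (s2 := enum [set y | adj x y]).
rewrite -cardE hk => /(_ _)/=; have F : 5 <= 4 = false by [].
rewrite F; suff h5 : {subset [:: o; o'; g; h; t] <= enum [set y | adj x y]} by move/(_ h5).
by move=> s; rewrite mem_enum !inE => /or4P[|||/orP[]] /eqP->.
Qed.

Let s1 := bca_sum hG (leq_trans (isT : 1 <= 3) D3).
Let b1 : b 1 = 2.
Proof. by have := s1; rewrite lam1 (c1 hG) //; [lia|exact: leq_trans D3]. Qed.

Lemma closer_uniq i x y z z' : c i = 1 -> d x y = i -> adj y z -> adj y z' ->
  (d x z).+1 = i -> (d x z').+1 = i -> z = z'.
Proof.
move=> ci E yz yz' Ez Ez'; have := card_c hG x y; rewrite E ci => h.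
have /cards1P[t Et] : #|[set z in [set z | (d x z).+1 == i] | adj y z]| == 1 by rewrite -h.
have : z \in [set t] by rewrite -Et !inE Ez eqxx.
have : z' \in [set t] by rewrite -Et !inE Ez' eqxx.
by rewrite !inE => /eqP-> /eqP->.
Qed.

(** Let w be a farther neighbour of x, in a triangle with the neighbour z that
    is as far as x. As b i = 2, there is another farther neighbour, and the
    triangle at x without w and z joins it to a closer neighbour. *)
Lemma two_levels_apart i y x w z : 0 < i -> b i = 2 -> d y x = i -> adj x w -> adj x z ->
  adj w z -> d y w = i.+1 -> d y z = i -> False.
Proof.
move=> i0 bi E xw xz wz Ew Ez; have := card_b hG y x; rewrite E bi => h.
have h1 := cardsD1 w [set s in sphere y i.+1 | adj x s].
rewrite !inE Ew eqxx xw /= -/(deg_in x _) h in h1.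
have [w2] : exists w2, w2 \in [set s in sphere y i.+1 | adj x s] :\ w.
  by apply/card_gt0P; lia.
rewrite !inE => /and3P[w2w /eqP Ew2 xw2].
have [|e ex Ee] := @gdist_pred G conn y x i.-1; first by rewrite prednK.
rewrite adj_sym in ex.
have ne2 : e != w2 by apply/eqP=> F; rewrite F Ew2 in Ee; lia.
have : adj e w2.
  apply: (other_line xw xz wz ex xw2 _ _ ne2); rewrite !inE negb_or.
    by apply/andP; split; apply/eqP=> F; rewrite F ?Ew ?Ez in Ee;
      move: Ee i0; clear; lia.
  by rewrite w2w; apply/eqP=> F; rewrite F Ez in Ew2; move: Ew2; clear; lia.
move=> ew; have [h2 _] := gdist_adj conn y ew; rewrite Ee Ew2 in h2.
by move: h2 i0; clear; lia.
Qed.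

(** Two closer neighbours a and a' of x would lie in the triangle at x that does
    not contain the farther neighbour w. From a, this is the situation of
    [two_levels_apart]. *)
Lemma step_c i : 0 < i -> i.+2 <= D -> b i = 2 -> c i.+1 = 1.
Proof.
move=> i0 iD bi; have [y [w Ew]] := dist_pair hG iD.
have [x xw Ex] := gdist_pred conn Ew; have [w' xw' ww'] := third_vertex xw.
have cpos : 0 < c i.+1 by apply: (c_gt0 hG); lia.
apply/eqP; rewrite eqn_leq cpos andbT leqNgt; apply/negP=> c2.
have := card_c hG y x; rewrite Ex => h.
have [a aS] : exists a, a \in [set s in [set s | (d y s).+1 == i.+1] | adj x s].
  by apply/card_gt0P; rewrite -/(deg_in x _) h.
have h1 := cardsD1 a [set s in [set s | (d y s).+1 == i.+1] | adj x s].
rewrite aS -/(deg_in x _) h in h1.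
have [a'] : exists a', a' \in [set s in [set s | (d y s).+1 == i.+1] | adj x s] :\ a.
  by apply/card_gt0P; lia.
move: aS; rewrite !inE => /andP[/eqP[Ea] xa] /and3P[a'a /eqP[Ea'] xa'].
have far s : adj x s -> d y s = i -> s \notin [set w; w'].
  move=> xs Es; rewrite !inE negb_or; apply/andP; split.
    by apply/eqP=> F; rewrite F Ew in Es; lia.
  apply/eqP=> F; rewrite F in Es; rewrite adj_sym in ww'.
  by have [h2 _] := gdist_adj conn y ww'; rewrite Es Ew in h2; lia.
have aa' : adj a a'.
  by apply: (other_line xw xw' ww' xa xa' (far _ xa Ea) (far _ xa' Ea')); rewrite eq_sym.
rewrite adj_sym in xa.
exact: (two_levels_apart i0 bi Ea xa aa' xa' Ex Ea').
Qed.

(** Start a shortest path of length j + 3 with the edge o p, end it with the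
    edge u w, and complete these edges to triangles with o' and z. If b j.+1
    were 1, then z would be as far from p as u is. The neighbours g and y of p
    on shortest paths to z and to u are not in the triangle of o and p; they are
    equal, against [two_levels_apart], or adjacent, and then u has two
    neighbours one step closer to g or p has two one step closer to u. *)
Lemma step_b j : 0 < j -> j.+3 <= D -> c j.+1 = 1 -> b j = 2 -> b j.+1 = 2.
Proof.
move=> j0 jD ci bj.
have bpos : 0 < b j.+1 by apply: (b_gt0 hG); exact: ltnW.
have ble : b j.+1 <= 2.
  by rewrite -b1; apply: (b_mono hG); rewrite /= (leq_trans _ jD) // ltnW.
case: (eqVneq (b j.+1) 2) => // bn2; exfalso.
have {bn2 ble bpos} bi : b j.+1 = 1 by lia.
have [o [w Eow]] := dist_pair hG jD.
have [p op Epw] := gdist_pred conn (etrans (gdist_sym conn w o) Eow).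
rewrite gdist_sym // in Epw.
have [u uw Epu] := gdist_pred conn Epw.
have [z uz wz] := third_vertex uw.
have [o' po' oo'] := third_vertex op.
have Eou : j.+2 <= d o u.
  by have [h _] := gdist_adj conn o uw; rewrite Eow in h.
have Epz : d p z = j.+1.
  have [h1 h2] := gdist_adj conn p wz; have [h3 h4] := gdist_adj conn p uz.
  rewrite Epw Epu in h1 h2 h3 h4.
  have [//|E] : d p z = j.+1 \/ d p z = j.+2 by move: h2 h3; clear; lia.
  have := card_b hG p u; rewrite Epu bi => /eqP/cards1P[t Et].
  have : w \in [set t] by rewrite -Et !inE Epw eqxx.
  have : z \in [set t] by rewrite -Et !inE E eqxx.
  rewrite !inE => /eqP F1 /eqP F2; rewrite F1 F2 in wz.
  by rewrite adj_irrefl in wz.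
have Eoz : j.+2 <= d o z.
  by rewrite adj_sym in wz; have [h1 h2] := gdist_adj conn o wz; rewrite Eow in h1.
have closer s : d p s = j.+1 -> exists2 g, adj p g & d g s = j.
  move=> Es; have [g gp Eg] := gdist_pred conn (etrans (gdist_sym conn s p) Es).
  by exists g; rewrite 1?adj_sym // gdist_sym.
have [g pg Egz] := closer _ Epz; have [y py Eyu] := closer _ Epu.
have away s t : d t s = j -> j.+2 <= d o s -> t \notin [set o; o'].
  move=> Et Eos; rewrite !inE negb_or; apply/andP; split; apply/eqP=> F.
    by rewrite F in Et; rewrite Et in Eos; move: Eos; clear; lia.
  have o'o : adj o' o by rewrite adj_sym.
  have [h _] := gdist_adj conn s o'o.
  by rewrite !(gdist_sym conn s) -F Et in h; move: h Eos; clear; lia.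
have go := away _ _ Egz Eoz; have yo := away _ _ Eyu Eou.
case: (eqVneq g y) => [E|gy].
  subst y; have Egw : d g w = j.+1.
    have [h1 h2] := gdist_adj conn w pg; have [h3 h4] := gdist_adj conn g uw.
    rewrite !(gdist_sym conn w) Epw in h1 h2; rewrite Eyu in h3 h4.
    by move: h2 h3 h1; clear; lia.
  exact: (two_levels_apart j0 bj Eyu uw uz wz Egw Egz).
have gyadj : adj g y := other_line op po' oo' pg py go yo gy.
have Egu : d g u = j.+1.
  have [h1 h2] := gdist_adj conn u gyadj; have [h3 h4] := gdist_adj conn u pg.
  rewrite !(gdist_sym conn u) Eyu Epu in h1 h2 h3 h4.
  have [//|E] : d g u = j.+1 \/ d g u = j by move: h1 h2 h3 h4; clear; lia.
  case/eqP: gy; apply: (closer_uniq (x := u) ci _ pg py); rewrite (gdist_sym conn u) //.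
    by rewrite E.
  by rewrite Eyu.
have [|e eu Eye] := @gdist_pred G conn y u j.-1; first by rewrite Eyu prednK.
rewrite adj_sym in eu.
have Ege : d g e = j.
  have [h1 h2] := gdist_adj conn e gyadj; have [h3 h4] := gdist_adj conn g eu.
  rewrite !(gdist_sym conn e) Eye prednK // in h1 h2; rewrite Egu in h3 h4.
  by apply/eqP; rewrite eqn_leq h2; move: h4; clear; lia.
have E : z = e by apply: (closer_uniq ci Egu uz eu); rewrite ?Egz ?Ege.
rewrite -E in Eye; have [h1 h2] := gdist_adj conn z py.
by rewrite !(gdist_sym conn z) Eye Epz prednK // ltnn in h2.
Qed.

(** Spheres double in size up to the radius D - 1. The last sphere is even as
    well, since c D is at most 4. *)
Lemma odd_order : odd #|G|.
Proof.
have main i : 0 < i < D -> c i = 1 /\ (i.+1 < D -> b i = 2).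
  elim: i => // -[|i] IH /andP[_ iD].
    by rewrite (c1 hG) ?b1 //; exact: leq_trans D3.
  have [|ci bi] := IH; first by lia.
  have bi2 := bi iD; have ci2 : c i.+2 = 1 by apply: step_c.
  by split=> // iD2; exact: step_b.
have pow i : 0 < i < D -> kk i = 2 ^ i.+1.
  elim: i => // -[|i] IH /andP[_ iD].
    by rewrite (sphere_size1 hG) //; exact: leq_trans D3.
  have [ci _] := main i.+2 iD; have [|_ bi] := main i.+1; first by lia.
  have := sphere_size_rec hG i.+1; rewrite ci muln1 bi // IH; last by lia.
  by move=> <-; rewrite [RHS]expnS mulnC.
have evD : ~~ odd (kk D).
  apply/negP=> oD; have r := sphere_size_rec hG D.-1.
  rewrite prednK in r; last by lia.
  rewrite pow in r; last by lia.
  have h8 : 8 %| kk D * c D.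
    rewrite -r; apply: dvdn_mulr; apply: (@dvdn_exp2l 2 3); lia.
  have cp : coprime 8 (kk D) by rewrite (@coprimeXl 3 2) // coprime2n.
  rewrite Gauss_dvdr // in h8.
  have cD : 0 < c D by apply: (c_gt0 hG); lia.
  have := dvdn_leq cD h8; have := bca_sum hG (leqnn D); lia.
have D0 : 0 < D by lia.
rewrite (card_graph hG) -(big_mkord predT kk) big_ltn // big_nat_recr //= oddD oddD.
rewrite /= (negbTE evD) addbF big_nat (big_morph odd oddD (erefl (odd 0))).
rewrite big1 // => i /andP[i0 iD]; rewrite pow ?i0 //.
by rewrite oddX.
Qed.

End ValencyFour.

(** * Closed walks of length five *)

Section ClosedWalks5.
Variable G : sgraph.
Implicit Types (x y z : G).

Definition rotate5 (t : G * G * G * G * G) : G * G * G * G * G :=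
  let: (x0, x1, x2, x3, x4) := t in (x1, x2, x3, x4, x0).

(** Closed walks of length five with a marked starting point. *)
Definition closed5 : pred (G * G * G * G * G) := fun t =>
  let: (x0, x1, x2, x3, x4) := t in
  [&& adj x0 x1, adj x1 x2, adj x2 x3, adj x3 x4 & adj x4 x0].

Lemma rotate5_inj : injective rotate5.
Proof. by move=> [[[[? ?] ?] ?] ?] [[[[? ?] ?] ?] ?] [-> -> -> -> ->]. Qed.

Lemma order_rotate5 t : closed5 t -> order rotate5 t = 5.
Proof.
move=> ct; set p := [:: t; rotate5 t; rotate5 (rotate5 t);
  rotate5 (rotate5 (rotate5 t)); rotate5 (rotate5 (rotate5 (rotate5 t)))].
have r5 : rotate5 (rotate5 (rotate5 (rotate5 (rotate5 t)))) = t.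
  by case: (t) => [[[[? ?] ?] ?] ?].
have n1 : t <> rotate5 t.
  by case: (t) ct => [[[[x0 x1] x2] x3] x4] /and5P[h _ _ _ _] [E]; rewrite E adj_irrefl in h.
have n2 : t <> rotate5 (rotate5 t) by move=> E; apply: n1; rewrite -!E in r5.
have n3 : t <> rotate5 (rotate5 (rotate5 t)) by move=> E; apply: n2; rewrite -!E in r5.
have n4 : t <> rotate5 (rotate5 (rotate5 (rotate5 t))).
  by move=> E; apply: n1; rewrite -!E in r5.
apply: (@order_cycle _ _ p); last by rewrite mem_head.
  by rewrite /p /= !eqxx r5 eqxx.
rewrite /p /= !inE !negb_or !(inj_eq rotate5_inj).
by move/eqP: n1; move/eqP: n2; move/eqP: n3; move/eqP: n4 => -> -> -> ->.
Qed.

(** Rotation acts on the closed walks of length five with orbits of size 5,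
    since a walk does not stay at its first vertex. *)
Lemma dvdn_closed_walks5 : 5 %| \sum_(x : G) walks 5 x x.
Proof.
have -> : \sum_(x : G) walks 5 x x = #|closed5|.
  transitivity (\sum_x0 \sum_x1 \sum_x2 \sum_x3 \sum_x4
    (closed5 (x0, x1, x2, x3, x4) : nat)); last first.
    rewrite !pair_big /= -sum1_card [RHS]big_mkcond.
    by apply: eq_bigr => -[[[[x0 x1] x2] x3] x4] _ /=; rewrite unfold_in /=; case: ifP.
  apply: eq_bigr => x0 _ /=; rewrite big_mkcond; apply: eq_bigr => x1 _.
  case: (adj x0 x1); last by rewrite !big1 // => *; rewrite !big1 // => *; rewrite !big1.
  rewrite big_mkcond; apply: eq_bigr => x2 _.
  case: (adj x1 x2); last by rewrite !big1 // => *; rewrite !big1.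
  rewrite big_mkcond; apply: eq_bigr => x3 _.
  case: (adj x2 x3); last by rewrite !big1.
  rewrite big_mkcond; apply: eq_bigr => x4 _.
  case: (adj x3 x4) => //=; rewrite big_mkcond (bigD1 x0) //= eqxx big1 ?addn0.
    by case: adj.
  by move=> y /negPf ->; case: adj.
rewrite -(fcard_order_set rotate5_inj (n := 5)) ?dvdn_mull //.
- by apply/subsetP=> t ct; rewrite inE order_rotate5.
- move=> t t' /eqP <-; case: t => [[[[x0 x1] x2] x3] x4]; rewrite /in_mem /=.
  by case: (adj x0 x1); rewrite ?andbT ?andbF // !andbA.
Qed.

End ClosedWalks5.

Section Dodecahedral.
Variables (G : sgraph) (b c : nat -> nat).
Hypothesis hG : drg G 3 b c.
Hypothesis D3 : 2 < diameter G.
Hypothesis lam0 : a_ 3 b c 1 = 0.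
Hypothesis c2 : c 2 = 1.
Hypothesis a2 : 0 < a_ 3 b c 2.
Local Notation d := (@gdist G).

Let conn : connected G. Proof. by case: hG. Qed.

(** The recursion of [sum_nbr] gives six closed walks of length five at each
    vertex, so 5 divides 6 * #|G|. *)
Lemma five_dvd_order : 5 %| #|G|.
Proof.
have D2 : 1 < diameter G := ltnW D3.
have s1 := bca_sum hG (ltnW D2); have s2 := bca_sum hG D2.
have b2 := b_gt0 hG D3; have c1E := c1 hG (ltnW D2).
have b1E : b 1 = 2 by rewrite lam0 c1E in s1; lia.
have [a2E b2E] : a_ 3 b c 2 = 1 /\ b 2 = 1 by lia.
have step f n : (forall x y : G, walks n x y = f (d y x)) -> forall x y : G,
    walks n.+1 x y = c (d y x) * f (d y x).-1 + a_ 3 b c (d y x) * f (d y x) +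
      b (d y x) * f (d y x).+1.
  move=> hf x y; rewrite -(sum_nbr hG) /=; apply: eq_bigr => z _; exact: hf.
have [f0 h0] := dist_classP (@walks_class _ _ _ _ hG 0).
have [f1 h1] := dist_classP (@walks_class _ _ _ _ hG 1).
have [f2 h2] := dist_classP (@walks_class _ _ _ _ hG 2).
have [f3 h3] := dist_classP (@walks_class _ _ _ _ hG 3).
have [f4 h4] := dist_classP (@walks_class _ _ _ _ hG 4).
have [f5 h5] := dist_classP (@walks_class _ _ _ _ hG 5).
have sy f n : (forall x y : G, walks n x y = f (d x y)) -> forall x y : G,
    walks n x y = f (d y x) by move=> h x y; rewrite h gdist_sym.
have rec f g n i : (forall x y : G, walks n x y = f (d x y)) ->
    (forall x y : G, walks n.+1 x y = g (d x y)) -> i <= 3 ->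
    g i = c i * f i.-1 + a_ 3 b c i * f i + b i * f i.+1.
  move=> hf hg i3; have [x [y E]] := dist_pair hG (leq_trans i3 D3).
  by rewrite -E -(step _ _ (sy _ _ hf)) hg gdist_sym.
have f0E i : i <= 3 -> f0 i = (i == 0).
  move=> i3; have [x [y E]] := dist_pair hG (leq_trans i3 D3).
  by rewrite -E -h0 /= -(gdist_eq0 conn).
have c0E := c0 hG; have a0E := a0 hG; have b0E := b0 hG.
have e10 := rec _ _ _ 0 h0 h1 isT; have e11 := rec _ _ _ 1 h0 h1 isT.
have e12 := rec _ _ _ 2 h0 h1 isT.
have e20 := rec _ _ _ 0 h1 h2 isT; have e21 := rec _ _ _ 1 h1 h2 isT.
have e22 := rec _ _ _ 2 h1 h2 isT.
have e13 : f1 3 = 0.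
  have [x [y E]] := dist_pair hG D3.
  rewrite -E -h1 /= big1 // => z xz; case: eqP => // F; subst z.
  by rewrite -(gdist1 conn) E in xz.
have e23 : f2 3 = 0.
  have [x [y E]] := dist_pair hG D3.
  rewrite -E -h2 /= big1 // => z xz; rewrite big1 // => u zu; case: eqP => // F; subst u.
  have := gdist_triangle conn z x y; rewrite E.
  by rewrite -(gdist1 conn) in xz; rewrite -(gdist1 conn) in zu; rewrite (eqP xz) (eqP zu).
have e30 := rec _ _ _ 0 h2 h3 isT; have e31 := rec _ _ _ 1 h2 h3 isT.
have e32 := rec _ _ _ 2 h2 h3 isT.
have e41 := rec _ _ _ 1 h3 h4 isT.
have e50 := rec _ _ _ 0 h4 h5 isT.
have := f0E 0 isT; have := f0E 1 isT; have := f0E 2 isT; have := f0E 3 isT.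
move=> /= z3 z2 z1 z0.
rewrite c0E a0E b0E /= in e10 e20 e30 e50; rewrite c1E lam0 b1E /= in e11 e21 e31 e41.
rewrite c2 a2E b2E /= in e12 e22 e32.
have f5E : f5 0 = 6 by lia.
have := @dvdn_closed_walks5 G; rewrite (eq_bigr (fun=> 6)) => [|x _].
  by rewrite sum_nat_const mulnC Gauss_dvdr.
by rewrite h5 gdistxx.
Qed.

End Dodecahedral.

(** * Pentagons in cubic graphs *)

Section Pentagon.
Variables (G : sgraph) (b c : nat -> nat).
Hypothesis hG : drg G 3 b c.
Hypothesis lam0 : a_ 3 b c 1 = 0.
Hypothesis c21 : c 2 = 1.
Implicit Types (x y z : G) (C : {set G}).
Local Notation d := (@gdist G).

Let conn : connected G. Proof. by case: hG. Qed.
Let hk : valency G 3. Proof. by case: hG. Qed.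

Lemma common_nbr_uniq x y z w : adj x y -> adj x z -> adj w y -> adj w z ->
  x != w -> y = z.
Proof.
move=> xy xz wy wz nxw.
have nadj : ~~ adj x w.
  by apply/negP=> xw; case: (no_triangle hG lam0 xy xw); rewrite adj_sym.
have Exw : d x w = 2.
  by apply: (gdist2 hG (x := y)) => //; rewrite adj_sym.
have := card_c hG x w; rewrite Exw c21 => /eqP/cards1P[u Eu].
have uE t : adj x t -> adj w t -> t = u.
  by move=> xt wt; apply/set1P; rewrite -Eu !inE wt andbT eqSS gdist1.
by rewrite (uE _ xy wy) (uE _ xz wz).
Qed.

(** The inner degrees have sum 10, and by [two_paths] their squares have sum at
    most 20, so they are all equal. *)
Lemma pentagon_degree C x : #|C| = 5 -> arcs C (~: C) = 5 -> x \in C -> deg_in x C = 2.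
Proof.
move=> C5 cut5 Cx; have aC := arcs_valency C hk; rewrite C5 cut5 in aC.
have {}aC : arcs C C = 10 by move: aC; clear; lia.
have := two_paths hG lam0 C; rewrite c21 C5 aC => le.
have s5 : \sum_(y in C) 4 = 20 by rewrite sum_nat_const C5.
(* the squares of [deg_in y C - 2] have sum 0 *)
have : \sum_(y in C) (deg_in y C ^ 2 + 4) <= \sum_(y in C) 4 * deg_in y C.
  rewrite big_split /= s5 -big_distrr /= -/(arcs C C) aC; move: le; clear; lia.
rewrite (bigD1 x) //= [leqRHS](bigD1 x) //=.
set u := bigop _ _ _; set w := bigop _ _ _ => h.
have wu : w <= u.
  apply: leq_sum => y _; rewrite -mulnn.
  by case: (deg_in y C) => [|[|n]] //; clear; lia.
move: h wu; rewrite -mulnn; move: u w (deg_in x C) => u w n.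
by case: n => [|[|[|n]]] //; clear; lia.
Qed.

Lemma pentagon C : #|C| = 5 -> {in C, forall x, deg_in x C = 2} ->
  exists p q r q2 r2 : G, [/\ C =i [:: p; q; r; q2; r2], uniq [:: p; q; r; q2; r2],
    [/\ adj p q, adj p r & adj q2 r2] & [/\ adj q q2, adj r r2, d p q2 = 2 & d p r2 = 2]].
Proof.
move=> C5 deg2.
have nbrs x y : x \in C -> y \in C -> adj x y -> exists z, [/\ z \in C, z != y,
    adj x z & forall w, w \in C -> adj x w -> w = y \/ w = z].
  move=> Cx Cy xy; have := deg2 _ Cx; rewrite /deg_in (cardsD1 y) !inE Cy xy => -[].
  move/eqP/cards1P=> [z Ez]; exists z; have : z \in [set z] by rewrite inE.
  rewrite -Ez !inE => /andP[nz /andP[Cz xz]]; split=> // w Cw xw.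
  case: (eqVneq w y) => [|nw]; [by left|right].
  by apply/set1P; rewrite -Ez !inE nw Cw xw.
have ex x : x \in C -> exists2 y, y \in C & adj x y.
  move=> Cx; have : 0 < deg_in x C by rewrite deg2.
  by case/card_gt0P=> y; rewrite inE => /andP[]; exists y.
have [p Cp] : exists p, p \in C by apply/set0Pn; rewrite -card_gt0 C5.
have [q Cq pq] := ex _ Cp; have [r [Cr nrq pr pE]] := nbrs _ _ Cp Cq pq.
have qp : adj q p by rewrite adj_sym.
have rp : adj r p by rewrite adj_sym.
have [q2 [Cq2 nq2p qq2 qE]] := nbrs _ _ Cq Cp qp.
have [r2 [Cr2 nr2p rr2 rE]] := nbrs _ _ Cr Cp rp.
have irr x y : adj x y -> x != y by apply: contraTneq => ->; rewrite adj_irrefl.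
have tri x y z : adj x y -> adj x z -> ~~ adj y z.
  by move=> xy xz; apply/negP=> yz; exact: (no_triangle hG lam0 xy xz yz).
have nq2r : q2 != r by apply: contraTneq qq2 => ->; exact: tri pq pr.
have nr2q : r2 != q by apply: contraTneq rr2 => ->; apply: tri pr pq.
have nqr2 : q2 != r2.
  apply: contraNneq nrq => E; apply/eqP; apply: (common_nbr_uniq pr pq (w := q2)).
  - by rewrite E adj_sym.
  - by rewrite adj_sym.
  - by rewrite eq_sym.
have un : uniq [:: p; q; r; q2; r2].
  rewrite /= !inE !negb_or (irr _ _ pq) (irr _ _ pr) (irr _ _ qq2) (irr _ _ rr2) nqr2.
  by rewrite ![p == _]eq_sym nq2p nr2p ![q == _]eq_sym nrq nr2q ![r == _]eq_sym nq2r.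
have EC : C =i [:: p; q; r; q2; r2].
  apply/fsym/subset_cardP; first by rewrite C5; apply/card_uniqP.
  by apply/subsetP=> x; rewrite !inE => /or4P[| | |/orP[]] /eqP->.
have q2r2 : adj q2 r2.
  have q2q : adj q2 q by rewrite adj_sym.
  have [z [Cz nz q2z _]] := nbrs _ _ Cq2 Cq q2q.
  move: Cz; rewrite EC !inE (negbTE nz) /=; case/or4P=> /eqP E; subst z => //.
  - by move: q2z; rewrite adj_sym (negbTE (tri _ _ _ qp qq2)).
  - have [E|E] := rE _ Cq2 (etrans (adj_sym _ _) q2z).
      by rewrite E eqxx in nq2p.
    by rewrite E eqxx in nqr2.
  - by rewrite adj_irrefl in q2z.
exists p, q, r, q2, r2; split=> //; split=> //.
  by apply: (gdist2 hG qp qq2); [rewrite eq_sym|exact: tri qp qq2].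
by apply: (gdist2 hG rp rr2); [rewrite eq_sym|exact: tri rp rr2].
Qed.

End Pentagon.

(** * Barriers with two edges inside *)

Section Barriers.
Variables (G : sgraph) (k : nat) (b c : nat -> nat).
Hypothesis hG : drg G k b c.
Hypothesis D3 : 2 < diameter G.
Hypothesis k3 : 2 < k.
Hypothesis evv : ~~ odd #|G|.
(** S and P form a barrier against extending the edges x1 y1 and x2 y2, and the
    hypothesis [maxi] is what the maximality of #|S| + #|P| says about a single
    block. *)
Variables (S : {set G}) (P : {set {set G}}).
Hypothesis bar : barrier (@adj G) [set: G] S P.
Hypothesis odd_all : {in P, forall C : {set G}, odd #|C|}.
Hypothesis sq : #|S| <= #|P| + 2.
Variables (x1 y1 x2 y2 : G).
Hypotheses (Sx1 : x1 \in S) (Sy1 : y1 \in S) (Sx2 : x2 \in S) (Sy2 : y2 \in S).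
Hypotheses (xy1 : adj x1 y1) (xy2 : adj x2 y2) (un : uniq [:: x1; y1; x2; y2]).
Hypothesis maxi : forall C R Q, C \in P -> barrier (@adj G) C R Q ->
  #|R| + 1 <= odd_blocks Q -> #|R| + #|Q| <= 1.
Implicit Types (x y z : G) (A C R : {set G}).
Local Notation d := (@gdist G).
Local Notation D := (diameter G).
Local Notation a := (a_ k b c).
Local Notation cut A := (arcs A (~: A)).

Let conn : connected G. Proof. by case: hG. Qed.
Let hk : valency G k. Proof. by case: hG. Qed.
Let D1 : 0 < D. Proof. exact: ltn_trans D3. Qed.

Lemma coverP_S : cover P = ~: S.
Proof. by case/barrierP: bar => _ /and3P[/eqP-> _ _] _; rewrite setTD. Qed.

Lemma block_nbr C x y : C \in P -> x \in C -> adj x y -> (y \in C) || (y \in S).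
Proof.
move=> PC Cx xy; case: (boolP (y \in S)) => [_|nSy]; first by rewrite orbT.
have : y \in cover P by rewrite coverP_S inE.
case/bigcupP=> C' PC' Cy; case/barrierP: bar => _ _ h.
by rewrite (h _ _ _ _ PC PC' Cx Cy xy) Cy.
Qed.

Lemma block_S C x : C \in P -> x \in C -> x \notin S.
Proof. by move=> PC Cx; have [_ _ dCS] := barrier_block bar PC; rewrite (disjointFr dCS). Qed.

Lemma deg_out_block C x : C \in P -> x \in C -> deg_in x (~: C) = deg_in x S.
Proof.
move=> PC Cx; apply: eq_card => y; rewrite !inE.
case: (boolP (adj x y)) => xy; rewrite ?andbF // !andbT.
have := block_nbr PC Cx xy; case: (boolP (y \in C)) => //= Cy _.
by apply/esym/negbTE; apply: block_S Cy.
Qed.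

(** The arcs from S to its complement are the arcs that leave the blocks. *)
Lemma sum_cuts : \sum_(C in P) cut C + arcs S S = k * #|S|.
Proof.
rewrite -(arcs_valency S hk) addnC; congr (_ + _).
rewrite arcsC -coverP_S /arcs (big_trivIset _ _) /=; last first.
  by case/barrierP: bar => _ /and3P[].
by apply: eq_bigr => C PC; apply: eq_bigr => x Cx; exact: deg_out_block.
Qed.

Lemma arcs_S_ge : 4 <= arcs S S.
Proof.
have pos x y : y \in S -> adj x y -> 0 < deg_in x S.
  by move=> Sy xy; apply/card_gt0P; exists y; rewrite inE Sy.
have h4 : #|[set x in [:: x1; y1; x2; y2]]| = 4 by rewrite cardsE; apply/card_uniqP.
rewrite -h4 -sum1_card /arcs big_mkcond [leqRHS]big_mkcond /=; apply: leq_sum => x _.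
rewrite inE; case: ifP => // h; move: h; rewrite !inE.
case/or4P => /eqP ->; rewrite ?Sx1 ?Sy1 ?Sx2 ?Sy2.
- exact: pos xy1.
- by apply: (pos _ x1); rewrite // adj_sym.
- exact: pos xy2.
- by apply: (pos _ x2); rewrite // adj_sym.
Qed.

Lemma card_S_ge : 4 <= #|S|.
Proof.
have h4 : #|[set x in [:: x1; y1; x2; y2]]| = 4 by rewrite cardsE; apply/card_uniqP.
rewrite -h4; apply/subset_leq_card/subsetP=> x; rewrite !inE.
by case/or4P => /eqP ->.
Qed.

Lemma odd_P : odd #|P| = odd #|S|.
Proof.
have := barrier_parity bar; rewrite odd_blocks_all // cardsT => ->.
by rewrite (negbTE evv).
Qed.

Lemma cut_singleton C : #|C| = 1 -> cut C = k.
Proof.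
move/eqP/cards1P=> [x ->]; rewrite /arcs big_set1 -(hk x); apply: eq_card => y.
rewrite !inE andbC; case: (boolP (adj x y)) => //= xy.
by apply: contraTneq xy => ->; rewrite adj_irrefl.
Qed.

Lemma card_compl_block C : C \in P -> 4 + (#|P| - 1) <= #|~: C|.
Proof.
move=> PC; have h : S :|: cover (P :\ C) \subset ~: C.
  apply/subsetP=> x; rewrite !inE; case/orP=> [Sx|/bigcupP[C']].
    by apply: contraL Sx; exact: block_S.
  rewrite !inE => /andP[nC PC'] C'x; apply/negP=> Cx.
  case/barrierP: bar => _ /and3P[_ /trivIsetP tP _] _.
  by have := disjointFr (tP _ _ PC' PC nC) C'x; rewrite Cx.
apply: leq_trans (subset_leq_card h); rewrite cardsU disjoint_setI0 ?cards0 ?subn0.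
  rewrite leq_add ?card_S_ge //; have tP : trivIset (P :\ C).
    by apply: (trivIsetS (subD1set P C)); case/barrierP: bar => _ /and3P[].
  rewrite -(eqP tP) (_ : #|P| - 1 = #|P :\ C|); last by rewrite (cardsD1 C P) PC addKn.
  rewrite -sum1_card; apply: leq_sum => C'; rewrite !inE => /andP[_ PC'].
  by rewrite card_gt0; case: (barrier_block bar PC').
rewrite -setI_eq0; apply/eqP/setP=> x; rewrite !inE; apply/negP=> /andP[Sx].
by case/bigcupP=> C'; rewrite !inE => /andP[_ PC'] C'x; move/negP: (block_S PC' C'x); apply.
Qed.

(** * Barriers in graphs with triangles *)

(** All edges at an isolated vertex x of the complement of S go to S, and so do
    the triangles on them: each of its k edges gives a 1 arcs of S that form a
    triangle with x. An arc of S is used by at most a 1 vertices x. *)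
Lemma singletons_bound : 0 < a 1 -> #|[set x | [set x] \in P]| * k <= arcs S S.
Proof.
move=> a1; set I := [set _ | _].
pose T x y z : nat := [&& adj x y, adj x z & adj y z].
have nb x y : x \in I -> adj x y -> y \in S.
  rewrite inE => Px xy; have := block_nbr Px (set11 x) xy; rewrite inE.
  by case: eqP => //= F; subst; rewrite adj_irrefl in xy.
have cn y z : adj y z -> \sum_x adj y x * adj z x = a 1.
  move=> yz; rewrite -(common_nbrs hG yz) -sum1dep_card [RHS]big_mkcond /=.
  by apply: eq_bigr => x _; case: adj; case: adj.
have e1 : \sum_(x in I) \sum_(y in S) \sum_(z in S) T x y z = #|I| * k * a 1.
  rewrite -mulnA -sum_nat_const; apply: eq_bigr => x Ix.
  rewrite -{1}(hk x) -sum_nat_const big_mkcond [RHS]big_mkcond /=; apply: eq_bigr => y _.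
  rewrite inE /T; case: (boolP (adj x y)) => xy; last by rewrite big1 ?if_same.
  rewrite (nb _ _ Ix xy) -(cn _ _ xy) big_mkcond; apply: eq_bigr => z _.
  case: ifP => [_|nSz]; first by case: adj; case: adj.
  by case: (boolP (adj x z)) => //= xz; rewrite (nb _ _ Ix xz) in nSz.
rewrite -(leq_pmul2r a1) -e1 exchange_big /= {1}/arcs big_distrl /=.
apply: leq_sum => y Sy; rewrite exchange_big /= deg_inE big_distrl /=.
apply: leq_sum => z Sz; case: (boolP (adj y z)) => yz; last first.
  by rewrite big1 // => x _; rewrite /T (negbTE yz) !andbF.
rewrite mul1n -(cn _ _ yz) big_mkcond; apply: leq_sum => x _.
by case: ifP => // _; rewrite /T yz andbT ![adj x _]adj_sym; case: adj; case: adj.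
Qed.

(** Let I be the set of vertices that are blocks and m the number of other
    blocks. The cuts of the latter have at least 2 k - 1 arcs, which gives [arcs
    S S] + (k - 1) m <= 2 k, and [singletons_bound] bounds k * #|I| by [arcs S
    S]. But there are at least two blocks, and at least three if I is not empty,
    since a vertex in I has its k neighbours in S; both are too many. *)
Lemma no_barrier_triangles : 0 < a 1 -> 5 <= k -> False.
Proof.
move=> a1 k5; pose I := [set x | [set x] \in P].
have g4 := arcs_S_ge; have gI := singletons_bound a1; rewrite -/I in gI.
have s4 := card_S_ge; have sm := sum_cuts.
have cI : #|I| = #|[set C in P | #|C| == 1]|.
  rewrite -(card_imset I set1_inj); apply: eq_card => C; rewrite inE.
  apply/imsetP/andP=> [[x Ix ->]|[PC /cards1P[x E]]].
    by rewrite inE in Ix; rewrite Ix cards1.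
  by exists x; rewrite // inE -E.
pose m := #|[set C in P | #|C| != 1]|.
have qE : #|P| = #|I| + m.
  rewrite cI /m -cardsUI [X in _ + X](_ : _ = 0) ?addn0; last first.
    by apply/eqP; rewrite cards_eq0; apply/eqP/setP=> C; rewrite !inE; case: eqP; rewrite !andbF.
  by apply: eq_card => C; rewrite !inE; case: eqP; rewrite ?andbT ?andbF ?orbF.
have low : k * #|P| + (k - 1) * m <= \sum_(C in P) cut C.
  rewrite mulnC -sum_nat_const mulnC /m -sum1dep_card big_mkcondr /= big_distrl /=.
  rewrite -big_split /=; apply: leq_sum => C PC.
  case: eqP => [E|nE] /=; first by rewrite mul0n addn0 (cut_singleton E).
  have C0 : 0 < #|C| by rewrite card_gt0; case: (barrier_block bar PC).
  have oC := odd_all PC.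
  have C3 : 3 <= #|C| by move: oC nE C0; case: #|C| => [|[|[|n]]].
  have nC3 : 3 <= #|~: C| by have := card_compl_block PC; clear; lia.
  by have := cut_ge hG D3 k3 k5 evv oC C3 nC3; move: k3; clear; lia.
have h : arcs S S + (k - 1) * m <= 2 * k.
  have := leq_mul (leqnn k) sq; rewrite mulnDr; move: low sm; clear; lia.
case: (posnP #|I|) => [I0|I0].
  have m2 : 2 <= m by move: s4 sq qE; rewrite I0; clear; lia.
  by have := leq_mul (leqnn (k - 1)) m2; move: h g4 k3; clear; lia.
have kS : k <= #|S|.
  case/card_gt0P: I0 => x; rewrite inE => Px; rewrite -(hk x).
  apply/subset_leq_card/subsetP=> y; rewrite inE => xy.
  have := block_nbr Px (set11 x) xy; rewrite inE.
  by case: eqP => //= F; subst; rewrite adj_irrefl in xy.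
have n3 : 3 <= #|I| + m by move: kS sq qE k5; clear; lia.
have := leq_mul n3 (leqnn (k - 1)); rewrite mulnDl mulnC.
have : #|I| * (k - 1) <= #|I| * k by rewrite leq_mul2l leq_subr orbT.
by move: h gI k5; clear; lia.
Qed.

(** * Barriers in bipartite graphs *)

(** If removing R leaves an independent set with more than #|R| vertices, its
    vertices are the blocks of a barrier of C. Maximality admits this only for R
    empty and C a single vertex. *)
Lemma split_block C R : C \in P -> R \subset C ->
  {in C :\: R &, forall x y, ~~ adj x y} -> #|R| < #|C :\: R| -> #|C| = 1.
Proof.
move=> PC sRC ind lt; pose Q := [set [set x] | x in C :\: R].
have bQ : barrier (@adj G) C R Q.
  apply/barrierP; split=> //.
    apply/and3P; split.
    - apply/eqP/setP=> x; apply/bigcupP/idP.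
        by case=> _ /imsetP[y Cy ->] /set1P->.
      by move=> Cx; exists [set x]; [apply/imsetP; exists x|rewrite set11].
    - apply/trivIsetP=> _ _ /imsetP[y Cy ->] /imsetP[z Cz ->] nyz.
      by rewrite disjoints1 inE; apply: contraNneq nyz => ->.
    - by apply/imsetP=> -[x _ /setP/(_ x)]; rewrite !inE eqxx.
  move=> _ _ x y /imsetP[x' Cx ->] /imsetP[y' Cy ->] /set1P-> /set1P-> xy.
  by case/negP: (ind _ _ Cx Cy).
have cQ : #|Q| = #|C :\: R| by rewrite card_imset //; exact: set1_inj.
have oQ : odd_blocks Q = #|Q|.
  by apply: odd_blocks_all => _ /imsetP[x _ ->]; rewrite cards1.
have := maxi PC bQ; rewrite oQ cQ addn1 => /(_ lt).
have := subset_leq_card sRC; rewrite cardsDS //.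
have : 0 < #|C| by rewrite card_gt0; case: (barrier_block bar PC).
by move: lt; rewrite cardsDS //; clear; lia.
Qed.

(** With single-vertex blocks only, [sum_cuts] makes #|S| larger than #|P|, and
    parity makes the difference 2. *)
Lemma independent_blocks : {in P, forall C : {set G}, #|C| = 1} ->
  [/\ {in ~: S &, forall x y, ~~ adj x y}, #|~: S| + 2 = #|S| & arcs S S = 2 * k].
Proof.
move=> all1; have cP : #|~: S| = #|P|.
  have := barrier_card bar; rewrite (eq_bigr (fun=> 1)) // sum1_card cardsT.
  by have := cardsC S; clear; lia.
have sm := sum_cuts; rewrite (eq_bigr (fun=> k)) in sm; last first.
  by move=> C PC; apply: cut_singleton; exact: all1.
rewrite sum_nat_const in sm; have g4 := arcs_S_ge.
have lt : #|P| < #|S|.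
  rewrite ltnNge; apply/negP=> le; have := leq_mul (leqnn k) le.
  by move: sm g4; clear; lia.
have sE : #|S| = #|P| + 2.
  have := odd_P; move: lt sq; clear; set s := #|S|; set p := #|P| => lt le o.
  have [E|//] : s = p.+1 \/ s = p + 2 by lia.
  by move: o; rewrite E /=; case: (odd p).
split; last first.
- by rewrite sE mulnDr in sm; move: sm; clear; lia.
- by rewrite cP sE.
move=> x y; rewrite -coverP_S => /bigcupP[C PC Cx] /bigcupP[C' PC' Cy].
apply/negP=> xy; case/barrierP: (bar) => _ _ h.
have E := h _ _ _ _ PC PC' Cx Cy xy; subst C'.
have /eqP/cards1P[z Ez] := all1 _ PC; rewrite Ez !inE in Cx Cy.
by rewrite (eqP Cx) (eqP Cy) adj_irrefl in xy.
Qed.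

(** Inside a block, the smaller colour class separates the vertices of the
    larger one, so all blocks are single vertices by [split_block]. The set of
    the vertices outside S of one colour and the vertices of S of the other
    colour then has odd size and only k outgoing arcs, the ones inside S,
    against [cut_gt_k]. *)
Lemma no_barrier_bipartite : (forall i, i <= D -> a i = 0) -> False.
Proof.
move=> a00; have [X prop] : exists X : {set G}, forall x y, adj x y -> (x \in X) != (y \in X).
  exists [set x | odd (d x1 x)] => x y xy.
  rewrite !inE; have [h1 h2] := gdist_adj conn x1 xy.
  have ne : d x1 x != d x1 y.
    apply/eqP=> E; have := card_a hG x1 x; rewrite a00 ?gdist_max // => /eqP.
    by rewrite /deg_in cards_eq0 => /eqP/setP/(_ y); rewrite !inE E eqxx xy.
  have [->|->] : d x1 y = (d x1 x).+1 \/ d x1 x = (d x1 y).+1.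
    by move: h1 h2 ne; clear; lia.
    by rewrite /=; case: odd.
  by rewrite /=; case: odd.
have lam0 : a 1 = 0 by apply: a00; exact: D1.
have all1 : {in P, forall C : {set G}, #|C| = 1}.
  move=> C PC; have := cardsID X C; have oC := odd_all PC => cC.
  have [lt|lt] : #|C :&: X| < #|C :\: X| \/ #|C :\: X| < #|C :&: X|.
    case: (ltngtP #|C :&: X| #|C :\: X|) => [||E]; [by left|by right|].
    by rewrite -cC E addnn odd_double in oC.
  - apply: (split_block PC (R := C :&: X)); first exact: subsetIl.
      move=> x y; rewrite !inE => /andP[nx Cx] /andP[ny Cy]; apply/negP=> /prop.
      by move: nx ny; rewrite Cx Cy /= => /negbTE-> /negbTE->.
    by rewrite setDIr setDv set0U.
  - apply: (split_block PC (R := C :\: X)); first exact: subsetDl.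
      move=> x y; rewrite !inE => /andP[nx Cx] /andP[ny Cy]; apply/negP=> /prop.
      by move: nx ny; rewrite Cx Cy !andbT !negbK => -> ->.
    by rewrite setDDr setDv set0U.
have [ind sE gE] := independent_blocks all1.
pose B := (~: S :&: X) :|: (S :\: X).
have nX x y : adj x y -> (y \in X) = ~~ (x \in X) by move=> /prop; do 2 case: (_ \in X).
have dB : [disjoint ~: S :&: X & S :\: X].
  by rewrite -setI_eq0; apply/eqP/setP=> x; rewrite !inE; case: (x \in S); rewrite ?andbF.
have cut1 : arcs (~: S :&: X) (~: B) = 0.
  apply: big1 => x; rewrite 2!inE => /andP[nSx Xx]; apply/eqP.
  rewrite cards_eq0; apply/eqP/setP=> y; rewrite !inE; apply/negP=> /andP[nB xy].
  have Sy : y \in S.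
    by apply: contraT => nSy; have := ind x y; rewrite !inE => /(_ nSx nSy); rewrite xy.
  by have := nX _ _ xy; rewrite Xx => yX; move: nB; rewrite Sy yX.
have cut2 : arcs (S :\: X) (~: B) = arcs (S :\: X) (S :&: X).
  apply: eq_bigr => x; rewrite inE => /andP[nXx Sx]; apply: eq_card => y.
  rewrite !inE; case: (boolP (adj x y)) => xy; rewrite ?andbF // !andbT.
  by rewrite (nX _ _ xy) nXx; case: (y \in S).
have cutB : cut B = arcs (S :\: X) (S :&: X) by rewrite arcsUl // cut1 cut2.
have h2 : arcs S S = 2 * arcs (S :\: X) (S :&: X).
  have mono A : (forall x y, x \in A -> y \in A -> ~~ adj x y) -> arcs A A = 0.
    move=> h; apply: big1 => x Ax; apply/eqP; rewrite cards_eq0.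
    by apply/eqP/setP=> y; rewrite !inE; apply/negP=> /andP[Ay]; apply/negP; exact: h.
  rewrite -{1 2}(setID S X) arcsUl; last first.
    by rewrite -setI_eq0; apply/eqP/setP=> x; rewrite !inE; case: (x \in X); rewrite ?andbF.
  rewrite !arcsUr; try by rewrite -setI_eq0; apply/eqP/setP=> x; rewrite !inE; case: (x \in X); rewrite ?andbF.
  rewrite (mono (S :&: X)) ?(mono (S :\: X)).
  - by rewrite addn0 add0n [arcs (S :&: X) _]arcsC addnn mul2n.
  - move=> x y; rewrite !inE => /andP[nx _] /andP[ny _]; apply/negP=> /nX.
    by rewrite (negbTE nx) (negbTE ny).
  - move=> x y; rewrite !inE => /andP[_ Xx] /andP[_ Xy]; apply/negP=> /nX.
    by rewrite Xx Xy.
have cBk : cut B = k by move: h2; rewrite gE cutB; clear; lia.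
have two (Y : {set G}) : (forall x y, adj x y -> (x \in Y) || (y \in Y)) -> 2 <= #|S :&: Y|.
  move=> hY; have pick x y : x \in S -> y \in S -> adj x y ->
      exists2 u, u \in S :&: Y & u \in [:: x; y].
    move=> Sx Sy /hY /orP[Yx|Yy]; [exists x|exists y]; by rewrite !inE ?Sx ?Sy ?Yx ?Yy ?eqxx ?orbT.
  have [u Su u1] := pick _ _ Sx1 Sy1 xy1; have [w Sw w1] := pick _ _ Sx2 Sy2 xy2.
  have uw : u != w.
    apply/eqP=> E; subst w; move: un; rewrite (cat_uniq [:: x1; y1] [:: x2; y2]).
    case/and3P=> _ /hasP[]; by exists u.
  have -> : 2 = #|[set u; w]| by rewrite cards2 uw.
  by apply/subset_leq_card/subsetP=> t; rewrite !inE => /orP[] /eqP->; rewrite -in_setI.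
have twoX : 2 <= #|S :&: X| by apply: two => x y /nX ->; case: (x \in X).
have twoX' : 2 <= #|S :\: X|.
  by rewrite setDE; apply: two => x y /nX; rewrite !inE => ->; case: (x \in X).
have sumB : k * #|S :\: X| = k * #|~: S :&: X| + k.
  have all_nbr A A' : (forall x y, x \in A -> adj x y -> y \in A') -> arcs A A' = k * #|A|.
    move=> h; rewrite mulnC -sum_nat_const; apply: eq_bigr => x Ax; rewrite -(hk x).
    by apply: eq_card => y; rewrite !inE; case: (boolP (adj x y)) => xy; rewrite ?andbF // (h x).
  rewrite -(all_nbr (S :\: X) X) => [|x y]; last first.
    by rewrite inE => /andP[nXx _] /nX ->.
  rewrite -(all_nbr (~: S :&: X) (S :\: X)) => [|x y]; last first.
    rewrite !inE => /andP[nSx Xx] xy; rewrite (nX _ _ xy) Xx /=.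
    by apply: contraT => nSy; have := ind x y; rewrite !inE => /(_ nSx nSy); rewrite xy.
  have -> : arcs (S :\: X) X = arcs (S :\: X) (S :&: X) + arcs (S :\: X) (~: S :&: X).
    rewrite -arcsUr -?setIUl ?setUCr ?setTI //.
    by rewrite -setI_eq0; apply/eqP/setP=> x; rewrite !inE; case: (x \in S); rewrite ?andbF.
  by rewrite -cutB cBk addnC [in RHS]arcsC.
have k0 : 0 < k := ltnW (ltnW k3).
have sB : #|S :\: X| = #|~: S :&: X| + 1.
  by apply/eqP; rewrite -(eqn_pmul2l k0) mulnDr muln1 sumB.
have cardB : #|B| = 2 * #|~: S :&: X| + 1.
  by rewrite cardsU (disjoint_setI0 dB) cards0 subn0 sB; clear; lia.
have := @cut_gt_k _ _ _ _ hG D3 k3 lam0 evv B; rewrite cBk ltnn => /(_ _ _ _)/negP.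
have -> : odd #|B| by rewrite cardB addn1 /= mul2n odd_double.
have -> : 2 < #|B| by move: sB twoX' cardB; clear; lia.
have -> : 2 < #|~: B|.
  have := cardsC B; have := cardsC S; have := cardsID X S.
  have := cardsID X (~: S).
  by move: twoX sE cardB sB; clear; lia.
by move=> /(_ isT isT isT).
Qed.

(** * Barriers in triangle-free graphs with odd cycles *)

Hypothesis lam0 : a 1 = 0.

Lemma split3 C r : C \in P -> #|C| = 3 -> r \in C ->
  {in C :\ r &, forall x y, ~~ adj x y} -> False.
Proof.
move=> PC C3 Cr ind; have := @split_block C [set r] PC; rewrite sub1set => /(_ Cr ind).
have E : #|C :\ r| = 2 by have := cardsD1 r C; rewrite C3 Cr => -[].
by rewrite cards1 E => /(_ isT); rewrite C3.
Qed.

(** Without triangles, one of three vertices meets all edges among them. *)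
Lemma block_neq3 C : C \in P -> #|C| != 3.
Proof.
move=> PC; apply/negP=> /eqP C3.
have [u Cu] : exists u, u \in C by apply/card_gt0P; rewrite C3.
have /eqP/cards2P[w [t [wt E]]] : #|C :\ u| = 2.
  by have := cardsD1 u C; rewrite C3 Cu => -[].
have CE : C = [set u; w; t] by rewrite -setUA -E setD1K.
have : w \in C :\ u by rewrite E !inE eqxx.
have : t \in C :\ u by rewrite E !inE eqxx orbT.
rewrite !inE => /andP[tu Ct] /andP[wu Cw].
have ind (r x y : G) : C :\ r \subset [set x; y] -> ~~ adj x y ->
    {in C :\ r &, forall x y, ~~ adj x y}.
  move=> sub nxy x' y' /(subsetP sub) Hx /(subsetP sub) Hy; move: Hx Hy.
  by rewrite !inE => /orP[] /eqP-> /orP[] /eqP->; rewrite ?adj_irrefl // adj_sym.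
have sub (r x y : G) : C = [set r; x; y] -> C :\ r \subset [set x; y].
  move=> ->; apply/subsetP=> z; rewrite !inE => /andP[zr].
  by rewrite (negbTE zr).
case: (boolP (adj w t)) => wtadj; last by apply: (split3 PC C3 Cu); exact: ind (sub _ _ _ CE) wtadj.
case: (boolP (adj u w)) => uw.
  have nut : ~~ adj u t by apply/negP=> ut; exact: (no_triangle hG lam0 uw ut wtadj).
  apply: (split3 PC C3 Cw); apply: (ind w u t) nut; apply: sub.
  by rewrite CE; apply/setP=> z; rewrite !inE; case: (z == u); case: (z == w).
apply: (split3 PC C3 Ct); apply: (ind t u w) uw; apply: sub.
by rewrite CE; apply/setP=> z; rewrite !inE; case: (z == u); case: (z == w); case: (z == t).
Qed.

Lemma card_P_ge : 2 <= #|P|.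
Proof. by have := card_S_ge; move: sq; clear; lia. Qed.

(** The complement would consist of four vertices of S and one vertex i. The
    three neighbours of i are in S and pairwise not adjacent, so the fourth
    vertex of S would be in both of the disjoint edges. *)
Lemma card_compl_neq5 C : k = 3 -> C \in P -> #|~: C| != 5.
Proof.
move=> kE PC; apply/negP=> /eqP C5; have q2 := card_P_ge.
have C'ex : exists C', C' \in P :\ C.
  by apply/set0Pn; rewrite -card_gt0; move: q2; rewrite (cardsD1 C P) PC.
case: C'ex => C'; rewrite !inE => /andP[nC PC'].
have [C'0 _ dS] := barrier_block bar PC'; have [i Ci] := set0Pn _ C'0.
pose N := [set y | adj i y]; have N3 : #|N| = 3 by rewrite hk kE.
have sub : S :|: C' \subset ~: C.
  apply/subsetP=> x; rewrite !inE => /orP[Sx|C'x].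
    by apply: contraL Sx; exact: block_S.
  case/barrierP: bar => _ /and3P[_ /trivIsetP tP _] _.
  by rewrite (disjointFr (tP _ _ PC' PC nC) C'x).
have c5 := subset_leq_card sub; rewrite C5 cardsU disjoint_setI0 1?disjoint_sym // cards0 subn0 in c5.
have S4 := card_S_ge.
have C'1 : C' = [set i].
  apply/eqP; rewrite eq_sym eqEcard sub1set Ci cards1; move: c5 S4; clear; lia.
have C'c : #|C'| = 1 by rewrite C'1 cards1.
have sNS : N \subset S.
  apply/subsetP=> y; rewrite inE => iy; have := block_nbr PC' Ci iy.
  by rewrite C'1 inE; case: eqP => //= F; subst; rewrite adj_irrefl in iy.
have c1 : #|S :\: N| <= 1.
  by rewrite cardsDS // N3; move: c5; rewrite C'c; clear; lia.
have bothN x y : adj x y -> x \in S -> y \in S -> exists2 u, u \in S :\: N & u \in [:: x; y].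
  move=> xy Sx Sy; case: (boolP (adj i x)) => ix; last by exists x; rewrite !inE ?ix ?eqxx.
  case: (boolP (adj i y)) => iy; last by exists y; rewrite !inE ?iy ?eqxx ?orbT.
  by case: (no_triangle hG lam0 ix iy xy).
have [u Su u1] := bothN _ _ xy1 Sx1 Sy1; have [w Sw w1] := bothN _ _ xy2 Sx2 Sy2.
have uw : u != w.
  apply/eqP=> E; subst w; move: un; rewrite (cat_uniq [:: x1; y1] [:: x2; y2]).
  by case/and3P=> _ /hasP[]; exists u.
have : #|[set u; w]| <= #|S :\: N|.
  by apply/subset_leq_card/subsetP=> t; case/set2P=> ->.
by rewrite cards2 uw; move: c1; clear; lia.
Qed.

Variable dd : nat.
Hypothesis ddD : dd <= D.
Hypothesis a_dd : 0 < a dd.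
Hypothesis a_lt : forall i, i < dd -> a i = 0.

Let odd_dist : exists2 i, i <= D & 0 < a i. Proof. by exists dd. Qed.

Lemma big_block C : C \in P -> #|C| != 1 -> 5 <= #|C| /\ 5 <= #|~: C|.
Proof.
move=> PC n1; have n3 := block_neq3 PC; have oC := odd_all PC.
have C0 : 0 < #|C| by rewrite card_gt0; case: (barrier_block bar PC).
split; first by move: n1 n3 oC C0; case: #|C| => [|[|[|[|[|n]]]]].
by have := card_compl_block PC; have := card_P_ge; clear; lia.
Qed.

Lemma cut_block_gt C : C \in P -> #|C| != 1 -> k < cut C.
Proof.
move=> PC n1; have [C5 C5'] := big_block PC n1.
by apply: (cut_gt_k hG D3 k3 lam0 evv (odd_all PC)); apply: ltnW; apply: ltnW.
Qed.

Lemma cut_block_ge C : C \in P -> k <= cut C.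
Proof.
move=> PC; case: (eqVneq #|C| 1) => [/cut_singleton->//|n1].
exact: ltnW (cut_block_gt PC n1).
Qed.

Lemma big_block_cut C : C \in P -> #|C| != 1 -> cut C <= 3 * k - 4 -> k = 3 /\ #|C| = 5.
Proof.
move=> PC n1 le; have [C5 C5'] := big_block PC n1; have oC := odd_all PC.
case/orP: (leq_total #|C| #|~: C|) => leC.
  exact: (cut_small_part hG D3 k3 lam0 evv odd_dist oC C5 leC le).
have oC' : odd #|~: C|.
  by have := congr1 odd (cardsC C); rewrite oddD oC; move: evv; case: odd => //; case: odd.
have := @cut_small_part _ _ _ _ hG D3 k3 lam0 evv odd_dist (~: C) oC' C5'.
rewrite setCK arcsC => /(_ leC le)[kE E5].
by move: (card_compl_neq5 kE PC); rewrite E5.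
Qed.

(** By [sum_cuts] and [cut_block_ge] the cut of C has at most 3 k - 4 arcs, so
    [big_block_cut] applies. The remaining slack excludes a second block of this
    kind. *)
Lemma only_pentagon C : C \in P -> #|C| != 1 ->
  [/\ k = 3, #|C| = 5, cut C = 5, arcs S S = 4 & {in P, forall C', C' != C -> #|C'| = 1}].
Proof.
move=> PC n1; have g4 := arcs_S_ge; have sm := sum_cuts.
rewrite (bigD1 C) //= in sm.
have rest : k * (#|P| - 1) <= \sum_(C' in P | C' != C) cut C'.
  rewrite (_ : #|P| - 1 = #|[set C' in P | C' != C]|).
    rewrite mulnC -sum_nat_const [leqLHS](eq_bigl (fun C' => (C' \in P) && (C' != C))).
      by apply: leq_sum => C' /andP[PC' _]; exact: cut_block_ge.
    by move=> C'; rewrite inE.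
  rewrite (cardsD1 C P) PC addKn; apply: eq_card => C'; rewrite !inE andbC //.
have q2 := card_P_ge.
have bound : k * #|S| <= k * (#|P| - 1) + 3 * k.
  apply: leq_trans (leq_mul (leqnn k) sq) _.
  have -> : #|P| + 2 = #|P| - 1 + 3 by move: q2; clear; lia.
  by rewrite mulnDr [k * 3]mulnC.
have le9 : cut C + arcs S S <= 3 * k.
  move: sm rest bound; clear.
  by set t := k * _; set s := k * _; set u := bigop _ _ _; lia.
have [kE C5] : k = 3 /\ #|C| = 5.
  by apply: big_block_cut => //; move: le9 g4; clear; lia.
have odd_cut5 C' : C' \in P -> #|C'| != 1 -> 5 <= cut C'.
  move=> PC' n1'; have := cut_block_gt PC' n1'; have := odd_cut hG C'.
  by rewrite kE odd_all //; case: (cut C') => [|[|[|[|[|n]]]]].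
have cC5 := odd_cut5 _ PC n1.
have [cE gE] : cut C = 5 /\ arcs S S = 4 by move: le9 cC5 g4; rewrite kE; clear; lia.
split=> // C' PC' nC; apply/eqP/negPn/negP=> n1'; have cC5' := odd_cut5 _ PC' n1'.
rewrite (bigD1 C') /= in sm; last by rewrite PC'.
have rest2 : k * (#|P| - 2) <= \sum_(B in P | (B != C) && (B != C')) cut B.
  rewrite (_ : #|P| - 2 = #|P :\ C :\ C'|).
    rewrite mulnC -sum_nat_const [leqLHS](eq_bigl (fun B => (B \in P) && ((B != C) && (B != C')))).
      by apply: leq_sum => B /andP[PB _]; exact: cut_block_ge.
    by move=> B; rewrite !inE; case: (B \in P); rewrite ?andbT ?andbF //= andbC.
  by rewrite (cardsD1 C P) PC (cardsD1 C' (P :\ C)) !inE nC PC' addnA addKn.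
rewrite (eq_bigl (fun B => (B \in P) && ((B != C) && (B != C')))) in sm; last first.
  by move=> B; rewrite andbA.
move: sm rest2 cC5' bound q2; rewrite kE cE gE; clear.
by set s := #|S|; set u := bigop _ _ _; set w := arcs _ _; set p := #|P|; lia.
Qed.

(** Let q and r be the neighbours of a vertex p in the pentagon C. Then X, which
    is S with q and r, spans four edges, and its complement spans only the edge
    of C opposite to p. As C makes the odd girth 5, [max_cut_bound] yields #|G|
    <= 16, whereas #|G| is even, a multiple of 5 and larger than 10. *)
Lemma no_barrier_pentagon C : C \in P -> #|C| != 1 -> False.
Proof.
move=> PC n1; have [kE C5 cut5 gE all1] := only_pentagon PC n1.
have hG3 := hG; have lam3 := lam0; have evv' := evv; have aE := a_dd; have aL := a_lt.
have hk3 := hk; rewrite kE in hG3 lam3 aE aL hk3.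
have c21 : c 2 = 1.
  have := c2_bound hG D3 k3 lam0 evv odd_dist; rewrite kE.
  by have := c_gt0 hG (i := 2); rewrite (ltnW D3) => /(_ isT); clear; lia.
have deg2 : {in C, forall x, deg_in x C = 2}.
  by move=> x; exact: (pentagon_degree hG3 lam3 c21 C5 cut5).
have [p [q [r [q2 [r2 [EC uC [pq pr q2r2] [qq2 rr2 dq dr]]]]]]] :=
  pentagon hG3 lam3 c21 C5 deg2.
have dd2 : dd = 2.
  apply/eqP; rewrite eqn_leq (dd_ge2 hG lam0 a_dd) andbT -dq.
  by apply: (equidistant_adj hG a_lt q2r2); rewrite dq dr.
have memC x : x \in [:: p; q; r; q2; r2] -> x \in C by rewrite EC.
have [Cp Cq Cr] : [/\ p \in C, q \in C & r \in C] by split; apply: memC; rewrite !inE eqxx ?orbT.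
have [Cq2 Cr2] : q2 \in C /\ r2 \in C by split; apply: memC; rewrite !inE eqxx ?orbT.
have tri x y z : adj x y -> adj x z -> ~~ adj y z.
  by move=> xy xz; apply/negP=> yz; exact: (no_triangle hG lam0 xy xz yz).
have nqr : q != r by move: uC; rewrite /= !inE !negb_or; case/and5P=> _ /and3P[].
pose X := S :|: [set q; r].
have dSC : [disjoint S & [set q; r]].
  rewrite disjoint_sym disjoints_subset; apply/subsetP=> x; rewrite !inE.
  by case/orP=> /eqP->; [exact: block_S Cq|exact: block_S Cr].
have degS x : x \in C -> deg_in x S = 1.
  move=> Cx; rewrite -(deg_out_block PC Cx); have := deg_inC x C hk3.
  by rewrite deg2 //; clear; lia.
have aX : arcs X X = 8.
  have qr0 : arcs [set q; r] [set q; r] = 0.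
    apply: big1 => x hx; apply/eqP; rewrite cards_eq0; apply/eqP/setP=> y; rewrite !inE.
    apply/negP=> /andP[hy]; apply/negP; move: hx hy; rewrite !inE.
    case/orP=> /eqP-> /orP[] /eqP->; rewrite ?adj_irrefl //; first exact: tri pq pr.
    exact: tri pr pq.
  rewrite /X arcsUl // !(arcsUr _ dSC) gE qr0 [arcs S _]arcsC.
  by rewrite {1 2}/arcs big_setU1 ?inE // big_set1 !degS.
have aX' : arcs (~: X) (~: X) <= 2.
  have -> : 2 = #|[set q2; r2]|.
    by rewrite cards2; move: uC; rewrite /= !inE !negb_or => /and5P[_ _ _ -> _].
  rewrite -sum1_card /arcs big_mkcond [leqRHS]big_mkcond /=; apply: leq_sum => x _.
  case: ifP => // nX; rewrite in_set2.
  have nbrX y : y \in ~: X -> adj x y -> ((x == q2) && (y == r2)) || ((x == r2) && (y == q2)).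
    move: nX; rewrite !inE !negb_or => /and3P[nSx nxq nxr] /and3P[nSy nyq nyr] xy.
    have : x \in cover P by rewrite coverP_S inE.
    case/bigcupP=> C' PC' C'x; have C'y : y \in C'.
      by have := block_nbr PC' C'x xy; rewrite (negbTE nSy) orbF.
    case: (eqVneq C' C) => [E|nC]; last first.
      have /eqP/cards1P[u Eu] := all1 _ PC' nC; move: C'x C'y xy; rewrite Eu.
      by move=> /set1P-> /set1P->; rewrite adj_irrefl.
    have qp : adj q p by rewrite adj_sym.
    have rp : adj r p by rewrite adj_sym.
    have npq2 := tri _ _ _ qp qq2; have npr2 := tri _ _ _ rp rr2.
    subst C'; move: C'x C'y xy; rewrite !EC !inE (negbTE nxq) (negbTE nxr) (negbTE nyq) (negbTE nyr) /=.
    case/or3P=> /eqP-> /or3P[] /eqP->; rewrite ?adj_irrefl ?eqxx ?orbT //.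
    - by rewrite (negbTE npq2).
    - by rewrite (negbTE npr2).
    - by rewrite adj_sym (negbTE npq2).
    - by rewrite adj_sym (negbTE npr2).
  case: (boolP ((x == q2) || (x == r2))) => hx.
    rewrite -(cards1 (if x == q2 then r2 else q2)).
    apply/subset_leq_card/subsetP=> y; rewrite [y \in _]inE => /andP[hy xy].
    rewrite inE; have := nbrX _ hy xy; case: (eqVneq x q2) => //= [E|_]; last by case/andP.
    by case/orP=> // /andP[/eqP E2 /eqP->]; rewrite -E E2.
  rewrite leqn0 cards_eq0; apply/eqP/setP=> y; rewrite inE [in RHS]inE.
  apply/negP=> /andP[hy xy]; have := nbrX _ hy xy; move: hx; rewrite negb_or.
  by case/andP=> /negbTE-> /negbTE->.
have := max_cut_bound hG ddD a_dd X (ltnW (dd_ge2 hG lam0 a_dd)).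
rewrite kE dd2 aX => le.
have v16 : #|G| <= 16 by move: le aX'; clear; lia.
have v10 := card_graph_gt hG D3 k3 lam0 evv ddD a_dd a_lt; rewrite dd2 in v10.
rewrite dd2 in aE; case/dvdnP: (five_dvd_order hG3 D3 lam3 c21 aE) => m Em.
by move: v16 v10 evv; rewrite Em; case: m {Em} => [|[|[|[|m]]]] //; clear; lia.
Qed.

(** If all blocks are single vertices, the only edges that do not join S to its
    complement are k edges inside S, and the odd girth is too large for the
    order of the graph. *)
Lemma no_barrier_odd : False.
Proof.
case: (boolP [forall C in P, #|C| == 1]) => [/forall_inP all1|].
  have [ind sE gE] : [/\ {in ~: S &, forall x y, ~~ adj x y}, #|~: S| + 2 = #|S| & arcs S S = 2 * k].
    by apply: independent_blocks => C /all1/eqP.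
  have aC0 : arcs (~: S) (~: S) = 0.
    apply: big1 => x Sx; apply/eqP; rewrite cards_eq0; apply/eqP/setP=> y.
    by rewrite !inE; apply/negP=> /andP[Sy]; apply/negP; apply: ind; rewrite // inE.
  have := max_cut_bound hG ddD a_dd S (ltnW (dd_ge2 hG lam0 a_dd)).
  rewrite gE aC0 addn0 mulnA leq_pmul2r ?(ltn_trans _ k3) //.
  by have := card_graph_gt hG D3 k3 lam0 evv ddD a_dd a_lt; clear; lia.
rewrite negb_forall_in => /exists_inP[C PC n1]; exact: no_barrier_pentagon n1.
Qed.

End Barriers.

(** * Matchings as sets of edges *)

Section Matchings.
Variable G : sgraph.
Implicit Types (x y z : G) (M : {set {set G}}).

Lemma edge_set x y : adj x y -> [set x; y] \in edges G.
Proof. by move=> xy; apply/imsetP; exists (x, y); rewrite ?inE. Qed.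

Lemma edgeP (A : {set G}) : A \in edges G -> exists x y, adj x y /\ A = [set x; y].
Proof. by case/imsetP=> -[x y]; rewrite inE => xy ->; exists x, y. Qed.

Lemma matching2P M : matching M -> #|M| = 2 -> exists x1 y1 x2 y2,
  [/\ adj x1 y1, adj x2 y2, uniq [:: x1; y1; x2; y2] & M = [set [set x1; y1]; [set x2; y2]]].
Proof.
case=> sM tM /eqP/cards2P[A [B [nAB E]]]; rewrite {}E in sM tM *.
have /edgeP[x1 [y1 [xy1 EA]]] := subsetP sM A (set21 A B).
have /edgeP[x2 [y2 [xy2 EB]]] := subsetP sM B (set22 A B).
exists x1, y1, x2, y2; split; rewrite -?EA -?EB //.
have irr x y : adj x y -> x != y by apply: contraTneq => ->; rewrite adj_irrefl.
have dAB : [disjoint A & B].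
  by move/trivIsetP: tM; apply; rewrite ?set21 ?set22.
have ne x y : x \in A -> y \in B -> x != y.
  by move=> Ax By; apply: contraTneq Ax => ->; rewrite (disjointFl dAB).
rewrite /= !inE !negb_or (irr _ _ xy1) (irr _ _ xy2) !ne //.
all: by rewrite ?EA ?EB !inE eqxx ?orbT.
Qed.

Lemma matching2 x1 y1 x2 y2 : adj x1 y1 -> adj x2 y2 -> uniq [:: x1; y1; x2; y2] ->
  matching [set [set x1; y1]; [set x2; y2]] /\ #|[set [set x1; y1]; [set x2; y2]]| = 2.
Proof.
move=> xy1 xy2 un; have dAB : [disjoint [set x1; y1] & [set x2; y2]].
  rewrite -setI_eq0; apply/eqP/setP=> z; rewrite !inE; apply/negP=> /andP[h1 h2].
  move: un; rewrite (cat_uniq [:: x1; y1] [:: x2; y2]) => /and3P[_ /hasP[]].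
  by exists z; rewrite !inE.
have ne : [set x1; y1] != [set x2; y2].
  apply: contraTneq dAB => <-; rewrite -setI_eq0 setIid; apply/set0Pn; exists x1.
  by rewrite set21.
split; last by rewrite cards2 ne.
split; first by apply/subsetP=> A /set2P[] ->; exact: edge_set.
apply/trivIsetP=> A B /set2P[]-> /set2P[]->; rewrite ?eqxx // => _.
by rewrite disjoint_sym.
Qed.

Lemma perfect_matching_extension M :
  matching M -> perfectly_matched (@adj G) (~: cover M) ->
  exists P, perfect_matching P /\ M \subset P.
Proof.
case=> sM tM [f hf]; pose N := [set [set x; f x] | x in ~: cover M].
have cN : cover N = ~: cover M.
  apply/setP=> x; apply/bigcupP/idP=> [[_ /imsetP[y Uy ->]]|Ux].
    by case/set2P=> ->; rewrite ?(hf _ Uy) //; case: (hf _ Uy).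
  by exists [set x; f x]; [apply/imsetP; exists x|rewrite set21].
have NE A z : A \in N -> z \in A -> A = [set z; f z].
  by case/imsetP=> x Ux -> /set2P[->//|->]; case: (hf _ Ux) => _ _ ->; rewrite setUC.
exists (M :|: N); split; last exact: subsetUl.
split; last by rewrite /cover bigcup_setU -!/(cover _) cN setUCr.
split.
  rewrite subUset sM; apply/subsetP=> _ /imsetP[x Ux ->]; apply: edge_set.
  by case: (hf _ Ux).
have dMN A B z : A \in M -> B \in N -> z \in A -> z \notin B.
  move=> MA NB Az; have : z \notin cover N.
    by rewrite cN inE negbK; apply/bigcupP; exists A.
  by apply: contra => Bz; apply/bigcupP; exists B.
apply/trivIsetP=> A B hA hB nAB; rewrite -setI_eq0.
apply/eqP/setP=> z; rewrite !inE; apply/negP=> /andP[Az Bz].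
case/setUP: hA => hA; case/setUP: hB => hB.
- by move/trivIsetP/(_ _ _ hA hB nAB): tM => /disjointFr/(_ Az); rewrite Bz.
- by case/negP: (dMN _ _ _ hA hB Az).
- by case/negP: (dMN _ _ _ hB hA Bz).
- by rewrite (NE _ _ hA Az) (NE _ _ hB Bz) eqxx in nAB.
Qed.

End Matchings.

(** * Extending two disjoint edges *)

Section Extension.
Variables (G : sgraph) (k : nat) (b c : nat -> nat).
Hypothesis hG : drg G k b c.
Hypothesis D3 : 2 < diameter G.
Hypothesis k3 : 2 < k.
Hypothesis evv : ~~ odd #|G|.
Implicit Types (x y z : G) (S C R W : {set G}) (P Q : {set {set G}}).

(** Tutte's theorem gives a barrier of the complement of W whose odd blocks
    outnumber its vertices, by at least 2 for parity reasons. Adding W to it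
    gives a barrier of the whole graph. Among all such barriers that contain W
    take one with #|S| + #|P| largest; by [barrier_refine] no block has a
    barrier that could be added, and an even block would have one, formed by any
    of its vertices. *)
Lemma maximal_barrier W : ~~ odd #|W| -> ~ perfectly_matched (@adj G) (~: W) ->
  exists S P, [/\ barrier (@adj G) [set: G] S P, W \subset S,
    {in P, forall C : {set G}, odd #|C|}, #|S| + 2 <= #|P| + #|W| &
    forall C R Q, C \in P -> barrier (@adj G) C R Q ->
      #|R| + 1 <= odd_blocks Q -> #|R| + #|Q| <= 1].
Proof.
move=> evW npm; pose good (X : {set G} * {set {set G}}) :=
  [&& barrier (@adj G) [set: G] X.1 X.2, W \subset X.1 & #|X.1| + 2 <= odd_blocks X.2 + #|W|].
have [X0 good0] : exists X, good X.
  case: (boolP [forall S, forall P, barrier (@adj G) (~: W) S P ==> (odd_blocks P <= #|S|)]) => [all|].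
    case: npm; apply: tutte; first exact: adj_sym.
    by move=> S P bSP; move/forallP/(_ S)/forallP/(_ P)/implyP: all; apply.
  rewrite negb_forall => /existsP[S]; rewrite negb_forall => /existsP[P].
  rewrite negb_imply -ltnNge => /andP[bSP lt]; exists (S :|: W, P).
  have /barrierP[sSW pP nP] := bSP.
  have dSW : [disjoint S & W] by rewrite disjoints_subset.
  apply/and3P; split=> /=; last first.
  - have := barrier_parity bSP; have := congr1 odd (cardsC W).
    rewrite cardsU (disjoint_setI0 dSW) cards0 subn0 oddD (negbTE evv) (negbTE evW) /= => -> /=.
    move: lt; clear; set o := odd_blocks P; set s := #|S| => lt E.
    suff : s.+2 <= o by lia.
    by rewrite ltn_neqAle lt andbT; apply: contra_eq_neq E => <-; rewrite /=; case: odd.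
  - exact: subsetUr.
  apply/barrierP; split=> //.
  by rewrite setTD setCU setIC -setDE.
case: (arg_maxnP (fun X : {set G} * {set {set G}} => #|X.1| + #|X.2|) good0) => [[S P]].
case/and3P=> /= bar sWS le maxi; exists S, P.
have key C R Q : C \in P -> barrier (@adj G) C R Q ->
    #|R| + odd #|C| <= odd_blocks Q -> #|R| + #|Q| <= 1.
  move=> PC bQ leQ; have [bar' cS oP] := barrier_refine (@adj_sym G) bar PC bQ.
  have cP := card_refine bar PC bQ.
  have := maxi (S :|: R, P :\ C :|: Q); rewrite /good /= bar' cS.
  rewrite (subset_trans sWS) ?subsetUl //=.
  have -> : #|S| + #|R| + 2 <= odd_blocks (P :\ C :|: Q) + #|W|.
    by move: le leQ oP; clear; lia.
  have arith (s r p q n : nat) : n + 1 = p + q -> s + r + n <= s + p -> r + q <= 1 by lia.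
  by move=> /(_ isT); exact: arith cP.
have odd_all : {in P, forall C : {set G}, odd #|C|}.
  move=> C PC; apply/negPn/negP=> evC; have [C0 _ _] := barrier_block bar PC.
  have [x Cx] := set0Pn _ C0; have cC := cardsD1 x C; rewrite Cx in cC.
  have oC : odd #|C :\ x| by move: evC; rewrite cC /= negbK.
  have Cx0 : C :\ x != set0 by apply: contraTneq oC => ->; rewrite cards0.
  have [bQ cR] := barrierU1 Cx (barrier_block1 (@adj G) Cx0).
  by have := key _ _ _ PC bQ; rewrite odd_blocks1 oC (negbTE evC) cR cards0 cards1 => /(_ isT).
split=> //; first by rewrite -(odd_blocks_all odd_all).
by move=> C R Q PC bQ leQ; apply: (key C) => //; rewrite odd_all.
Qed.

(** With triangles, [lambda_bound] excludes valency 3 and leaves one triangle on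
    each edge for valency 4. Without triangles the graph is bipartite, or there
    is a smallest dd with a dd > 0. *)
Lemma no_barrier S P x1 y1 x2 y2 :
  barrier (@adj G) [set: G] S P -> {in P, forall C : {set G}, odd #|C|} -> #|S| <= #|P| + 2 ->
  x1 \in S -> y1 \in S -> x2 \in S -> y2 \in S -> adj x1 y1 -> adj x2 y2 ->
  uniq [:: x1; y1; x2; y2] ->
  (forall C R Q, C \in P -> barrier (@adj G) C R Q ->
      #|R| + 1 <= odd_blocks Q -> #|R| + #|Q| <= 1) -> False.
Proof.
move=> bar odd_all sq Sx1 Sy1 Sx2 Sy2 xy1 xy2 un maxi.
case: (posnP (a_ k b c 1)) => [lam0|lam].
  case: (boolP [forall i : 'I_(diameter G).+1, a_ k b c i == 0]) => [/forallP a00|].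
    apply: (no_barrier_bipartite hG D3 k3 evv bar odd_all sq Sx1 Sy1 Sx2 Sy2 xy1 xy2 un maxi).
    by move=> i iD; apply/eqP; exact: (a00 (Ordinal (iD : i < _.+1))).
  rewrite negb_forall => /existsP[i0]; rewrite -lt0n => ai0.
  have ex : exists i, 0 < a_ k b c i by exists i0.
  case: (ex_minnP ex) => dd a_dd min_dd.
  apply: (no_barrier_odd hG D3 k3 evv bar odd_all sq Sx1 Sy1 Sx2 Sy2 xy1 xy2 un maxi lam0 (dd := dd)) => //.
    by apply: leq_trans (min_dd _ ai0) _; rewrite -ltnS.
  by move=> i lti; apply/eqP; rewrite -leqn0 leqNgt; apply: contraL lti => /min_dd; rewrite leqNgt.
have lb := lambda_bound hG D3 k3.
have [k5|k4] := leqP 5 k.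
  exact: (no_barrier_triangles hG D3 k3 evv bar odd_all sq Sx1 Sy1 Sx2 Sy2 xy1 xy2 un).
have kE : k = 4 by move: lb lam k4; clear; lia.
have lam1 : a_ k b c 1 = 1 by move: lb lam; rewrite {2}kE; clear; lia.
by have := hG; rewrite kE in lam1 * => hG4; have := odd_order hG4 D3 lam1; rewrite (negbTE evv).
Qed.

Lemma extension M : matching M -> #|M| = 2 -> exists P, perfect_matching P /\ M \subset P.
Proof.
move=> hM M2; apply: perfect_matching_extension => //.
case: (boolP [exists f : {ffun G -> G}, [forall x in ~: cover M,
    [&& f x \in ~: cover M, adj x (f x) & f (f x) == x]]]) => [/existsP[f /forall_inP h]|npm].
  by exists f => x /h /and3P[? ? /eqP].
case: (matching2P hM M2) => x1 [y1 [x2 [y2 [xy1 xy2 un EM]]]].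
have cM : cover M = [set x in [:: x1; y1; x2; y2]].
  rewrite EM /cover big_setU1 ?big_set1 /=; last first.
    rewrite inE; apply: contraTneq un => /setP/(_ x1); rewrite !inE eqxx => /esym.
    by case/orP=> /eqP->; rewrite /= !inE eqxx ?orbT.
  by apply/setP=> x; rewrite !inE -!orbA.
have W4 : #|cover M| = 4 by rewrite cM cardsE; apply/card_uniqP.
case: (@maximal_barrier (cover M)) => [||S [P [bar sWS odd_all sq maxi]]].
- by rewrite W4.
- case=> f hf; case/negP: npm; apply/existsP; exists (finfun f).
  by apply/forall_inP=> x Ux; rewrite !ffunE; have [-> -> ->] := hf _ Ux; rewrite eqxx.
case: (@no_barrier S P x1 y1 x2 y2) => //.
  by move: sq; rewrite W4; clear; lia.
all: by apply: (subsetP sWS); rewrite cM !inE eqxx ?orbT.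
Qed.

End Extension.

Theorem mainTheorem1 (G : sgraph) (k : nat)
  (hdr : distance_regular G) (heven : ~~ odd #|G|)
  (hval : valency G k) (hk : 3 <= k) (hD : 3 <= diameter G) :
  extendable G 2.
Proof.
have [b [c hG]] := distance_regular_drg hdr hval.
have [v8 _] := card_graph_ge hG hD hk.
split.
- by split=> //; case: hdr.
- have [x [y [z [w [[xy yz zw Exw] [Exz Eyw]]]]]] := path3 hG hD hk.
  have conn : connected G by case: hdr.
  have irr (u u' : G) : adj u u' -> u != u' by apply: contraTneq => ->; rewrite adj_irrefl.
  have un : uniq [:: x; y; z; w].
    rewrite /= !inE !negb_or (irr _ _ xy) (irr _ _ yz) (irr _ _ zw).
    by rewrite -!(gdist_eq0 conn) Exz Exw Eyw.
  have [hM M2] := matching2 xy zw un.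
  by have [P [PM _]] := extension hG hD hk heven hM M2; exists P.
- by move: v8 hk; clear; lia.
by move=> M hM M2; exact: (extension hG hD hk heven hM M2).
Qed.
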